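(* Let $W\in\mathcal W[0,\infty)$ with $\operatorname{tr}W=0$. Assume that there are $r>0$ and a holomorphic function $M:\{w\in\mathbb C:|w|<r\}\to\overline{\mathbb C^+}$ such that $m_+(z;W)=M(-1/z)$ for all $z\in\mathbb C^+$ with $|z|>1/r$. Then $W(x)$ is real analytic. More precisely, there is an $h>0$ such that the entries of $W(x)$ have holomorphic continuations $W(z)$ to the rounded strip $S=\{z\in\mathbb C:|z-x|<h\text{ for some }x>0\}$. Moreover, for every $n\ge0$ there is a constant $B_n$ such that $\|W^{(n)}(x)\|\le B_n$ for all $x\ge0$.
   Context: $\mathbb C^{+}$ is the open upper half plane, $\overline{\mathbb C^+}=\mathbb C^+\cup\mathbb R\cup\{\infty\}$ is a subset of the Riemann sphere $\mathbb C_\infty$. $\mathcal W[0,\infty)$ is the set of Dirac potentials on $[0,\infty)$: functions $W:[0,\infty)\to\mathbb R^{2\times2}$ with $W(x)=W^t(x)$ and $W\in L^1_{\mathrm{loc}}[0,\infty)$; potentials that agree almost everywhere are identified. The Dirac equation is $Jy'(x)+W(x)y(x)=-zy(x)$ with $J=\begin{pmatrix}0&-1\\1&0\end{pmatrix}$. For $z\in\mathbb C^+$, let $f_+(\cdot,z)$ be the (unique up to a constant factor) nontrivial solution in $L^2((0,\infty);\mathbb C^2)$. The half line $m$ function is $m_+(z;W)=f_+(0,z)$, where a vector $(f_1,f_2)^t\ne0$ is identified with $f_1/f_2\in\mathbb C_\infty$; it maps $\mathbb C^+$ holomorphically to $\mathbb C^+$. $\|\cdot\|$ is the operator norm. *)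

(* Defs.v *)
From HB Require Import structures.
From mathcomp Require Import all_boot all_order all_algebra.
From mathcomp Require Import all_classical all_reals all_analysis.
From mathcomp Require Import complex.

Set Implicit Arguments.
Unset Strict Implicit.
Unset Printing Implicit Defensive.

Import Order.TTheory GRing.Theory Num.Theory.
Import numFieldNormedType.Exports.

Local Open Scope classical_set_scope.
Local Open Scope ring_scope.
Local Open Scope complex_scope.

Section Complex.
Context {R : realType}.
Implicit Types z w : R[i].

Definition upper_half_plane : set R[i] := [set z | 0 < complex.Im z].

Definition holomorphic_at (f : R[i] -> R[i]) z : Prop :=
  derivable (f : R[i]^o -> R[i]^o) z 1.

Definition rounded_strip (h : R) : set R[i] :=
  [set z | exists2 x : R, 0 < x & `|z - x%:C| < h%:C].

(* The Riemann sphere; None is the point at infinity. *)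
Definition sphere : Type := one_point_compactification R[i].

Definition closed_upper_half_plane : set sphere :=
  [set p | if p is Some z then 0 <= complex.Im z else True].

(* The two charts p |-> p and p |-> 1/p of the sphere, with the junk value 0
   at infinity, respectively at 0. *)
Definition chart (p : sphere) : R[i] := if p is Some z then z else 0.
Definition chart_inv (p : sphere) : R[i] := if p is Some z then z^-1 else 0.

Definition sphere_holomorphic_at (M : R[i] -> sphere) w : Prop :=
  ((\forall u \near (w : R[i]^o), M u <> None) /\
     holomorphic_at (chart \o M) w) \/
  ((\forall u \near (w : R[i]^o), M u <> Some 0) /\
     holomorphic_at (chart_inv \o M) w).

(* A vector (v1, v2)^t <> 0 is identified with v1 / v2. *)
Definition sphere_of_vec (v : 'cV[R[i]]_2) : sphere :=
  if v 1 0 == 0 then None else Some (v 0 0 / v 1 0).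

End Complex.

Arguments sphere : clear implicits.
Arguments closed_upper_half_plane R : clear implicits.
Arguments upper_half_plane R : clear implicits.

Section RealFunctions.
Context {R : realType}.

Definition absolutely_continuous (f : R -> R) (a b : R) : Prop :=
  forall e : R, 0 < e -> exists2 d : R, 0 < d &
    forall (n : nat) (l u : 'I_n -> R),
      (forall i, [/\ a <= l i, l i <= u i & u i <= b]) ->
      (forall i j, i != j -> u i <= l j \/ u j <= l i) ->
      \sum_(i < n) (u i - l i) < d ->
      \sum_(i < n) `|f (u i) - f (l i)| < e.

Definition real_analytic_at (f : R -> R) (x : R) : Prop :=
  exists (a : nat -> R), exists2 d : R, 0 < d &
    forall t : R, `|t| < d -> pseries a t @ \oo --> f (x + t).

Definition euclidean_norm (n : nat) (v : 'cV[R]_n) : R :=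
  Num.sqrt (\sum_(i < n) v i 0 ^+ 2).

Definition operator_norm (m n : nat) (A : 'M[R]_(m, n)) : R :=
  sup [set euclidean_norm (A *m v) | v in
         [set v : 'cV[R]_n | euclidean_norm v <= 1]].

Definition mxderiven (n : nat) (p q : nat) (V : R -> 'M[R]_(p, q)) (x : R) :
    'M[R]_(p, q) :=
  \matrix_(i, j) derive1n n (fun t : R => V t i j) x.

End RealFunctions.

Section Dirac.
Context {R : realType}.
Local Notation mu := (@lebesgue_measure R).

(* Potentials on [0, oo) are represented by functions on R whose values on
   the negative half line play no role; since they are only determined up to
   null sets, pointwise conditions are imposed almost everywhere. *)
Definition dirac_potential (W : R -> 'M[R]_2) : Prop :=
  (forall i j (b : R), 0 <= b ->
     mu.-integrable `[0, b] (EFin \o (fun x : R => W x i j))) /\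
  {ae mu, forall x : R, 0 <= x -> (W x)^T = W x}.

(* The matrix with rows (0, -1) and (1, 0). *)
Definition dirac_J : 'M[R[i]]_2 := \matrix_(i, j) (i%:R - j%:R).

Definition Re_entry (y : R -> 'cV[R[i]]_2) (i : 'I_2) : R -> R :=
  fun x => complex.Re (y x i 0).
Definition Im_entry (y : R -> 'cV[R[i]]_2) (i : 'I_2) : R -> R :=
  fun x => complex.Im (y x i 0).

Definition vec_derive (y : R -> 'cV[R[i]]_2) (x : R) : 'cV[R[i]]_2 :=
  \col_i (derive1 (Re_entry y i) x +i* derive1 (Im_entry y i) x).

(* J y' + W y = - z y on [0, oo), in the Caratheodory sense. *)
Definition dirac_solution (W : R -> 'M[R]_2) (z : R[i])
    (y : R -> 'cV[R[i]]_2) : Prop :=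
  (forall i (b : R), 0 <= b ->
     absolutely_continuous (Re_entry y i) 0 b /\
     absolutely_continuous (Im_entry y i) 0 b) /\
  {ae mu, forall x : R, 0 <= x ->
     (forall i, derivable (Re_entry y i) x 1 /\
                derivable (Im_entry y i) x 1) /\
     dirac_J *m vec_derive y x + map_mx (real_complex R) (W x) *m y x
       = - z *: y x}.

Definition square_integrable (y : R -> 'cV[R[i]]_2) : Prop :=
  (\int[mu]_(x in `[0%R, +oo[)
     (\sum_(i < 2) (Re_entry y i x ^+ 2 + Im_entry y i x ^+ 2))%:E < +oo)%E.

Definition weyl_solution (W : R -> 'M[R]_2) (z : R[i])
    (f : R -> 'cV[R[i]]_2) : Prop :=
  [/\ dirac_solution W z f, square_integrable f &
      exists2 x : R, 0 <= x & f x != 0].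

(* The value f_+(0, z) in the Riemann sphere. For z in the upper half plane a
   Weyl solution exists and is unique up to a constant factor, hence the
   default value -i is not taken there. *)
Definition m_plus (W : R -> 'M[R]_2) (z : R[i]) : sphere R :=
  xget (Some (0 -i* 1) : sphere R)
    [set p | exists2 f, weyl_solution W z f & p = sphere_of_vec (f 0)].

End Dirac.

(* Main.v *)
(* With u = f1 + i f2, v = f1 - i f2 and q = i (W00 + i W01) the Dirac equation
   becomes u' = i z u + q v, v' = - i z v + conj q u.  In the variable w = -1/z the
   Cayley transform s = v / u of the half line m function m_+(z; W(x + .)) solves the
   Riccati equation s' = 2 i s / w + conj q - q s^2 in x.  At x = 0 it extends to a
   holomorphic function of modulus at most 1 on |w| < r.  This persists for all x > 0:
   for Im w <= 0 because |u|^2 - |v|^2 is then nondecreasing in x, for Im w > 0 because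
   the Weyl solution is square integrable.  Hence s(x, w) = sum a_n(x) w^n with
   |a_n(x)| <= (2/r)^n for all x, and comparing coefficients in the Riccati equation
   gives a_0 = 0, conj q = - 2 i a_1 and a_n' = 2 i a_(n+1) - q sum_j a_j a_(n-j) for
   n > 0.  If a_n has weight n, every differentiation raises the weight by one, which
   bounds the n-th derivative of a_1, and thus of W, by C n! (4/r)^n on the half line. *)
Require Import Defs.
From HB Require Import structures.
From mathcomp Require Import all_boot all_order all_algebra.
From mathcomp Require Import all_classical all_reals all_analysis.
From mathcomp Require Import measurable_realfun complex ring lra.

Set Implicit Arguments.
Unset Strict Implicit.
Unset Printing Implicit Defensive.

Import Order.TTheory GRing.Theory Num.Theory.
Import numFieldNormedType.Exports.

Local Open Scope classical_set_scope.
Local Open Scope ring_scope.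
Local Open Scope complex_scope.

(** Since [W] is only locally integrable, the Riccati equation holds only almost everywhere in x,
    and its coefficients cannot be compared at once. They are compared in the integrated equation as
    w tends to 0: this shows that a_0 = 0, then that q agrees almost everywhere with a continuous
    function. Only after that do the a_n become continuously differentiable. The other obstacle is
    holomorphy in w, because a Weyl solution at z = -1/w is at hand only for Im w > 0. Therefore the
    solution with initial values (1, s(0, w)) is propagated for every w. It depends holomorphically
    on w outside 0, and where a Weyl solution exists it is proportional to it. At w = 0 the equation
    is singular, so s(x, .) is known as a bounded holomorphic function on a punctured disc. Its
    coefficients are Cauchy integrals over the circle of radius r/2, which is the origin of the
    constant 2/r. *)

Local Notation nm := ComplexField.Normc.normc.

(** * The real-valued modulus of a complex number *)

Section NormC.
Context {R : realType}.
Implicit Types x y z : R[i].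

(** The library norm is an element of [R[i]], whose order is partial. Estimates are carried out with
    the real number [nm z], and this equation translates between the two. *)
Lemma normrE_nm z : `|z| = (nm z)%:C. Proof. by rewrite normc_def; case: z. Qed.

Lemma nm_ge0 z : 0 <= nm z. Proof. by case: z => a b; exact: sqrtr_ge0. Qed.
Lemma nm0 : nm (0 : R[i]) = 0. Proof. exact: ComplexField.Normc.normc0. Qed.
Lemma nm1 : nm (1 : R[i]) = 1. Proof. exact: ComplexField.Normc.normc1. Qed.
Lemma nmM x y : nm (x * y) = nm x * nm y.
Proof. exact: ComplexField.Normc.normcM. Qed.
Lemma nmV x : nm x^-1 = (nm x)^-1. Proof. exact: ComplexField.Normc.normcV. Qed.
Lemma nmN x : nm (- x) = nm x. Proof. exact: normcN. Qed.
Lemma nmD x y : nm (x + y) <= nm x + nm y. Proof. exact: le_normcD. Qed.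
Lemma nmB x y : nm (x - y) <= nm x + nm y.
Proof. by rewrite -(nmN y); exact: nmD. Qed.
Lemma nmC x y : nm (x - y) = nm (y - x). Proof. by rewrite -nmN opprB. Qed.
Lemma nm_eq0 x : (nm x == 0) = (x == 0).
Proof.
by apply/eqP/eqP => [/ComplexField.Normc.eq0_normc//|->]; exact: nm0.
Qed.
Lemma nm_gt0 x : (0 < nm x) = (x != 0).
Proof. by rewrite lt_def nm_eq0 nm_ge0 andbT. Qed.
Lemma nmX x n : nm (x ^+ n) = nm x ^+ n.
Proof. by elim: n => [|n IH]; rewrite ?expr0 ?nm1// !exprS nmM IH. Qed.
Lemma nm_sqr x : nm x ^+ 2 = complex.Re x ^+ 2 + complex.Im x ^+ 2.
Proof. by case: x => a b; rewrite sqr_sqrtr// addr_ge0// sqr_ge0. Qed.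
Lemma nm_Re x : `|complex.Re x| <= nm x.
Proof.
rewrite -(@ler_pXn2r _ 2)// ?nnegrE ?nm_ge0// nm_sqr real_normK ?num_real//.
by rewrite lerDl sqr_ge0.
Qed.
Lemma nm_Im x : `|complex.Im x| <= nm x.
Proof.
rewrite -(@ler_pXn2r _ 2)// ?nnegrE ?nm_ge0// nm_sqr real_normK ?num_real//.
by rewrite lerDr sqr_ge0.
Qed.
Lemma nm_real (a : R) : nm a%:C = `|a|.
Proof. by rewrite /= expr0n addr0 sqrtr_sqr. Qed.
Lemma nm_im (a : R) : nm (0 +i* a) = `|a|.
Proof. by rewrite /= expr0n add0r sqrtr_sqr. Qed.
Lemma nm_le_ReIm x : nm x <= `|complex.Re x| + `|complex.Im x|.
Proof.
case: x => a b; rewrite -[X in X <= _]/(nm (a +i* b)).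
have -> : a +i* b = a%:C + (0 +i* b).
  by apply/eqP; rewrite eq_complex /= addr0 add0r !eqxx.
by rewrite (le_trans (nmD _ _))// nm_real nm_im /= addr0 add0r.
Qed.
Lemma nm_conj x : nm (conjc x) = nm x.
Proof. by case: x => a b; rewrite /= sqrrN. Qed.
Lemma nm_i : nm ('i%C : R[i]) = 1.
Proof. by rewrite nm_im normr1. Qed.
Lemma nm_sum (I : Type) (s : seq I) (P : pred I) (F : I -> R[i]) :
  nm (\sum_(i <- s | P i) F i) <= \sum_(i <- s | P i) nm (F i).
Proof.
apply: (big_ind2 (fun u v => nm u <= v)); first by rewrite nm0.
- by move=> *; rewrite (le_trans (nmD _ _))// lerD.
- by [].
Qed.
Lemma nmBB x y : nm x - nm y <= nm (x - y).
Proof. by rewrite lerBlDr; have := nmD (x - y) y; rewrite subrK. Qed.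
Lemma mulcJ x : x * conjc x = (nm x ^+ 2)%:C.
Proof.
rewrite nm_sqr; case: x => a b; apply/eqP; rewrite eq_complex /=.
by apply/andP; split; apply/eqP; ring.
Qed.
Lemma nm_natr n : nm (n%:R : R[i]) = n%:R.
Proof. by rewrite -(rmorph_nat (real_complex R)) nm_real normr_nat. Qed.
Lemma nm_eq0_le x : nm x <= 0 -> x = 0.
Proof. by move=> h; apply/eqP; rewrite -nm_eq0 eq_le h nm_ge0. Qed.

End NormC.

(* Increments in the domain are measured by [j]: it is [id] on the complex plane and
   the embedding of the reals on the line. *)
Section Calculus.
Context {R : realType} {T : Type} (j : T -> R[i]).
Implicit Types (A : set T) (f g : T -> R[i]) (x y : T).

Definition cont_at A f x := forall e : R, 0 < e -> exists2 d : R, 0 < d &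
  forall y, A y -> nm (j y - j x) < d -> nm (f y - f x) <= e.

(* Caratheodory's form of differentiability: the rules of differentiation
   become rules for continuity. *)
Definition der A f x (D : R[i]) := exists phi : T -> R[i],
  [/\ cont_at A phi x, phi x = D &
      forall y, A y -> f y - f x = phi y * (j y - j x)].

(** Replaces the choice of epsilons in the rules below: a bound by a fixed multiple of [e] is
    enough, and [e <= 1] keeps products of increments linear in [e]. *)
Lemma cont_scaled A f x (C : R) :
  (forall e, 0 < e -> e <= 1 -> exists2 d : R, 0 < d &
     forall y, A y -> nm (j y - j x) < d -> nm (f y - f x) <= C * e) ->
  cont_at A f x.
Proof.
move=> H e e0.
have C1 : 0 < `|C| + 1 by rewrite ltr_wpDl.
have [|| d d0 hd] := H (Num.min 1 (e / (`|C| + 1))).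
- by rewrite lt_min ltr01 divr_gt0.
- by rewrite ge_min lexx.
exists d => // y Ay yd; rewrite (le_trans (hd y Ay yd))//.
have h : Num.min 1 (e / (`|C| + 1)) <= e / (`|C| + 1) by rewrite ge_min lexx orbT.
have h0 : 0 <= Num.min 1 (e / (`|C| + 1)) by rewrite le_min ler01 ltW// divr_gt0.
have hC : C <= `|C| + 1 by rewrite (le_trans (ler_norm _))// lerDl.
rewrite (le_trans (ler_wpM2r h0 hC))// (le_trans (ler_wpM2l (ltW C1) h))//.
by rewrite mulrCA divff ?mulr1// gt_eqF.
Qed.

Lemma cont_cst A x c : cont_at A (fun=> c) x.
Proof. by move=> e e0; exists 1 => // y _ _; rewrite subrr nm0 ltW. Qed.

Lemma cont_id A x : cont_at A j x.
Proof. by move=> e e0; exists e => // y _ /ltW. Qed.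

Lemma cont_sub (A B : set T) f x : A `<=` B -> cont_at B f x -> cont_at A f x.
Proof. by move=> AB H e /H[d d0 hd]; exists d => // y /AB; exact: hd. Qed.

Lemma cont_two A f g x e : 0 < e -> cont_at A f x -> cont_at A g x ->
  exists2 d : R, 0 < d & forall y, A y -> nm (j y - j x) < d ->
    nm (f y - f x) <= e /\ nm (g y - g x) <= e.
Proof.
move=> e0 /(_ _ e0)[d d0 hd] /(_ _ e0)[d' d'0 hd'].
exists (Num.min d d'); first by rewrite lt_min d0.
by move=> y Ay; rewrite lt_min => /andP[yd yd']; split; [exact: hd|exact: hd'].
Qed.

Lemma contD A f g x : cont_at A f x -> cont_at A g x ->
  cont_at A (fun y => f y + g y) x.
Proof.
move=> hf hg; apply: (@cont_scaled _ _ _ 2) => e e0 _.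
have [d d0 hd] := cont_two e0 hf hg; exists d => // y Ay /(hd y Ay)[h1 h2].
have -> : f y + g y - (f x + g x) = (f y - f x) + (g y - g x) by ring.
by rewrite (le_trans (nmD _ _))//; lra.
Qed.

Lemma contM A f g x : cont_at A f x -> cont_at A g x ->
  cont_at A (fun y => f y * g y) x.
Proof.
move=> hf hg; apply: (@cont_scaled _ _ _ (1 + nm (f x) + nm (g x))) => e e0 e1.
have [d d0 hd] := cont_two e0 hf hg; exists d => // y Ay /(hd y Ay)[h1 h2].
have -> : f y * g y - f x * g x = (f y - f x) * (g y - g x) +
   (f x * (g y - g x) + g x * (f y - f x)) by ring.
have E1 : (1 + nm (f x) + nm (g x)) * e = e * 1 + (nm (f x) * e + nm (g x) * e) by ring.
rewrite E1 (le_trans (nmD _ _))// lerD//.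
  by rewrite nmM ler_pM ?nm_ge0// (le_trans h2).
by rewrite (le_trans (nmD _ _))// !nmM lerD// ler_wpM2l ?nm_ge0.
Qed.

Lemma contN A f x : cont_at A f x -> cont_at A (fun y => - f y) x.
Proof.
by move=> hf e /hf[d d0 hd]; exists d => // y Ay /(hd y Ay); rewrite -opprD nmN.
Qed.

Lemma contB A f g x : cont_at A f x -> cont_at A g x ->
  cont_at A (fun y => f y - g y) x.
Proof. by move=> hf hg; apply: contD => //; exact: contN. Qed.

Lemma contV A f x : f x != 0 -> cont_at A f x -> cont_at A (fun y => (f y)^-1) x.
Proof.
move=> fx0 hf; have n0 : 0 < nm (f x) by rewrite nm_gt0.
apply: (@cont_scaled _ _ _ (2 / nm (f x) ^+ 2)) => e e0 e1.
have m0 : 0 < Num.min e (nm (f x) / 2) by rewrite lt_min e0 divr_gt0.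
have [d d0 hd] := hf _ m0.
exists d => // y Ay /(hd y Ay); rewrite le_min => /andP[h1 h2].
have h3 : nm (f x) / 2 <= nm (f y).
  by have := nmBB (f x) (f y); rewrite nmC => h; lra.
have n0' : 0 < nm (f y) by rewrite (lt_le_trans _ h3)// divr_gt0.
have fy0 : f y != 0 by rewrite -nm_gt0.
have -> : (f y)^-1 - (f x)^-1 = - (f y - f x) * ((f y)^-1 * (f x)^-1).
  by field; rewrite fx0.
have h4 : (nm (f y))^-1 <= 2 / nm (f x).
  by rewrite -[leRHS]invrK lef_pV2 ?posrE ?invr_gt0 ?divr_gt0// invf_div.
have -> : 2 / nm (f x) ^+ 2 * e = e * (2 / nm (f x) * (nm (f x))^-1).
  by field; rewrite gt_eqF.
rewrite !nmM nmN !nmV ler_pM ?nm_ge0 ?mulr_ge0 ?invr_ge0 ?nm_ge0//.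
by rewrite ler_wpM2r ?invr_ge0 ?nm_ge0.
Qed.

Lemma contX A f x n : cont_at A f x -> cont_at A (fun y => f y ^+ n) x.
Proof.
move=> hf; elim: n => [|n IH].
  by under eq_fun do rewrite expr0; exact: cont_cst.
by under eq_fun do rewrite exprS; exact: contM.
Qed.

Lemma cont_conj A f x : cont_at A f x -> cont_at A (fun y => conjc (f y)) x.
Proof.
by move=> hf e /hf[d d0 hd]; exists d => // y Ay /(hd y Ay); rewrite -rmorphB nm_conj.
Qed.

(** The slope function is the difference quotient, with the value [D] where [j y = j x]; at such
    points the hypothesis forces [f y = f x]. *)
Lemma derP A f x D : (forall e : R, 0 < e -> exists2 d : R, 0 < d &
    forall y, A y -> nm (j y - j x) < d ->
      nm (f y - f x - D * (j y - j x)) <= e * nm (j y - j x)) -> der A f x D.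
Proof.
move=> H.
exists (fun y => if j y == j x then D else (f y - f x) / (j y - j x)).
split; rewrite ?eqxx//.
  move=> e e0; have [d d0 hd] := H e e0; exists d => // y Ay yd.
  rewrite eqxx; case: ifPn => [_|jn]; first by rewrite subrr nm0 ltW.
  have n0 : j y - j x != 0 by rewrite subr_eq0.
  have -> : (f y - f x) / (j y - j x) - D = (f y - f x - D * (j y - j x)) / (j y - j x).
    by field.
  by rewrite nmM nmV ler_pdivrMr ?nm_gt0//; exact: hd.
move=> y Ay; case: ifPn => [/eqP jn|jn]; last by rewrite divfK// subr_eq0.
rewrite jn subrr mulr0.
have [d d0 hd] := H 1 ltr01.
by have := hd y Ay; rewrite jn subrr nm0 mulr0 subr0 mulr0 => /(_ d0)/nm_eq0_le.
Qed.

Lemma der_eps A f x D : der A f x D -> forall e : R, 0 < e ->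
  exists2 d : R, 0 < d & forall y, A y -> nm (j y - j x) < d ->
      nm (f y - f x - D * (j y - j x)) <= e * nm (j y - j x).
Proof.
move=> [phi [cphi <- E]] e /cphi[d d0 hd]; exists d => // y Ay yd.
by rewrite E// -mulrBl nmM ler_wpM2r ?nm_ge0// hd.
Qed.

Lemma der_cont A f x D : der A f x D -> cont_at A f x.
Proof.
move=> [phi [cphi _ E]] e e0.
have [d d0 hd] := contM cphi (contB (cont_id A x) (cont_cst A x (j x))) e0.
by exists d => // y Ay /(hd y Ay); rewrite subrr mulr0 subr0 E.
Qed.

Lemma der_cst A x c : der A (fun=> c) x 0.
Proof.
by exists (fun=> 0); split; [exact: cont_cst| |move=> y _; rewrite mul0r subrr].
Qed.

Lemma der_id A x : der A j x 1.
Proof. by exists (fun=> 1); split; [exact: cont_cst| |move=> y _; rewrite mul1r]. Qed.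

Lemma der_sub (A B : set T) f x D : A `<=` B -> der B f x D -> der A f x D.
Proof.
move=> AB [phi [c p E]]; exists phi; split => //; first exact: cont_sub c.
by move=> y /AB; exact: E.
Qed.

Lemma der_local A f g x D (r : R) : 0 < r -> A x ->
  (forall y, A y -> nm (j y - j x) < r -> f y = g y) ->
  der A f x D -> der A g x D.
Proof.
move=> r0 Ax fg /der_eps H; apply: derP => e /H[d d0 hd].
exists (Num.min d r); first by rewrite lt_min d0.
move=> y Ay; rewrite lt_min => /andP[yd yr].
by rewrite -!fg ?hd// subrr nm0.
Qed.

Lemma der_eq A f g x D : A x -> (forall y, A y -> f y = g y) ->
  der A f x D -> der A g x D.
Proof. by move=> Ax fg; apply: (der_local ltr01 Ax) => y /fg. Qed.

Lemma derD A f g x D D' : der A f x D -> der A g x D' ->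
  der A (fun y => f y + g y) x (D + D').
Proof.
move=> [p [cp p0 E]] [q [cq q0 E']]; exists (fun y => p y + q y).
split; [exact: contD|by rewrite p0 q0|move=> y Ay].
by rewrite mulrDl -E// -E'//; ring.
Qed.

Lemma derM A f g x D D' : A x -> der A f x D -> der A g x D' ->
  der A (fun y => f y * g y) x (D * g x + f x * D').
Proof.
move=> Ax df dg; have cg := der_cont dg.
move: df dg => [p [cp p0 E]] [q [cq q0 E']].
exists (fun y => p y * g y + f x * q y); split.
- by apply: contD; apply: contM => //; exact: cont_cst.
- by rewrite p0 q0.
- move=> y Ay.
  have -> : (p y * g y + f x * q y) * (j y - j x) =
    (p y * (j y - j x)) * g y + f x * (q y * (j y - j x)) by ring.
  by rewrite -E// -E'//; ring.
Qed.

Lemma derZ A f x D c : der A f x D -> der A (fun y => c * f y) x (c * D).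
Proof.
move=> [p [cp p0 E]]; exists (fun y => c * p y); split.
- by apply: contM => //; exact: cont_cst.
- by rewrite p0.
- by move=> y Ay; rewrite -mulrA -E//; ring.
Qed.

Lemma derN A f x D : der A f x D -> der A (fun y => - f y) x (- D).
Proof.
move=> [p [cp p0 E]]; exists (fun y => - p y); split.
- exact: contN.
- by rewrite p0.
- by move=> y Ay; rewrite mulNr -E//; ring.
Qed.

Lemma derB A f g x D D' : der A f x D -> der A g x D' ->
  der A (fun y => f y - g y) x (D - D').
Proof. by move=> df dg; apply: derD => //; exact: derN. Qed.

Lemma derV A f x D : A x -> (forall y, A y -> f y != 0) -> der A f x D ->
  der A (fun y => (f y)^-1) x (- D / f x ^+ 2).
Proof.
move=> Ax f0 df; have cf := der_cont df; move: df => [p [cp p0 E]].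
exists (fun y => - p y * ((f y)^-1 * (f x)^-1)); split.
- apply: contM; first exact: contN.
  by apply: contM; [apply: contV => //; exact: f0|exact: cont_cst].
- by rewrite p0 expr2 invfM.
- move=> y Ay.
  have -> : - p y * ((f y)^-1 * (f x)^-1) * (j y - j x) =
    - (p y * (j y - j x)) * ((f y)^-1 * (f x)^-1) by ring.
  by rewrite -E//; field; rewrite !f0.
Qed.

Lemma derV_at A f x D : A x -> f x != 0 -> der A f x D ->
  der A (fun y => (f y)^-1) x (- D / f x ^+ 2).
Proof.
move=> Ax fx0 df.
have n0 : 0 < nm (f x) / 2 by rewrite divr_gt0// nm_gt0.
have [d d0 hd] := der_cont df n0.
have nz y : A y -> nm (j y - j x) < d -> f y != 0.
  move=> Ay /(hd y Ay) h; apply/eqP => fy0; move: h; rewrite fy0 sub0r nmN.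
  by move: n0 => + h; lra.
(* Zeros of [f] away from [x] are replaced by the value 1, so that [derV] applies. *)
apply: (@der_local A (fun y => (if f y == 0 then 1 else f y)^-1) _ x _ d) => //.
  by move=> y Ay /(nz y Ay)/negPf ->.
have -> : f x = (fun y => if f y == 0 then 1 else f y) x by rewrite /= (negPf fx0).
apply: (@derV A (fun y => if f y == 0 then 1 else f y)) => //.
  by move=> y Ay; case: ifPn => // _; rewrite oner_eq0.
apply: (@der_local A f _ x _ d) => //.
by move=> y Ay /(nz y Ay)/negPf ->.
Qed.

Lemma derX A f x D n : A x -> der A f x D ->
  der A (fun y => f y ^+ n) x (n%:R * f x ^+ n.-1 * D).
Proof.
move=> Ax df; elim: n => [|n IH].
  by rewrite !mul0r; under eq_fun do rewrite expr0; exact: der_cst.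
under eq_fun do rewrite exprS.
have := derM Ax df IH; congr der.
by case: n {IH} => [|n] /=; rewrite ?expr0 ?exprS; ring.
Qed.

Lemma der_sum A (I : Type) (s : seq I) (F : I -> T -> R[i]) (D : I -> R[i]) x :
  (forall i, der A (F i) x (D i)) ->
  der A (fun y => \sum_(i <- s) F i y) x (\sum_(i <- s) D i).
Proof.
move=> dF; elim: s => [|i s IH].
  by under eq_fun do rewrite big_nil; rewrite big_nil; exact: der_cst.
by under eq_fun do rewrite big_cons; rewrite big_cons; exact: derD.
Qed.

Lemma derE A f x D D' : D = D' -> der A f x D -> der A f x D'.
Proof. by move=> ->. Qed.

End Calculus.

Lemma cont_comp {R : realType} {T : Type} {U : Type} (j : T -> R[i]) (k : U -> R[i])
    (A : set T) (B : set U) (h : T -> U) (f : U -> R[i]) x :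
  (forall y, A y -> B (h y)) -> cont_at j A (k \o h) x -> cont_at k B f (h x) ->
  cont_at j A (f \o h) x.
Proof.
move=> AB ch cf e /cf[d d0 hd].
(* [cont_at] yields a weak inequality but asks for a strict one, hence the half. *)
have d20 : 0 < d / 2 by rewrite divr_gt0.
have [d' d'0 hd'] := ch _ d20; exists d' => // y Ay /(hd' y Ay) /= l.
by apply: hd; [exact: AB|rewrite (le_lt_trans l)// ltr_pdivrMr// ltr_pMr// ltr1n].
Qed.

Lemma der_comp {R : realType} {T : Type} {U : Type} (j : T -> R[i]) (k : U -> R[i])
    (A : set T) (B : set U) (h : T -> U) (f : U -> R[i]) x D D' :
  (forall y, A y -> B (h y)) -> der j A (k \o h) x D -> der k B f (h x) D' ->
  der j A (f \o h) x (D' * D).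
Proof.
move=> AB dh [q [cq q0 E']]; have ch := der_cont dh; move: dh => [p [cp p0 E]].
exists (fun y => (q \o h) y * p y); split.
- by apply: contM => //; exact: cont_comp ch cq.
- by rewrite /= p0 q0.
- by move=> y Ay; rewrite /= -mulrA -E// E'//; exact: AB.
Qed.

(** Conjugation commutes with differentiation only along real increments, which is what [jr]
    expresses. *)
Lemma der_conj {R : realType} {T : Type} (j : T -> R[i]) (A : set T) f x D :
  (forall y, conjc (j y) = j y) ->
  der j A f x D -> der j A (fun y => conjc (f y)) x (conjc D).
Proof.
move=> jr [p [cp p0 E]]; exists (fun y => conjc (p y)); split.
- exact: cont_conj.
- by rewrite p0.
- by move=> y Ay; rewrite -rmorphB E// rmorphM; congr (_ * _); rewrite rmorphB /= !jr.
Qed.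

(** * Bisection arguments *)

Section Bisection.
Context {R : realType}.

Lemma half_powers_small (C e : R) : 0 < e -> exists n, C / 2 ^+ n < e.
Proof.
move=> e0; exists (Num.truncn (C / e)).+1.
rewrite ltr_pdivrMr ?exprn_gt0// mulrC -ltr_pdivrMr//.
apply: (@lt_le_trans _ _ (Num.truncn (C / e)).+1%:R).
  by have [h|h] := leP 0 (C / e); [have/andP[] := truncn_itv h|rewrite (lt_trans h)].
by rewrite -natrX ler_nat ltnW// ltn_expl.
Qed.

(* Cousin's lemma for rectangles, by repeated quartering; with a degenerate
   second side it is the bisection principle on a segment. *)
Lemma rect_ind (P : R -> R -> R -> R -> Prop) (a b c d : R) :
  a <= b -> c <= d ->
  (forall p q s t, a <= p -> p <= q -> q <= b -> c <= s -> s <= t -> t <= d ->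
     P p ((p + q) / 2) s ((s + t) / 2) -> P p ((p + q) / 2) ((s + t) / 2) t ->
     P ((p + q) / 2) q s ((s + t) / 2) -> P ((p + q) / 2) q ((s + t) / 2) t ->
     P p q s t) ->
  (forall x y, a <= x <= b -> c <= y <= d -> exists2 e : R, 0 < e &
     forall p q s t, a <= p <= x -> x <= q <= b -> c <= s <= y -> y <= t <= d ->
       q - p < e -> t - s < e -> P p q s t) ->
  P a b c d.
Proof.
move=> ab cd Psplit Ploc; apply: contrapT => nP.
pose st := (R * R)%type.
pose h n : R := (b - a) / 2 ^+ n.
pose l n : R := (d - c) / 2 ^+ n.
have h_ge0 n : 0 <= h n by rewrite divr_ge0 ?subr_ge0// exprn_ge0.
have l_ge0 n : 0 <= l n by rewrite divr_ge0 ?subr_ge0// exprn_ge0.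
have hS n : h n = h n.+1 + h n.+1 by rewrite /h exprS; field; rewrite expf_neq0.
have lS n : l n = l n.+1 + l n.+1 by rewrite /l exprS; field; rewrite expf_neq0.
pose Q n (s : st) := P s.1 (s.1 + h n) s.2 (s.2 + l n).
(* A state is the lower left corner of the current rectangle. The next one is a quarter on which [P]
   fails; the fourth is not tested because, by [Psplit], it must fail when [P] holds on the other
   three. *)
pose next n (s : st) : st :=
  if ~~ `[< Q n.+1 s >] then s
  else if ~~ `[< Q n.+1 (s.1, s.2 + l n.+1) >] then (s.1, s.2 + l n.+1)
  else if ~~ `[< Q n.+1 (s.1 + h n.+1, s.2) >] then (s.1 + h n.+1, s.2)
  else (s.1 + h n.+1, s.2 + l n.+1).
pose S := fix S n : st := if n is m.+1 then next m (S m) else (a, c).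
have Sin n : [/\ a <= (S n).1, (S n).1 + h n <= b, c <= (S n).2 & (S n).2 + l n <= d].
  elim: n => [|n [i1 i2 i3 i4]] /=.
    by rewrite /h /l expr0 !divr1; split; rewrite // ?[_ + (_ - _)]addrC subrK.
  move: (h_ge0 n.+1) (l_ge0 n.+1) i1 i2 i3 i4; rewrite (hS n) (lS n) /next.
  case: (S n) (h n.+1) (l n.+1) => p s u v /= *.
  by do 3?case: ifPn => _ /=; split; lra.
have Snext n : (S n).1 <= (S n.+1).1 /\ (S n.+1).1 + h n.+1 <= (S n).1 + h n.
  move: (h_ge0 n.+1); rewrite (hS n) /= /next.
  case: (S n) (h n.+1) => p s u /= *.
  by do 3?case: ifPn => _ /=; split; lra.
have Snext2 n : (S n).2 <= (S n.+1).2 /\ (S n.+1).2 + l n.+1 <= (S n).2 + l n.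
  move: (l_ge0 n.+1); rewrite (lS n) /= /next.
  case: (S n) (l n.+1) => p s u /= *.
  by do 3?case: ifPn => _ /=; split; lra.
have SnP n : ~ Q n (S n).
  elim: n => [|n IH].
    by rewrite /Q /= /h /l expr0 !divr1 ![_ + (_ - _)]addrC !subrK.
  rewrite /= /next; case: ifPn => [/asboolPn//|/negbNE/asboolP q1].
  case: ifPn => [/asboolPn//|/negbNE/asboolP q2].
  case: ifPn => [/asboolPn//|/negbNE/asboolP q3 q4].
  apply: IH; have [i1 i2 i3 i4] := Sin n.
  move: q1 q2 q3 q4; rewrite /Q /= => q1 q2 q3 q4.
  have e1 : ((S n).1 + ((S n).1 + h n)) / 2 = (S n).1 + h n.+1 by rewrite (hS n); lra.
  have e2 : ((S n).2 + ((S n).2 + l n)) / 2 = (S n).2 + l n.+1 by rewrite (lS n); lra.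
  have e3 : (S n).1 + h n = (S n).1 + h n.+1 + h n.+1 by rewrite (hS n); lra.
  have e4 : (S n).2 + l n = (S n).2 + l n.+1 + l n.+1 by rewrite (lS n); lra.
  by apply: Psplit; rewrite ?lerDl ?h_ge0 ?l_ge0// e1 e2 ?e3 ?e4.
have nested (f g : nat -> R) : (forall n, f n <= f n.+1) -> (forall n, g n.+1 <= g n) ->
    (forall n, f n <= g n) -> exists x, forall n, f n <= x <= g n.
  move=> fi gd fg.
  have fm : {homo f : m n / (m <= n)%N >-> m <= n}.
    by apply: homo_leq => // x y z; exact: le_trans.
  have gm : {homo g : m n / (m <= n)%N >-> m >= n}.
    by apply: homo_leq => // [x y z /= h1 h2]; exact: le_trans h2 h1.
  have fgmn m n : f m <= g n.
    have [mn|/ltnW nm'] := leqP m n.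
      by rewrite (le_trans (fm _ _ mn)).
    by rewrite (le_trans (fg m))// gm.
  have hs : has_sup (range f).
    by split; [exists (f 0%N), 0%N|exists (g 0%N) => _ [m _ <-]].
  exists (sup (range f)) => n; apply/andP; split.
    by apply: ub_le_sup; [case: hs|exists n].
  by apply: ge_sup; [case: hs|move=> _ [m _ <-]].
have [x hx] : exists x, forall n, (S n).1 <= x <= (S n).1 + h n.
  by apply: nested => n; [case: (Snext n)|case: (Snext n)|rewrite lerDl].
have [y hy] : exists y, forall n, (S n).2 <= y <= (S n).2 + l n.
  by apply: nested => n; [case: (Snext2 n)|case: (Snext2 n)|rewrite lerDl].
have xab : a <= x <= b.
  by have := hx 0%N; rewrite /= /h expr0 divr1 [a + _]addrC subrK.
have ycd : c <= y <= d.
  by have := hy 0%N; rewrite /= /l expr0 divr1 [c + _]addrC subrK.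
have [e e0 He] := Ploc x y xab ycd.
have [n hn] := half_powers_small (Num.max (b - a) (d - c)) e0.
have [i1 i2 i3 i4] := Sin n; have /andP[x1 x2] := hx n; have /andP[y1 y2] := hy n.
apply: (SnP n); apply: He; rewrite ?i1 ?i2 ?i3 ?i4 ?x1 ?x2 ?y1 ?y2//.
- rewrite addrAC subrr add0r (le_lt_trans _ hn)// ler_pM2r ?invr_gt0 ?exprn_gt0//.
  by rewrite le_max lexx.
- rewrite addrAC subrr add0r (le_lt_trans _ hn)// ler_pM2r ?invr_gt0 ?exprn_gt0//.
  by rewrite le_max lexx orbT.
Qed.

Lemma segment_ind (P : R -> R -> Prop) (a b : R) : a <= b ->
  (forall p m q, a <= p -> p <= m -> m <= q -> q <= b -> P p m -> P m q -> P p q) ->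
  (forall x, a <= x <= b -> exists2 e : R, 0 < e &
     forall p q, a <= p <= x -> x <= q <= b -> q - p < e -> P p q) ->
  P a b.
Proof.
move=> ab Ps Pl; apply: (@rect_ind (fun p q _ _ => P p q) a b 0 0) => //.
  move=> p q s t ap pq qb _ _ _ h1 _ h2 _.
  by apply: (Ps p ((p + q) / 2) q) => //; lra.
move=> x y /Pl[e e0 he] _; exists e => // p q s t h1 h2 _ _ h3 _; exact: he.
Qed.

End Bisection.

(** * The mean value inequality *)

Section MeanValue.
Context {R : realType}.
Local Notation RC := (real_complex R).

Definition seg (a b : R) : set R := [set x | a <= x <= b].
Definition halfline : set R := [set x | 0 <= x].

Lemma nm_RCB (x y : R) : nm (RC x - RC y) = `|x - y|.
Proof. by rewrite -rmorphB nm_real. Qed.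

(** Up to the slack [e'] the estimate holds on short segments around each point, by
    differentiability there, and it adds up under concatenation; so [segment_ind] gives it on the
    whole segment. *)
Lemma mean_value (f f' : R -> R[i]) (a b M : R) : a <= b ->
  (forall x, seg a b x -> der RC (seg a b) f x (f' x)) ->
  (forall x, seg a b x -> nm (f' x) <= M) ->
  nm (f b - f a) <= M * (b - a).
Proof.
move=> ab df fM; apply/ler_addgt0Pr => e e0.
have be : 0 < b - a + 1 by lra.
suff : nm (f b - f a) <= (M + e / (b - a + 1)) * (b - a).
  move/le_trans; apply; rewrite mulrDl lerD2l mulrAC ler_pdivrMr//.
  by rewrite ler_pM2l//; lra.
set e' := e / _; have e'0 : 0 < e' by rewrite divr_gt0.
apply: (segment_ind (P := fun p q => nm (f q - f p) <= (M + e') * (q - p)) ab).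
  move=> p m q _ _ _ _ h1 h2.
  have -> : f q - f p = (f q - f m) + (f m - f p) by ring.
  by rewrite (le_trans (nmD _ _))// (le_trans (lerD h2 h1))// -mulrDr; lra.
move=> x xab; have [d d0 hd] := der_eps (df x xab) e'0.
exists d => // p q /andP[ap px] /andP[xq qb] qp.
move/andP: (xab) => [ax xb].
have hp : nm (f p - f x - f' x * (RC p - RC x)) <= e' * (x - p).
  rewrite (le_trans (hd p _ _))// ?nm_RCB; first by rewrite /seg /= ap (le_trans px).
    by rewrite distrC ger0_norm; lra.
  by rewrite distrC ger0_norm; lra.
have hq : nm (f q - f x - f' x * (RC q - RC x)) <= e' * (q - x).
  rewrite (le_trans (hd q _ _))// ?nm_RCB; first by rewrite /seg /= qb (le_trans ax).
    by rewrite ger0_norm; lra.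
  by rewrite ger0_norm; lra.
have -> : f q - f p = (f q - f x - f' x * (RC q - RC x)) -
   (f p - f x - f' x * (RC p - RC x)) + f' x * (RC q - RC p) by ring.
rewrite (le_trans (nmD _ _))// [leRHS]mulrDl addrC lerD//.
  rewrite nmM nm_RCB ger0_norm; last lra.
  by rewrite ler_wpM2r ?fM//; lra.
by rewrite (le_trans (nmB _ _))// (le_trans (lerD hq hp))// -mulrDr; lra.
Qed.

Lemma der0_const (f : R -> R[i]) a b : a <= b ->
  (forall x, seg a b x -> der RC (seg a b) f x 0) -> f b = f a.
Proof.
move=> ab df; apply/eqP; rewrite -subr_eq0 -nm_eq0 eq_le nm_ge0 andbT.
have := mean_value (f' := fun=> 0) ab df (M := 0).
by rewrite mul0r; apply=> x _; rewrite nm0.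
Qed.

Lemma der_monotone (f f' : R -> R[i]) a b : a <= b ->
  (forall x, seg a b x -> der RC (seg a b) f x (f' x)) ->
  (forall x, seg a b x -> 0 <= complex.Re (f' x)) ->
  complex.Re (f a) <= complex.Re (f b).
Proof.
move=> ab df fM; apply/ler_addgt0Pr => e e0.
have be : 0 < b - a + 1 by lra.
suff : complex.Re (f a) <= complex.Re (f b) + e / (b - a + 1) * (b - a).
  move/le_trans; apply; rewrite lerD2l mulrAC ler_pdivrMr//.
  by rewrite ler_pM2l//; lra.
set e' := e / _; have e'0 : 0 < e' by rewrite divr_gt0.
apply: (segment_ind (P := fun p q =>
   complex.Re (f p) <= complex.Re (f q) + e' * (q - p)) ab).
  by move=> p m q _ _ _ _ h1 h2; lra.
move=> x xab; have [d d0 hd] := der_eps (df x xab) e'0.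
exists d => // p q /andP[ap px] /andP[xq qb] qp.
move/andP: (xab) => [ax xb].
have RM (u : R) : complex.Re (f' x * (RC u - RC x)) = complex.Re (f' x) * (u - x).
  by case: (f' x) => s t /=; ring.
have ReB (u v : R[i]) : complex.Re (u - v) = complex.Re u - complex.Re v.
  by case: u v => ? ? [].
have hp : nm (f p - f x - f' x * (RC p - RC x)) <= e' * (x - p).
  rewrite (le_trans (hd p _ _))// ?nm_RCB; first by rewrite /seg /= ap (le_trans px).
    by rewrite distrC ger0_norm; lra.
  by rewrite distrC ger0_norm; lra.
have hq : nm (f q - f x - f' x * (RC q - RC x)) <= e' * (q - x).
  rewrite (le_trans (hd q _ _))// ?nm_RCB; first by rewrite /seg /= qb (le_trans ax).
    by rewrite ger0_norm; lra.
  by rewrite ger0_norm; lra.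
have := le_trans (nm_Re _) hp; have := le_trans (nm_Re _) hq.
rewrite !ReB !RM !ler_norml => /andP[h1 _] /andP[_ h2].
have h3 := fM x xab.
have h4 : 0 <= complex.Re (f' x) * (q - x) by rewrite mulr_ge0//; lra.
have h5 : 0 <= complex.Re (f' x) * (x - p) by rewrite mulr_ge0//; lra.
by have h6 : complex.Re (f' x) * (x - p) = - (complex.Re (f' x) * (p - x)); lra.
Qed.

End MeanValue.

Section UniformLimit.
Context {R : realType} {T : Type} (j : T -> R[i]).

(** The mean value inequality based at [x], isolated because it is what differentiating a limit asks
    of the domain. It is established for segments and for discs. *)
Definition mvt_at (A : set T) (x : T) := forall (f f' : T -> R[i]) (M : R),
  (forall y, A y -> der j A f y (f' y)) -> (forall y, A y -> nm (f' y) <= M) ->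
  forall y, A y -> nm (f y - f x) <= M * nm (j y - j x).

(** The mean value inequality applied to [F n - F N] bounds its increments uniformly in [n], hence
    those of [f - F N]; the differentiability of the single function [F N] does the rest. *)
Lemma der_limit (A : set T) (x : T) (F F' : nat -> T -> R[i]) (f f' : T -> R[i]) :
  A x -> mvt_at A x ->
  (forall n y, A y -> der j A (F n) y (F' n y)) ->
  (forall y, A y -> forall e : R, 0 < e ->
     exists N, forall n, (N <= n)%N -> nm (F n y - f y) <= e) ->
  (forall e : R, 0 < e -> exists N, forall n, (N <= n)%N ->
     forall y, A y -> nm (F' n y - f' y) <= e) ->
  der j A f x (f' x).
Proof.
move=> Ax mA dF cF uF; apply: derP => e e0.
have e8 : 0 < e / 8 by rewrite divr_gt0.
have [N hN] := uF _ e8.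
have dN := dF N x Ax.
have e4 : 0 < e / 4 by rewrite divr_gt0.
have [d d0 hd] := der_eps dN e4; exists d => // y Ay yd.
set t := nm (j y - j x).
have t0 : 0 <= t by exact: nm_ge0.
have hmn n : (N <= n)%N -> nm (F n y - F N y - (F n x - F N x)) <= e / 4 * t.
  move=> Nn.
  have dFN y' : A y' -> der j A (fun u => F n u - F N u) y' (F' n y' - F' N y').
    by move=> Ay'; apply: derB; exact: dF.
  apply: (mA _ _ _ dFN) => // y' Ay'.
  have -> : F' n y' - F' N y' = (F' n y' - f' y') - (F' N y' - f' y') by ring.
  rewrite (le_trans (nmB _ _))//.
  by have := hN n Nn y' Ay'; have := hN N (leqnn N) y' Ay'; lra.
have lim : nm (f y - F N y - (f x - F N x)) <= e / 4 * t.
  apply/ler_addgt0Pr => e1 e10.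
  have e12 : 0 < e1 / 2 by rewrite divr_gt0.
  have [N1 h1] := cF y Ay _ e12; have [N2 h2] := cF x Ax _ e12.
  set n := maxn N (maxn N1 N2).
  have n1 : (N1 <= n)%N by rewrite !leq_max leqnn !orbT.
  have n2 : (N2 <= n)%N by rewrite !leq_max leqnn !orbT.
  have := hmn n (leq_maxl _ _); have := h1 n n1; have := h2 n n2.
  have -> : f y - F N y - (f x - F N x) = (F n y - F N y - (F n x - F N x)) -
     (F n y - f y) + (F n x - f x) by ring.
  move=> k1 k2 k3; rewrite (le_trans (nmD _ _))//.
  by have := nmB (F n y - F N y - (F n x - F N x)) (F n y - f y); lra.
have -> : f y - f x - f' x * (j y - j x) = (f y - F N y - (f x - F N x)) +
   (F N y - F N x - F' N x * (j y - j x)) + (F' N x - f' x) * (j y - j x) by ring.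
have h1 := hd y Ay yd; rewrite -/t in h1.
have h2 : nm ((F' N x - f' x) * (j y - j x)) <= e / 8 * t.
  by rewrite nmM ler_wpM2r// hN.
rewrite (le_trans (nmD _ _))//.
have h3 := nmD (f y - F N y - (f x - F N x)) (F N y - F N x - F' N x * (j y - j x)).
have : 0 <= e * t by rewrite mulr_ge0// ltW.
lra.
Qed.

End UniformLimit.

Section MvtDomains.
Context {R : realType}.
Local Notation RC := (real_complex R).

Lemma mvt_seg (a b x : R) : seg a b x -> mvt_at RC (seg a b) x.
Proof.
move=> /andP[ax xb] f f' M df fM y /andP[ay yb]; rewrite nm_RCB.
have sub p q : a <= p -> q <= b -> seg p q `<=` seg a b.
  by move=> ap qb u /andP[pu uq]; rewrite /seg /= (le_trans ap)// (le_trans uq).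
have [xy|/ltW yx] := leP x y.
  rewrite ger0_norm ?subr_ge0//.
  apply: (mean_value (f' := f') xy) => u /(sub _ _ ax yb) uab; last exact: fM.
  by apply: der_sub (df u uab); exact: sub.
rewrite distrC nmC ger0_norm ?subr_ge0//.
apply: (mean_value (f' := f') yx) => u /(sub _ _ ay xb) uab; last exact: fM.
by apply: der_sub (df u uab); exact: sub.
Qed.

Definition disc (c : R[i]) (r : R) : set R[i] := [set z | nm (z - c) < r].

Lemma mvt_disc (c : R[i]) (r : R) x : disc c r x -> mvt_at id (disc c r) x.
Proof.
move=> xr f f' M df fM y yr.
have r0 : 0 < r by rewrite (le_lt_trans _ xr)// nm_ge0.
(* The disc is convex, so the segment from [x] to [y] stays in it and [mean_value] applies along
   it. *)
pose g (t : R) := x + RC t * (y - x).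
have gD t : seg 0 1 t -> disc c r (g t).
  move=> /andP[t0 t1]; rewrite /disc /= /g.
  have -> : x + RC t * (y - x) - c = RC (1 - t) * (x - c) + RC t * (y - c).
    by rewrite rmorphB rmorph1; ring.
  rewrite (le_lt_trans (nmD _ _))// !nmM !nm_real !ger0_norm ?subr_ge0//.
  have [->|tn] := eqVneq t 0; first by rewrite mul0r addr0 subr0 mul1r.
  have tp : 0 < t by rewrite lt_def tn.
  apply: (@lt_le_trans _ _ ((1 - t) * r + t * r)); last by lra.
  apply: ler_ltD; first by rewrite ler_wpM2l ?subr_ge0// ltW.
  by rewrite ltr_pM2l.
have dg t : der RC (seg 0 1) g t (y - x).
  apply: (@derE _ _ _ _ _ _ (0 + (1 * (y - x)))); first by rewrite add0r mul1r.
  apply: derD; first exact: der_cst.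
  have -> : (fun t : R => RC t * (y - x)) = (fun t : R => (y - x) * RC t).
    by apply/funext => u; rewrite mulrC.
  by rewrite mul1r -[X in der _ _ _ _ X]mulr1; apply: derZ; exact: der_id.
have := mean_value (f := f \o g) (f' := fun t => f' (g t) * (y - x)) (a := 0) (b := 1)
  (M := M * nm (y - x)) ler01.
have g1 : g 1 = y by rewrite /g rmorph1; ring.
have g0 : g 0 = x by rewrite /g rmorph0; ring.
rewrite /= g1 g0 subr0 mulr1; apply.
  move=> t t01; apply: (der_comp (k := id) (B := disc c r)) => //.
  by apply: df; exact: gD.
by move=> t t01; rewrite nmM ler_wpM2r ?nm_ge0// fM//; exact: gD.
Qed.

End MvtDomains.

(** * Real derivatives and primitives of continuous functions *)

Section RealDerivatives.
Context {R : realType}.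
Local Notation RC := (real_complex R).

Lemma is_derive_eps (F : R -> R) (x D : R) : is_derive x 1 F D ->
  forall e : R, 0 < e -> exists2 d : R, 0 < d &
    forall y, `|y - x| < d -> `|F y - F x - D * (y - x)| <= e * `|y - x|.
Proof.
move=> [dF DF] e e0.
have cF : h^-1 *: (F (h *: 1 + x) - F x) @[h --> 0^'] --> D by rewrite -DF.
move/cvgrPdist_le : cF => /(_ e e0).
rewrite near_withinE => /nbhs_ballP[d /= d0 hd]; exists d => // y yd.
have [->|yx] := eqVneq y x; first by rewrite !subrr mulr0 subr0 normr0 mulr0.
have yx0 : y - x != 0 by rewrite subr_eq0.
have := hd (y - x); rewrite /ball /= sub0r normrN => /(_ yd yx0).
rewrite /GRing.scale /= mulr1 subrK => h.
have -> : F y - F x - D * (y - x) = - ((y - x) * (D - (y - x)^-1 * (F y - F x))).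
  by field.
by rewrite normrN normrM mulrC ler_wpM2r.
Qed.

Lemma eps_is_derive (F : R -> R) (x D : R) :
  (forall e : R, 0 < e -> exists2 d : R, 0 < d &
    forall y, `|y - x| < d -> `|F y - F x - D * (y - x)| <= e * `|y - x|) ->
  is_derive x 1 F D.
Proof.
move=> H.
have cF : h^-1 *: (F (h *: 1 + x) - F x) @[h --> 0^'] --> D.
  apply/cvgrPdist_le => e /H[d d0 hd].
  rewrite near_withinE; apply/nbhs_ballP; exists d => //= h.
  rewrite /ball /= sub0r normrN => hd' h0.
  have := hd (h *: 1 + x); rewrite addrK /GRing.scale /= mulr1 => /(_ hd') le.
  have -> : D - h^-1 * (F (h + x) - F x) = - (h^-1 * (F (h + x) - F x - D * h)).
    by field.
  by rewrite normrN normrM normfV mulrC ler_pdivrMr ?normr_gt0.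
by apply: DeriveDef; [apply/cvg_ex; exists D|exact: cvg_lim].
Qed.

Lemma is_derive_der (F : R -> R) (x D : R) (A : set R) : is_derive x 1 F D ->
  der RC A (fun y => (F y)%:C) x D%:C.
Proof.
move=> /is_derive_eps H; apply: derP => e /H[d d0 hd]; exists d => // y _.
by rewrite nm_RCB => /hd; rewrite -!rmorphB -rmorphM -rmorphB !nm_real.
Qed.

Lemma ReM_real (u : R[i]) (a : R) : complex.Re (u * a%:C) = complex.Re u * a.
Proof. by case: u => s t /=; ring. Qed.
Lemma ReB (u v : R[i]) : complex.Re (u - v) = complex.Re u - complex.Re v.
Proof. by case: u v => ? ? []. Qed.
Lemma ImB (u v : R[i]) : complex.Im (u - v) = complex.Im u - complex.Im v.
Proof. by case: u v => ? ? []. Qed.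
Lemma ReD (u v : R[i]) : complex.Re (u + v) = complex.Re u + complex.Re v.
Proof. by case: u v => ? ? []. Qed.
Lemma ImD (u v : R[i]) : complex.Im (u + v) = complex.Im u + complex.Im v.
Proof. by case: u v => ? ? []. Qed.
Lemma ReImE (u : R[i]) : u = (complex.Re u)%:C + 'i%C * (complex.Im u)%:C.
Proof. exact: complexE. Qed.

Lemma der_Re (f : R -> R[i]) (A : set R) x D : der RC A f x D ->
  der RC A (fun y => (complex.Re (f y))%:C) x (complex.Re D)%:C.
Proof.
move=> df; have H := der_eps df; apply: derP => e /H[d d0 hd]; exists d => // y Ay /(hd y Ay).
rewrite -!rmorphB -rmorphM -rmorphB !nm_real; apply: le_trans.
apply: le_trans (nm_Re _); rewrite !ReB.
by rewrite (_ : complex.Re (D * (y - x)%:C) = complex.Re D * (y - x)) ?ReM_real.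
Qed.

Lemma der_is_derive (F : R -> R) (x D : R) (A : set R) (d : R) : 0 < d ->
  (forall y, `|y - x| < d -> A y) -> der RC A (fun y => (F y)%:C) x D%:C ->
  is_derive x 1 F D.
Proof.
move=> d0 dA df; have H := der_eps df; apply: eps_is_derive => e /H[d' d'0 hd].
exists (Num.min d d'); first by rewrite lt_min d0.
move=> y; rewrite lt_min => /andP[/dA Ay yd']; have := hd y Ay.
by rewrite nm_RCB => /(_ yd'); rewrite -!rmorphB -rmorphM -rmorphB !nm_real.
Qed.

Lemma cont_Re (f : R -> R[i]) x : cont_at RC setT f x ->
  {for x, continuous (fun y => complex.Re (f y))}.
Proof.
move=> cf; apply/cvgrPdist_le => e /cf[d d0 hd].
apply/nbhs_ballP; exists d => //= y; rewrite /ball /= => yd.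
have := hd y I; rewrite nm_RCB distrC => /(_ yd); apply: le_trans.
by rewrite distrC -ReB nm_Re.
Qed.

Lemma cont_Im (f : R -> R[i]) x : cont_at RC setT f x ->
  {for x, continuous (fun y => complex.Im (f y))}.
Proof.
move=> cf; apply/cvgrPdist_le => e /cf[d d0 hd].
apply/nbhs_ballP; exists d => //= y; rewrite /ball /= => yd.
have := hd y I; rewrite nm_RCB distrC => /(_ yd); apply: le_trans.
by rewrite distrC -ImB nm_Im.
Qed.

Lemma real_primitive (f : R -> R) (a : R) : continuous f ->
  exists F : R -> R, forall x, a <= x -> is_derive x 1 F (f x).
Proof.
move=> cf.
(* The lower end [a - 1] makes every [x >= a] an interior point, so that the derivative at [a] is
   two-sided as well. *)
pose F (x : R) : R := (\int[lebesgue_measure]_(t in `[(a - 1)%R, x]) f t)%R.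
exists F => x ax.
have fi : lebesgue_measure.-integrable `[(a - 1)%R, (x + 1)%R] (EFin \o f).
  apply: continuous_compact_integrable; first exact: segment_compact.
  exact: continuous_subspaceT.
have xu : x < x + 1 by lra.
have ax' : (a - 1 < x) by lra.
have [dF F'] := continuous_FTC1_closed xu fi ax' (cf x).
exact (DeriveDef dF (etrans (esym (derive1E _ _)) F')).
Qed.

Lemma primitive (f : R -> R[i]) (a : R) : (forall x, cont_at RC setT f x) ->
  exists F : R -> R[i], forall x, a <= x -> der RC setT F x (f x).
Proof.
move=> cf.
have [F hF] := real_primitive a (fun x => cont_Re (cf x)).
have [G hG] := real_primitive a (fun x => cont_Im (cf x)).
exists (fun x => (F x)%:C + 'i%C * (G x)%:C) => x ax.
rewrite [X in der _ _ _ _ X]ReImE; apply: derD.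
  exact: is_derive_der (hF x ax).
by apply: derZ; exact: is_derive_der (hG x ax).
Qed.

(** A retraction of the line onto the segment that does not increase distances; composition with it
    extends a continuous function from the segment to the line. *)
Definition clamp (a b x : R) : R := Num.max a (Num.min b x).

Lemma clamp_seg (a b x : R) : a <= b -> seg a b (clamp a b x).
Proof.
move=> ab; rewrite /seg /= /clamp.
by rewrite le_max lexx /= ge_max ab ge_min lexx.
Qed.

Lemma clamp_id (a b x : R) : seg a b x -> clamp a b x = x.
Proof. by move=> /andP[ax xb]; rewrite /clamp min_r// max_r. Qed.

Lemma max_lip (a x y : R) : `|Num.max a x - Num.max a y| <= `|x - y|.
Proof.
have hn : x - y <= `|x - y| by exact: ler_norm.
have hn' : y - x <= `|x - y| by rewrite distrC ler_norm.
by rewrite ler_norml; case: (leP a x) => h1; case: (leP a y) => h2; lra.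
Qed.

Lemma min_lip (a x y : R) : `|Num.min a x - Num.min a y| <= `|x - y|.
Proof.
have hn : x - y <= `|x - y| by exact: ler_norm.
have hn' : y - x <= `|x - y| by rewrite distrC ler_norm.
by rewrite ler_norml; case: (leP a x) => h1; case: (leP a y) => h2; lra.
Qed.

Lemma clamp_lip (a b x y : R) : `|clamp a b x - clamp a b y| <= `|x - y|.
Proof. exact: le_trans (max_lip _ _ _) (min_lip _ _ _). Qed.

Lemma primitive_seg (f : R -> R[i]) (a b : R) : a <= b ->
  (forall x, seg a b x -> cont_at RC (seg a b) f x) ->
  exists F : R -> R[i], forall x, seg a b x -> der RC (seg a b) F x (f x).
Proof.
move=> ab cf.
have [x|F hF] := @primitive (f \o clamp a b) a.
  apply: (@cont_comp _ _ _ RC RC setT (seg a b)) => //.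
  - by move=> y _; exact: clamp_seg.
  - move=> e e0; exists e => // y _; rewrite nm_RCB => /ltW; apply: le_trans.
    by rewrite -[leLHS]/(nm (RC (clamp a b y) - RC (clamp a b x))) nm_RCB clamp_lip.
  - by apply: cf; exact: clamp_seg.
exists F => x xab; move/andP: (xab) => [ax _].
have := hF x ax; rewrite /= clamp_id//.
exact: der_sub.
Qed.

Lemma primitive_half (f : R -> R[i]) :
  (forall x, halfline x -> cont_at RC halfline f x) ->
  exists F : R -> R[i], forall x, halfline x -> der RC halfline F x (f x).
Proof.
move=> cf.
have [x|F hF] := @primitive (f \o Num.max 0) 0.
  apply: (@cont_comp _ _ _ RC RC setT halfline) => //.
  - by move=> y _; rewrite /halfline /= le_max lexx.
  - move=> e e0; exists e => // y _; rewrite nm_RCB => /ltW; apply: le_trans.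
    by rewrite -[leLHS]/(nm (RC (Num.max 0 y) - RC (Num.max 0 x))) nm_RCB max_lip.
  - by apply: cf; rewrite /halfline /= le_max lexx.
exists F => x x0.
have := hF x x0; rewrite /= max_r//.
exact: der_sub.
Qed.

End RealDerivatives.

(** * The complex exponential *)

Section ComplexExponential.
Context {R : realType}.
Local Notation RC := (real_complex R).

Definition cis (t : R) : R[i] := cos t +i* sin t.
Definition cexp (z : R[i]) : R[i] := (expR (complex.Re z))%:C * cis (complex.Im z).

Lemma cisD s t : cis (s + t) = cis s * cis t.
Proof.
rewrite /cis cosD sinD; apply/eqP; rewrite eq_complex /=.
by apply/andP; split; apply/eqP; ring.
Qed.
Lemma nm_cis t : nm (cis t) = 1.
Proof. by rewrite /= cos2Dsin2 sqrtr1. Qed.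
Lemma cis0 : cis 0 = 1.
Proof. by rewrite /cis cos0 sin0. Qed.
Lemma cis2pi : cis (2 * pi) = 1.
Proof. by rewrite /cis mulr_natl cos2pi mulr2n sinD sinpi mul0r mulr0 addr0. Qed.
Lemma cexpD z w : cexp (z + w) = cexp z * cexp w.
Proof. by rewrite /cexp ReD ImD cisD expRD rmorphM; ring. Qed.
Lemma nm_cexp z : nm (cexp z) = expR (complex.Re z).
Proof. by rewrite nmM nm_cis nm_real mulr1 ger0_norm// expR_ge0. Qed.
Lemma cexp_real (t : R) : cexp t%:C = (expR t)%:C.
Proof. by rewrite /cexp /= cis0 mulr1. Qed.

Lemma der_cexp A z : der id A cexp z (cexp z).
Proof.
(* By the functional equation it is enough to differentiate at 0. *)
suff H : forall e : R, 0 < e -> exists2 d : R, 0 < d & forall h : R[i],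
    nm h < d -> nm (cexp h - 1 - h) <= e * nm h.
  apply: derP => e e0.
  have Ez : 0 < nm (cexp z) by rewrite nm_cexp expR_gt0.
  have e'0 : 0 < e / nm (cexp z) by rewrite divr_gt0.
  have [d d0 hd] := H _ e'0; exists d => // y _ /hd h1.
  have Ey : cexp y = cexp (y - z) * cexp z by rewrite -cexpD subrK.
  have -> : cexp y - cexp z - cexp z * (y - z) =
    cexp z * (cexp (y - z) - 1 - (y - z)) by rewrite Ey; ring.
  rewrite nmM (le_trans (ler_wpM2l (ltW Ez) h1))//.
  by rewrite mulrA mulrCA divff ?mulr1// gt_eqF.
move=> e e0.
have e8 : 0 < e / 8 by rewrite divr_gt0.
have [d1 d10 h1] := is_derive_eps (is_derive_expR (0 : R)) e8.
have [d2 d20 h2] := is_derive_eps (is_derive_cos (0 : R)) e8.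
have [d3 d30 h3] := is_derive_eps (is_derive_sin (0 : R)) e8.
have [d4 d40 h4] := is_derive_eps (is_derive_expR (0 : R)) ltr01.
(* The bound [1/2] yields [expR t <= 2], and [e/8] controls the mixed term. The four parts of the
   remainder then add up to at most 7/8 of [e * n]. *)
pose d := Num.min (Num.min d1 d2) (Num.min d3 (Num.min d4 (Num.min (1/2) (e/8)))).
have d0 : 0 < d by rewrite !lt_min d10 d20 d30 d40 /= divr_gt0//= e8.
exists d => // -[t s] ht.
have tl : `|t| <= nm (t +i* s) by exact: nm_Re (t +i* s).
have sl : `|s| <= nm (t +i* s) by exact: nm_Im (t +i* s).
set n := nm _ in ht tl sl *.
have n0 : 0 <= n by exact: nm_ge0.
move: ht; rewrite !lt_min => /andP[/andP[n1 n2] /andP[n3 /andP[n4 /andP[n5 n6]]]].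
have k1 := h1 t; rewrite subr0 expR0 mul1r in k1.
have k2 := h2 s; rewrite subr0 cos0 sin0 oppr0 mul0r subr0 in k2.
have k3 := h3 s; rewrite subr0 sin0 cos0 mul1r subr0 in k3.
have k4 := h4 t; rewrite subr0 expR0 !mul1r in k4.
have {}k1 := k1 (le_lt_trans tl n1); have {}k2 := k2 (le_lt_trans sl n2).
have {}k3 := k3 (le_lt_trans sl n3); have {}k4 := k4 (le_lt_trans tl n4).
have b1 : `|expR t - 1| <= 2 * n.
  rewrite -[expR t - 1](subrK t) (le_trans (ler_normD _ _))//.
  lra.
have b2 : expR t <= 2.
  have := ler_norm (expR t - 1); lra.
have -> : cexp (t +i* s) - 1 - (t +i* s) = (expR t - 1 - t)%:C +
   ((expR t * (cos s - 1))%:C + ('i%C * (expR t * (sin s - s))%:C +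
    'i%C * ((expR t - 1) * s)%:C)).
  apply/eqP; rewrite eq_complex /= !(mul0r, mulr0, mul1r, add0r, addr0, subr0).
  by apply/andP; split; apply/eqP; ring.
have E0 : 0 <= expR t := expR_ge0 t.
have q1 : nm (expR t - 1 - t)%:C <= e / 8 * n.
  by rewrite nm_real (le_trans k1)// ler_wpM2l// ltW.
have q2 : nm (expR t * (cos s - 1))%:C <= 2 * (e / 8 * n).
  rewrite nm_real normrM ger0_norm// ler_pM// (le_trans k2)//.
  by rewrite ler_wpM2l// ltW.
have q3 : nm ('i%C * (expR t * (sin s - s))%:C) <= 2 * (e / 8 * n).
  rewrite nmM nm_i mul1r nm_real normrM ger0_norm// ler_pM// (le_trans k3)//.
  by rewrite ler_wpM2l// ltW.
have q4 : nm ('i%C * ((expR t - 1) * s)%:C) <= 2 * n * (e / 8).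
  rewrite nmM nm_i mul1r nm_real normrM ler_pM// (le_trans sl)// ltW//.
have en : 0 <= e * n by rewrite mulr_ge0// ltW.
rewrite (le_trans (nmD _ _))// (le_trans (lerD q1 (nmD _ _)))//.
rewrite (le_trans (lerD (lexx _) (lerD q2 (nmD _ _))))//.
rewrite (le_trans (lerD (lexx _) (lerD (lexx _) (lerD q3 q4))))//.
lra.
Qed.

End ComplexExponential.

(** * Power series expansion on a punctured disc *)

Section IntegralByPrimitives.
Context {R : realType}.
Local Notation RC := (real_complex R).
Implicit Types (f g F G : R -> R[i]) (a b c : R).

Definition prim_on f a b F := forall x, seg a b x -> der RC (seg a b) F x (f x).

Definition cont_on f a b := forall x, seg a b x -> cont_at RC (seg a b) f x.

(* 0 by default when [f] has no primitive on [seg a b]. *)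
Definition cint f a b : R[i] :=
  let F := xget (fun=> 0) [set F | prim_on f a b F] in F b - F a.

Lemma seg_l a b : a <= b -> seg a b a. Proof. by rewrite /seg /= lexx. Qed.
Lemma seg_r a b : a <= b -> seg a b b.
Proof. by rewrite /seg /= lexx andbT. Qed.
Lemma seg_subset a b p q : a <= p -> q <= b -> seg p q `<=` seg a b.
Proof. by move=> ap qb u /andP[pu uq]; rewrite /seg /= (le_trans ap)// (le_trans uq). Qed.

Lemma cintE f a b F : a <= b -> prim_on f a b F -> cint f a b = F b - F a.
Proof.
move=> ab hF; rewrite /cint; set G := xget _ _.
have hG : prim_on f a b G by rewrite /G; case: xgetP => [F' _ //|/(_ F)].
have : G b - F b = G a - F a.
  apply: (@der0_const _ (fun x => G x - F x)) => // x xab.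
  by rewrite -(subrr (f x)); apply: derB; [exact: hG|exact: hF].
move=> h; have -> : G b = G a - F a + F b by rewrite -h subrK.
by ring.
Qed.

Lemma prim_ex f a b : a <= b -> cont_on f a b -> exists F, prim_on f a b F.
Proof. by move=> ab cf; exact: primitive_seg. Qed.

Lemma prim_sub f a b F p q : a <= p -> q <= b -> prim_on f a b F -> prim_on f p q F.
Proof.
move=> ap qb hF x xpq; have sub := seg_subset ap qb.
exact: der_sub sub (hF x (sub x xpq)).
Qed.

Lemma cint_ext f g a b : a <= b -> (forall x, seg a b x -> f x = g x) ->
  cint f a b = cint g a b.
Proof.
move=> ab fg; rewrite /cint.
suff -> : prim_on f a b = prim_on g a b by [].
apply/funext => F; apply/propext.
by split=> hF x xab; [rewrite -fg|rewrite fg]; rewrite //; exact: hF.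
Qed.

Lemma cint_chasles f a b c : a <= b -> b <= c -> cont_on f a c ->
  cint f a c = cint f a b + cint f b c.
Proof.
move=> ab bc cf; have ac := le_trans ab bc.
have [F hF] := prim_ex ac cf.
rewrite (cintE ac hF) (cintE ab (F := F)) ?(cintE bc (F := F)); first by ring.
  exact: prim_sub hF.
exact: prim_sub hF.
Qed.

Lemma cintB f g a b : a <= b -> cont_on f a b -> cont_on g a b ->
  cint (fun x => f x - g x) a b = cint f a b - cint g a b.
Proof.
move=> ab cf cg; have [F hF] := prim_ex ab cf; have [G hG] := prim_ex ab cg.
rewrite (cintE ab hF) (cintE ab hG) (@cintE _ _ _ (fun x => F x - G x))//.
  by ring.
by move=> x xab; apply: derB; [exact: hF|exact: hG].
Qed.

Lemma cintD f g a b : a <= b -> cont_on f a b -> cont_on g a b ->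
  cint (fun x => f x + g x) a b = cint f a b + cint g a b.
Proof.
move=> ab cf cg; have [F hF] := prim_ex ab cf; have [G hG] := prim_ex ab cg.
rewrite (cintE ab hF) (cintE ab hG) (@cintE _ _ _ (fun x => F x + G x))//.
  by ring.
by move=> x xab; apply: derD; [exact: hF|exact: hG].
Qed.

Lemma cintZc f (c : R[i]) a b : a <= b -> cont_on f a b ->
  cint (fun x => c * f x) a b = c * cint f a b.
Proof.
move=> ab cf; have [F hF] := prim_ex ab cf.
rewrite (cintE ab hF) (@cintE _ _ _ (fun x => c * F x))//; first by ring.
by move=> x xab; apply: derZ; exact: hF.
Qed.

Lemma cint_cst (c : R[i]) a b : a <= b -> cint (fun=> c) a b = c * (b - a)%:C.
Proof.
move=> ab; rewrite (@cintE _ _ _ (fun x => c * RC x))//.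
  by rewrite rmorphB; ring.
by move=> x xab; rewrite -[X in der _ _ _ _ X]mulr1; apply: derZ; exact: der_id.
Qed.

Lemma cint_bound f a b M : a <= b -> cont_on f a b ->
  (forall x, seg a b x -> nm (f x) <= M) -> nm (cint f a b) <= M * (b - a).
Proof.
move=> ab cf fM; have [F hF] := prim_ex ab cf.
by rewrite (cintE ab hF); apply: (mean_value (f' := f)).
Qed.

Lemma cint_sum (f_ : nat -> R -> R[i]) (n : nat) a b : a <= b -> (forall k, cont_on (f_ k) a b) ->
  cint (fun x => \sum_(k < n) f_ k x) a b = \sum_(k < n) cint (f_ k) a b.
Proof.
move=> ab cf; have [F hF] := choice (fun k => prim_ex ab (cf k)).
rewrite (@cintE _ _ _ (fun x => \sum_(k < n) F k x))//.
  by rewrite -sumrB; apply: eq_bigr => k _; rewrite (cintE ab (hF k)).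
by move=> x xab; apply: der_sum => k; exact: hF.
Qed.

End IntegralByPrimitives.

(** * Goursat's theorem on rectangles *)

Section Goursat.
Context {R : realType}.
Local Notation RC := (real_complex R).
Implicit Types (g : R[i] -> R[i]) (p q s t : R).

Definition pt (x y : R) : R[i] := x%:C + 'i%C * y%:C.

Lemma Re_pt x y : complex.Re (pt x y) = x.
Proof. by rewrite /pt /=; ring. Qed.
Lemma Im_pt x y : complex.Im (pt x y) = y.
Proof. by rewrite /pt /=; ring. Qed.
Definition contour g p q s t : R[i] :=
  (cint (fun x => g (pt x s)) p q - cint (fun x => g (pt x t)) p q) +
  'i%C * (cint (fun y => g (pt q y)) s t - cint (fun y => g (pt p y)) s t).

Definition rect p q s t : set R[i] :=
  [set z | seg p q (complex.Re z) /\ seg s t (complex.Im z)].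

Lemma rect_pt p q s t x y : seg p q x -> seg s t y -> rect p q s t (pt x y).
Proof. by move=> h1 h2; split; rewrite ?Re_pt ?Im_pt. Qed.

Definition rcont g p q s t := forall z, rect p q s t z -> cont_at id (rect p q s t) g z.

Lemma rcontH g p q s t y : rcont g p q s t -> seg s t y ->
  cont_on (fun x => g (pt x y)) p q.
Proof.
move=> cg yst x xpq.
apply: (@cont_comp _ _ _ RC id (seg p q) (rect p q s t) (fun x => pt x y) g).
- by move=> u upq; exact: rect_pt.
- by apply: contD; [exact: cont_id|exact: cont_cst].
- by apply: cg; exact: rect_pt.
Qed.

Lemma rcontV g p q s t x : rcont g p q s t -> seg p q x ->
  cont_on (fun y => g (pt x y)) s t.
Proof.
move=> cg xpq y yst.
apply: (@cont_comp _ _ _ RC id (seg s t) (rect p q s t) (fun y => pt x y) g).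
- by move=> u upq; exact: rect_pt.
- apply: contD; first exact: cont_cst.
  by apply: contM; [exact: cont_cst|exact: cont_id].
- by apply: cg; exact: rect_pt.
Qed.

Lemma rect_subset p q s t p' q' s' t' : p <= p' -> q' <= q -> s <= s' -> t' <= t ->
  rect p' q' s' t' `<=` rect p q s t.
Proof.
by move=> h1 h2 h3 h4 z [/(seg_subset h1 h2) ? /(seg_subset h3 h4) ?]; split.
Qed.

Lemma rcont_sub g p q s t p' q' s' t' : p <= p' -> q' <= q -> s <= s' -> t' <= t ->
  rcont g p q s t -> rcont g p' q' s' t'.
Proof.
move=> h1 h2 h3 h4 cg z zr; apply: (cont_sub (rect_subset h1 h2 h3 h4)).
by apply: cg; exact: rect_subset zr.
Qed.

Lemma contour_splitV g p m q s t : p <= m -> m <= q -> s <= t -> rcont g p q s t ->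
  contour g p q s t = contour g p m s t + contour g m q s t.
Proof.
move=> pm mq st cg; rewrite /contour.
rewrite !(@cint_chasles _ _ p m q)//; first by ring.
  by apply: rcontH cg _; exact: seg_r.
by apply: rcontH cg _; exact: seg_l.
Qed.

Lemma contour_splitH g p q s m t : p <= q -> s <= m -> m <= t -> rcont g p q s t ->
  contour g p q s t = contour g p q s m + contour g p q m t.
Proof.
move=> pq sm mt cg; rewrite /contour.
rewrite !(@cint_chasles _ _ s m t)//; first by ring.
  by apply: rcontV cg _; exact: seg_l.
by apply: rcontV cg _; exact: seg_r.
Qed.

(** The first order Taylor polynomials subtracted in Goursat's argument are of this form; their
    integrals over the sides are explicit. *)
Lemma contour_affine (al be : R[i]) p q s t : p <= q -> s <= t ->
  contour (fun z => al + be * z) p q s t = 0.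
Proof.
move=> pq st; rewrite /contour.
have H y : cint (fun x => al + be * pt x y) p q =
  (al + be * ('i%C * y%:C)) * (q - p)%:C + be * ((q%:C ^+ 2 - p%:C ^+ 2) / 2).
  rewrite (@cintE _ _ _ _ (fun x => (al + be * ('i%C * y%:C)) * RC x +
     (be / 2) * RC x ^+ 2))//; first by rewrite rmorphB; field.
  move=> x xpq; rewrite /pt.
  apply: (@derE _ _ _ _ _ _ ((al + be * ('i%C * y%:C)) * 1 +
     (be / 2) * (2%:R * RC x ^+ 1 * 1))); first by rewrite expr1; field.
  apply: derD; first by apply: derZ; exact: der_id.
  by apply: derZ; apply: (derX 2) => //; exact: der_id.
have V x : cint (fun y => al + be * pt x y) s t =
  (al + be * x%:C) * (t - s)%:C + be * 'i%C * ((t%:C ^+ 2 - s%:C ^+ 2) / 2).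
  rewrite (@cintE _ _ _ _ (fun y => (al + be * x%:C) * RC y +
     (be * 'i%C / 2) * RC y ^+ 2))//; first by rewrite rmorphB; field.
  move=> y yst; rewrite /pt.
  apply: (@derE _ _ _ _ _ _ ((al + be * x%:C) * 1 +
     (be * 'i%C / 2) * (2%:R * RC y ^+ 1 * 1))); first by rewrite expr1; field.
  apply: derD; first by apply: derZ; exact: der_id.
  by apply: derZ; apply: (derX 2) => //; exact: der_id.
by rewrite !H !V !rmorphB; field.
Qed.

Lemma contourB g h p q s t : p <= q -> s <= t -> rcont g p q s t -> rcont h p q s t ->
  contour (fun z => g z - h z) p q s t = contour g p q s t - contour h p q s t.
Proof.
move=> pq st cg ch.
have l1 := seg_l pq; have r1 := seg_r pq; have l2 := seg_l st; have r2 := seg_r st.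
rewrite /contour.
rewrite (cintB pq (rcontH cg l2) (rcontH ch l2)) (cintB pq (rcontH cg r2) (rcontH ch r2)).
rewrite (cintB st (rcontV cg l1) (rcontV ch l1)) (cintB st (rcontV cg r1) (rcontV ch r1)).
ring.
Qed.

Lemma contour_bound g p q s t M : p <= q -> s <= t -> rcont g p q s t ->
  (forall z, rect p q s t z -> nm (g z) <= M) ->
  nm (contour g p q s t) <= 2 * M * ((q - p) + (t - s)).
Proof.
move=> pq st cg gM.
have l1 := seg_l pq; have r1 := seg_r pq; have l2 := seg_l st; have r2 := seg_r st.
have H y : seg s t y -> nm (cint (fun x => g (pt x y)) p q) <= M * (q - p).
  move=> yst; apply: cint_bound => //; first exact: rcontH cg yst.
  by move=> x xpq; apply: gM; exact: rect_pt.
have V x : seg p q x -> nm (cint (fun y => g (pt x y)) s t) <= M * (t - s).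
  move=> xpq; apply: cint_bound => //; first exact: rcontV cg xpq.
  by move=> y yst; apply: gM; exact: rect_pt.
rewrite /contour (le_trans (nmD _ _))// nmM nm_i mul1r.
rewrite (le_trans (lerD (nmB _ _) (nmB _ _)))//.
have := H _ l2; have := H _ r2; have := V _ l1; have := V _ r1.
lra.
Qed.

(** The bound by the squared half perimeter is stable under quartering, since four quarters of half
    the perimeter contribute 4/4 of it. It holds on small rectangles around a point because there
    [g] is affine up to [e'] times the diameter. *)
Theorem goursat g p q s t : p <= q -> s <= t ->
  (forall z, rect p q s t z -> exists D, der id (rect p q s t) g z D) ->
  contour g p q s t = 0.
Proof.
move=> pq st dg.
have cg : rcont g p q s t by move=> z zr; have [D] := dg z zr; exact: der_cont.
apply: nm_eq0_le; apply/ler_addgt0Pr => e e0; rewrite add0r.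
pose L := (q - p) + (t - s) + 1.
have L0 : 0 < L by rewrite /L; lra.
(* Chosen so that the final bound is at most [e]; the [+ 1] in [L] keeps it positive for a
   degenerate rectangle. *)
pose e' := e / (2 * L ^+ 2).
have e'0 : 0 < e' by rewrite divr_gt0// mulr_gt0// exprn_gt0.
suff : nm (contour g p q s t) <= 2 * e' * ((q - p) + (t - s)) ^+ 2.
  move/le_trans; apply.
  have -> : e = 2 * e' * L ^+ 2 by rewrite /e'; field; rewrite gt_eqF.
  apply: ler_wpM2l; first by rewrite mulr_ge0// ltW.
  rewrite ler_pXn2r ?nnegrE//; rewrite /L; lra.
apply: (rect_ind (P := fun p q s t =>
  nm (contour g p q s t) <= 2 * e' * ((q - p) + (t - s)) ^+ 2) pq st).
  move=> a b c d pa ab bq sc cd dt h1 h2 h3 h4.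
  have cg' : rcont g a b c d by exact: rcont_sub cg.
  have m1 : a <= (a + b) / 2 by lra.
  have m2 : (a + b) / 2 <= b by lra.
  have n1 : c <= (c + d) / 2 by lra.
  have n2 : (c + d) / 2 <= d by lra.
  rewrite (contour_splitV m1 m2 cd cg').
  rewrite (contour_splitH m1 n1 n2 (rcont_sub (lexx a) m2 (lexx c) (lexx d) cg')).
  rewrite (contour_splitH m2 n1 n2 (rcont_sub m1 (lexx b) (lexx c) (lexx d) cg')).
  rewrite (le_trans (nmD _ _))// (le_trans (lerD (nmD _ _) (nmD _ _)))//.
  rewrite (le_trans (lerD (lerD h1 h2) (lerD h3 h4)))//.
  rewrite le_eqVlt; apply/orP; left; apply/eqP; by field.
move=> x y xpq yst.
have zr : rect p q s t (pt x y) by exact: rect_pt.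
have [D dD] := dg _ zr.
have [d d0 hd] := der_eps dD e'0.
have d20 : 0 < d / 2 by rewrite divr_gt0.
exists (d / 2) => // a b c c' /andP[pa ax] /andP[xb bq] /andP[sc cy] /andP[yc' c't] ba cc'.
have ab : a <= b by exact: le_trans xb.
have cc : c <= c' by exact: le_trans yc'.
have cg' : rcont g a b c c' by exact: rcont_sub cg.
pose h z := (g (pt x y) - D * pt x y) + D * z.
have ch : rcont h a b c c'.
  move=> z _; apply: contD; first exact: cont_cst.
  by apply: contM; [exact: cont_cst|exact: cont_id].
have E := contourB ab cc cg' ch.
rewrite [X in _ - X]contour_affine// subr0 in E.
rewrite -E expr2 mulrA -[X in X * _]mulrA.
apply: contour_bound => //.
  by move=> z zr'; apply: contB; [exact: cg'|exact: ch].
move=> z [/andP[z1 z2] /andP[z3 z4]].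
have -> : g z - h z = g z - g (pt x y) - D * (z - pt x y) by rewrite /h; ring.
have nz : nm (z - pt x y) <= (b - a) + (c' - c).
  rewrite (le_trans (nm_le_ReIm _))// ReB ImB Re_pt Im_pt lerD// ler_norml; lra.
rewrite (le_trans (hd z _ _))//.
- by apply: (rect_subset pa bq sc c't); split; apply/andP.
- by rewrite (le_lt_trans nz)//; lra.
- by rewrite ler_wpM2l// ltW.
Qed.

End Goursat.

(** * Integrals over circles *)

Section Circle.
Context {R : realType}.
Local Notation RC := (real_complex R).
Implicit Types (k : R[i] -> R[i]) (rho : R).

(** The integral of [k] against [dw / (i w)] over the circle of radius [rho]. In this normalisation
    the Cauchy kernel is [w / (w - w0)]. *)
Definition circ k rho : R[i] := cint (fun t => k (rho%:C * cis t)) 0 (2 * pi).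

Lemma twopi_ge0 : 0 <= 2 * pi :> R.
Proof. by rewrite mulr_ge0// pi_ge0. Qed.

Lemma nm_circle rho t : 0 <= rho -> nm (rho%:C * cis t) = rho.
Proof. by move=> r0; rewrite nmM nm_real nm_cis mulr1 ger0_norm. Qed.

(** In logarithmic coordinates the annulus becomes a rectangle of height [2 * pi]. Its horizontal
    sides cancel by periodicity, and Goursat's theorem equates the vertical ones. *)
Theorem circ_const k rho1 rho2 : 0 < rho1 -> rho1 <= rho2 ->
  (forall w, rho1 <= nm w <= rho2 -> exists D, der id setT k w D) ->
  circ k rho1 = circ k rho2.
Proof.
move=> r1 r12 dk.
have r2 : 0 < rho2 by exact: lt_le_trans r12.
have l12 : ln rho1 <= ln rho2 by rewrite ler_ln.
have G := @goursat R (k \o cexp) (ln rho1) (ln rho2) 0 (2 * pi) l12 twopi_ge0.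
have E rho t : 0 < rho -> cexp (pt (ln rho) t) = rho%:C * cis t.
  by move=> r0; rewrite /cexp Re_pt Im_pt lnK.
have /G : forall z, rect (ln rho1) (ln rho2) 0 (2 * pi) z ->
    exists D, der id (rect (ln rho1) (ln rho2) 0 (2 * pi)) (k \o cexp) z D.
  move=> z [/andP[z1 z2] _].
  have [|D dD] := dk (cexp z).
    by rewrite nm_cexp -[rho1]lnK ?posrE// -[rho2]lnK ?posrE// !ler_expR z1.
  exists (D * cexp z); apply: (@der_comp _ _ _ id id _ setT) => //.
  exact: der_cexp.
rewrite /contour /=.
have -> : (fun x => k (cexp (pt x (2 * pi)))) = (fun x => k (cexp (pt x 0))) :> (R -> R[i]).
  by apply/funext => x; rewrite /cexp !Im_pt !Re_pt cis2pi cis0.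
rewrite subrr add0r => /eqP; rewrite mulf_eq0 => /orP[/eqP i0|].
  by have := @nm_i R; rewrite i0 nm0 => /esym/eqP; rewrite oner_eq0.
rewrite subr_eq0 => /eqP H; rewrite /circ.
have C rho : 0 < rho -> (fun t => k (rho%:C * cis t)) = (fun y => k (cexp (pt (ln rho) y))).
  by move=> r0; apply/funext => t; rewrite E.
by rewrite (C _ r1) (C _ r2) H.
Qed.

End Circle.

Section DiscExpansion.
Context {R : realType}.
Local Notation RC := (real_complex R).
Implicit Types (f k : R[i] -> R[i]) (rho : R) (w : R[i]).

Lemma cont_cis A (x : R) : cont_at RC A cis x.
Proof.
have -> : cis = cexp \o (fun t : R => 'i%C * t%:C) :> (R -> R[i]).
  apply/funext => t; rewrite /cexp /=.
  have -> : 0 * t - 1 * 0 = 0 :> R by ring.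
  have -> : 0 * 0 + 1 * t = t :> R by ring.
  by rewrite expR0 mul1r.
apply: (@cont_comp _ _ _ RC id A setT) => //.
  by apply: contM; [exact: cont_cst|exact: cont_id].
exact: der_cont (der_cexp _ _).
Qed.

Lemma circle_cont k rho : 0 <= rho -> (forall w, nm w = rho -> cont_at id setT k w) ->
  cont_on (fun t => k (rho%:C * cis t)) 0 (2 * pi).
Proof.
move=> r0 ck t _; apply: (@cont_comp _ _ _ RC id _ setT (fun t => rho%:C * cis t)) => //.
  by apply: contM; [exact: cont_cst|exact: cont_cis].
by apply: ck; rewrite nm_circle.
Qed.

Lemma circ_bound k rho M : 0 <= rho -> (forall w, nm w = rho -> cont_at id setT k w) ->
  (forall w, nm w = rho -> nm (k w) <= M) -> nm (circ k rho) <= M * (2 * pi).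
Proof.
move=> r0 ck kM; rewrite -[2 * pi]subr0; apply: cint_bound; first exact: twopi_ge0.
  exact: circle_cont.
by move=> t _; apply: kM; rewrite nm_circle.
Qed.

Lemma circ_ext k k' rho : 0 <= rho -> (forall w, nm w = rho -> k w = k' w) ->
  circ k rho = circ k' rho.
Proof.
move=> r0 kk; apply: cint_ext; first exact: twopi_ge0.
by move=> t _; rewrite kk// nm_circle.
Qed.

Lemma circB k k' rho : 0 <= rho -> (forall w, nm w = rho -> cont_at id setT k w) ->
  (forall w, nm w = rho -> cont_at id setT k' w) ->
  circ (fun w => k w - k' w) rho = circ k rho - circ k' rho.
Proof.
by move=> r0 ck ck'; rewrite /circ -cintB//;
  [exact: twopi_ge0|exact: circle_cont|exact: circle_cont].
Qed.

Lemma circZ k (c : R[i]) rho : 0 <= rho -> (forall w, nm w = rho -> cont_at id setT k w) ->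
  circ (fun w => c * k w) rho = c * circ k rho.
Proof.
by move=> r0 ck; rewrite /circ -cintZc//; [exact: twopi_ge0|exact: circle_cont].
Qed.

Lemma circ_cst (c : R[i]) rho : circ (fun=> c) rho = c * (2 * pi)%:C.
Proof. by rewrite /circ cint_cst ?subr0//; exact: twopi_ge0. Qed.

Lemma circle_ucont k rho e : 0 <= rho -> 0 < e ->
  (forall w, nm w = rho -> cont_at id setT k w) ->
  exists2 d : R, 0 < d & forall rho' t, 0 <= t <= 2 * pi -> `|rho' - rho| < d ->
    nm (k (rho'%:C * cis t) - k (rho%:C * cis t)) <= e.
Proof.
move=> r0 e0 ck.
apply: (segment_ind (P := fun p q => exists2 d : R, 0 < d &
  forall rho' t, p <= t <= q -> `|rho' - rho| < d ->
    nm (k (rho'%:C * cis t) - k (rho%:C * cis t)) <= e) twopi_ge0).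
  move=> p m q _ pm mq _ [d d0 hd] [d' d'0 hd'].
  exists (Num.min d d'); first by rewrite lt_min d0.
  move=> rho' t /andP[pt tq]; rewrite lt_min => /andP[l1 l2].
  have [tm|/ltW mt] := leP t m; first by apply: hd => //; rewrite pt.
  by apply: hd' => //; rewrite mt.
move=> x _.
have e2 : 0 < e / 2 by rewrite divr_gt0.
have [d d0 hd] := ck _ (nm_circle x r0) _ e2.
(* Half of [d] is reserved for the change of angle, half for the change of radius; the [+ 1] covers
   [rho = 0]. *)
have e3 : 0 < d / (2 * (rho + 1)) by rewrite divr_gt0// mulr_gt0//; lra.
have [d' d'0 hd'] := @cont_cis setT x _ e3.
exists d' => // p q /andP[_ px] /andP[xq _] pq.
exists (d / 2); first by rewrite divr_gt0.
move=> rho' t /andP[pt tq] rr.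
have tx : nm (cis t - cis x) <= d / (2 * (rho + 1)).
  by apply: hd' => //; rewrite nm_RCB ltr_norml; lra.
have rtx : rho * nm (cis t - cis x) < d / 2.
  apply: (@le_lt_trans _ _ (rho * (d / (2 * (rho + 1))))); first by rewrite ler_wpM2l.
  have -> : rho * (d / (2 * (rho + 1))) = (d / 2) * (rho / (rho + 1)).
    by field; rewrite gt_eqF//; lra.
  rewrite gtr_pMr ?divr_gt0// ltr_pdivrMr; lra.
have h1 : nm (k (rho'%:C * cis t) - k (rho%:C * cis x)) <= e / 2.
  apply: hd => //; change (nm (rho'%:C * cis t - rho%:C * cis x) < d).
  have -> : rho'%:C * cis t - rho%:C * cis x =
     (rho' - rho)%:C * cis t + rho%:C * (cis t - cis x) by rewrite rmorphB; ring.
  rewrite (le_lt_trans (nmD _ _))// !nmM nm_cis mulr1 !nm_real (ger0_norm r0).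
  by rewrite [ltRHS](splitr d) ltrD.
have h2 : nm (k (rho%:C * cis t) - k (rho%:C * cis x)) <= e / 2.
  apply: hd => //; change (nm (rho%:C * cis t - rho%:C * cis x) < d).
  by rewrite -mulrBr nmM nm_real ger0_norm//; lra.
have -> : k (rho'%:C * cis t) - k (rho%:C * cis t) =
  (k (rho'%:C * cis t) - k (rho%:C * cis x)) - (k (rho%:C * cis t) - k (rho%:C * cis x)).
  by ring.
rewrite (le_trans (nmB _ _))//; lra.
Qed.

(** Serves to pass over a circle on which the integrand is merely known to be continuous at some
    point. *)
Lemma circ_radius_cont k rho eta e : 0 < rho -> 0 < eta -> 0 < e ->
  (forall w, `|nm w - rho| < eta -> cont_at id setT k w) ->
  exists2 d : R, 0 < d & forall rho', `|rho' - rho| < d ->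
    nm (circ k rho' - circ k rho) <= e.
Proof.
move=> r0 eta0 e0 ck.
have tp : 0 < 2 * pi :> R by rewrite mulr_gt0// pi_gt0.
have e1 : 0 < e / (2 * pi) by rewrite divr_gt0.
have ckr w : nm w = rho -> cont_at id setT k w by move=> E; apply: ck; rewrite E subrr normr0.
have [d d0 hd] := circle_ucont (ltW r0) e1 ckr.
exists (Num.min d (Num.min rho eta)); first by rewrite !lt_min d0 r0.
move=> rho'; rewrite !lt_min => /andP[l1 /andP[l2 l3]].
have r'0 : 0 < rho' by move: l2; rewrite ltr_norml; lra.
have ckr' w : nm w = rho' -> cont_at id setT k w by move=> E; apply: ck; rewrite E.
have c1 := circle_cont (ltW r'0) ckr'.
have c2 := circle_cont (ltW r0) ckr.
rewrite /circ -cintB//; last exact: twopi_ge0.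
have -> : e = e / (2 * pi) * (2 * pi - 0) by rewrite subr0 divfK// gt_eqF.
apply: cint_bound; first exact: twopi_ge0.
  by move=> t tt; apply: contB; [exact: c1|exact: c2].
by move=> t tt; apply: hd.
Qed.

Lemma tends_to_zero (x C : R) : 0 <= C -> (forall e, 0 < e -> e <= 1 -> x <= C * e) -> x <= 0.
Proof.
move=> C0 H; apply/ler_addgt0Pr => e e0; rewrite add0r.
have C1 : 0 < C + 1 by lra.
pose m := Num.min 1 (e / (C + 1)).
have m0 : 0 < m by rewrite lt_min ltr01 divr_gt0.
have m1 : m <= 1 by rewrite ge_min lexx.
have m2 : m <= e / (C + 1) by rewrite ge_min lexx orbT.
rewrite (le_trans (H m m0 m1))// (le_trans (ler_wpM2l C0 m2))//.
by rewrite mulrCA ger_pMr// ler_pdivrMr//; lra.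
Qed.

(** The integral does not depend on the radius, and on growing circles the integrand tends to 1. *)
Lemma circ_pole w0 rho : nm w0 < rho -> circ (fun w => w / (w - w0)) rho = (2 * pi)%:C.
Proof.
move=> wr; have n0 := nm_ge0 w0.
have r0 : 0 < rho by lra.
have nz w : nm w0 < nm w -> w - w0 != 0.
  by move=> l; rewrite subr_eq0; apply/eqP => E; rewrite E ltxx in l.
have dk w : nm w0 < nm w -> exists D, der id setT (fun w => w / (w - w0)) w D.
  move=> l; eexists; apply: derM => //; first exact: der_id.
  apply: derV_at => //; first exact: nz.
  by apply: derB; [exact: der_id|exact: der_cst].
have ck w : nm w0 < nm w -> cont_at id setT (fun w => w / (w - w0)) w.
  by move=> /dk[D]; exact: der_cont.
apply/eqP; rewrite -subr_eq0 -nm_eq0 eq_le nm_ge0 andbT.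
apply: (@tends_to_zero _ (2 * pi)); first exact: twopi_ge0.
move=> e e0 e1.
(* On this circle [nm (w - w0)] is at least [nm w0 / e], so the integrand differs from 1 by at most
   [e]. *)
pose rho' := Num.max rho (nm w0 + nm w0 / e).
have rr : rho <= rho' by rewrite le_max lexx.
have re : nm w0 + nm w0 / e <= rho' by rewrite le_max lexx orbT.
have r'0 : 0 <= rho' by rewrite (le_trans (ltW r0)).
have r'w : nm w0 < rho' by rewrite (lt_le_trans wr).
rewrite (circ_const r0 rr); last first.
  by move=> w /andP[h _]; apply: dk; exact: lt_le_trans h.
rewrite -[(2 * pi)%:C]mul1r -(circ_cst 1 rho') -circB//.
- rewrite mulrC; apply: circ_bound => //.
    move=> w E; apply: contB; last exact: cont_cst.
    by apply: ck; rewrite E.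
  move=> w E.
  have wn : w - w0 != 0 by apply: nz; rewrite E.
  have -> : w / (w - w0) - 1 = w0 / (w - w0) by field.
  rewrite nmM nmV ler_pdivrMr ?nm_gt0//.
  have h := nmBB w w0; rewrite E in h.
  have h2 : nm w0 / e <= nm (w - w0) by lra.
  by rewrite ler_pdivrMr// mulrC in h2.
- by move=> w E; apply: ck; rewrite E.
- by move=> w _; exact: cont_cst.
Qed.

Section Expansion.
Variables (f : R[i] -> R[i]) (r : R).
Hypothesis r0 : 0 < r.
Hypothesis df : forall w, w != 0 -> nm w < r -> exists D, der id setT f w D.
Hypothesis fM : forall w, w != 0 -> nm w < r -> nm (f w) <= 1.

Let cf w : w != 0 -> nm w < r -> cont_at id setT f w.
Proof. by move=> w0 wr; have [D] := df w0 wr; exact: der_cont. Qed.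

(** Cauchy's formula across the puncture at 0. The function [k] is holomorphic off 0 and [w0], so
    its circle integrals are constant on either side of [nm w0]. On the inside they vanish, as [f]
    is bounded and the circles may shrink to 0; continuity of [k] at [w0] carries this value to the
    outside. *)
Lemma cauchy_formula w0 rho : w0 != 0 -> nm w0 < rho -> rho < r ->
  circ (fun w => f w * (w / (w - w0))) rho = f w0 * (2 * pi)%:C.
Proof.
move=> w00 wr rr; have n0 : 0 < nm w0 by rewrite nm_gt0.
have rho0 : 0 < rho by lra.
have w0r : nm w0 < r by lra.
have [D [phi [cphi _ Ephi]]] := df w00 w0r.
(* [phi] is the difference quotient of [f] at [w0], so [k] extends [(f w - f w0) * (w / (w - w0))]
   continuously to [w0]. *)
pose k w := w * phi w.
have kE w : w != w0 -> k w = (f w - f w0) * (w / (w - w0)).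
  by move=> ww; have := Ephi w I; rewrite /= => ->; rewrite /k; field; rewrite subr_eq0.
have dk w : w != 0 -> nm w < r -> w != w0 -> exists D, der id setT k w D.
  move=> wn wl ww; have [Df hDf] := df wn wl.
  have wd : 0 < nm (w - w0) by rewrite nm_gt0 subr_eq0.
  eexists.
  apply: (@der_local _ _ id setT (fun w => (f w - f w0) * (w / (w - w0))) k w _ _ wd) => //.
    move=> y _ yw; rewrite kE//; apply/eqP => E; move: yw.
    by rewrite E /= nmC ltxx.
  apply: derM => //; first by apply: derB; [exact: hDf|exact: der_cst].
  apply: derM => //; first exact: der_id.
  apply: derV_at => //; first by rewrite subr_eq0.
  by apply: derB; [exact: der_id|exact: der_cst].
have ck w : w != 0 -> nm w < r -> cont_at id setT k w.
  move=> wn wl; have [->|ww] := eqVneq w w0.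
    by apply: contM => //; exact: cont_id.
  by have [Dk] := dk w wn wl ww; exact: der_cont.
have nzw rho' w : 0 < rho' -> nm w = rho' -> w != 0.
  by move=> h E; rewrite -nm_gt0 E.
have left_zero rho1 : 0 < rho1 -> rho1 < nm w0 -> circ k rho1 = 0.
  move=> r1 r1w; apply/eqP; rewrite -nm_eq0 eq_le nm_ge0 andbT.
  (* On the circle of radius [e * rho1] the increment of [f] is at most 2 and [w / (w - w0)] is at
     most [e * rho1 / (nm w0 - rho1)]. *)
  pose C := 2 * rho1 / (nm w0 - rho1) * (2 * pi).
  have C0 : 0 <= C.
    rewrite mulr_ge0 ?twopi_ge0// divr_ge0//; first lra.
    by rewrite subr_ge0 ltW.
  apply: (@tends_to_zero _ C C0) => e e0 e1.
  have er0 : 0 < e * rho1 by rewrite mulr_gt0.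
  have er1 : e * rho1 <= rho1 by rewrite ger_pMl.
  rewrite -(circ_const er0 er1); last first.
    move=> w /andP[h1 h2]; apply: dk; first by rewrite -nm_gt0 (lt_le_trans er0).
      lra.
    by apply/eqP => E; move: h2; rewrite E; lra.
  rewrite /C mulrAC; apply: circ_bound; first exact: ltW.
    by move=> w E; apply: ck; [exact: nzw E|rewrite E; lra].
  move=> w E; have wn : w != w0 by apply/eqP => E'; move: E; rewrite E'; lra.
  have wp : 0 < nm (w - w0) by rewrite nm_gt0 subr_eq0.
  rewrite kE// !nmM nmV E.
  have h1 : nm (f w - f w0) <= 2.
    rewrite (le_trans (nmB _ _))//.
    have := fM w00 w0r; have := fM (nzw _ _ er0 E); rewrite E => /(_ ltac:(lra)).
    lra.
  have h2 : (nm (w - w0))^-1 <= (nm w0 - rho1)^-1.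
    rewrite lef_pV2 ?posrE ?subr_gt0//.
    have := nmBB w0 w; rewrite E nmC; lra.
  have -> : 2 * rho1 / (nm w0 - rho1) * e = 2 * (e * rho1 * (nm w0 - rho1)^-1) by ring.
  have h3 : e * rho1 * (nm (w - w0))^-1 <= e * rho1 * (nm w0 - rho1)^-1.
    by rewrite ler_wpM2l// ltW.
  apply: ler_pM => //; first exact: nm_ge0.
  by rewrite mulr_ge0 ?invr_ge0 ?nm_ge0// ltW.
have eta0 : 0 < Num.min (nm w0) (r - nm w0) by rewrite lt_min n0 subr_gt0.
have radius_cont e : 0 < e -> exists2 d : R, 0 < d & forall rho', `|rho' - nm w0| < d ->
    nm (circ k rho' - circ k (nm w0)) <= e.
  move=> e0; apply: (circ_radius_cont n0 eta0 e0) => w.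
  rewrite lt_min => /andP[h1 h2]; apply: ck.
    by rewrite -nm_gt0; move: h1; rewrite ltr_norml; lra.
  by move: h2; rewrite ltr_norml; lra.
have mid_zero : circ k (nm w0) = 0.
  apply: nm_eq0_le; apply/ler_addgt0Pr => e e0; rewrite add0r.
  have [d d0 hd] := radius_cont e e0.
  pose rho1 := nm w0 - Num.min (d / 2) (nm w0 / 2).
  have m0 : 0 < Num.min (d / 2) (nm w0 / 2) by rewrite lt_min !divr_gt0.
  have m1 : Num.min (d / 2) (nm w0 / 2) <= d / 2 by rewrite ge_min lexx.
  have m2 : Num.min (d / 2) (nm w0 / 2) <= nm w0 / 2 by rewrite ge_min lexx orbT.
  have := hd rho1; rewrite left_zero ?sub0r ?nmN /rho1; [|lra|lra].
  by apply; rewrite ltr_norml; lra.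
have right_zero : circ k rho = 0.
  apply: nm_eq0_le; apply/ler_addgt0Pr => e e0; rewrite add0r.
  have [d d0 hd] := radius_cont e e0.
  pose rho1 := nm w0 + Num.min (d / 2) (rho - nm w0).
  have m0 : 0 < Num.min (d / 2) (rho - nm w0) by rewrite lt_min divr_gt0// subr_gt0.
  have m1 : Num.min (d / 2) (rho - nm w0) <= d / 2 by rewrite ge_min lexx.
  have m2 : Num.min (d / 2) (rho - nm w0) <= rho - nm w0 by rewrite ge_min lexx orbT.
  have rho10 : 0 < rho1 by rewrite /rho1; lra.
  have rho11 : rho1 <= rho by rewrite /rho1; lra.
  have := hd rho1; rewrite mid_zero subr0 (circ_const rho10 rho11).
    by apply; rewrite /rho1 ltr_norml; lra.
  move=> w /andP[h1 h2]; apply: dk.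
  - by rewrite -nm_gt0; lra.
  - lra.
  - by apply/eqP => E; move: h1; rewrite E /rho1; lra.
have cpole w : nm w = rho -> cont_at id setT (fun w => w / (w - w0)) w.
  move=> E; have ww : w - w0 != 0.
    by rewrite subr_eq0; apply/eqP => E'; move: E; rewrite E'; lra.
  apply: contM; first exact: cont_id.
  by apply: contV => //; apply: contB; [exact: cont_id|exact: cont_cst].
rewrite -(circ_pole wr) -circZ//; last exact: ltW.
apply/eqP; rewrite -subr_eq0 -circB//; last 3 first.
- exact: ltW.
- by move=> w E; apply: contM; [apply: cf; [exact: nzw E|rewrite E]|exact: cpole].
- by move=> w E; apply: contM; [exact: cont_cst|exact: cpole].
rewrite -right_zero; apply/eqP; apply: circ_ext; first exact: ltW.
move=> w E; rewrite kE; first by ring.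
by apply/eqP => E'; move: E; rewrite E'; lra.
Qed.

(** Riemann's theorem on removable singularities in terms of coefficients. Integrating over the
    circle of radius [r / 2] gives the powers of [2 / r]; for [nm w <= r / 4] the Cauchy kernel has
    modulus at most 2 there, which is the factor in the remainder. *)
Theorem disc_expansion : exists c : nat -> R[i],
  (forall n, nm (c n) <= (2 / r) ^+ n) /\
  (forall N w, w != 0 -> nm w <= r / 4 ->
     nm (f w - \sum_(n < N) c n * w ^+ n) <= 2 * (2 / r * nm w) ^+ N).
Proof.
have rpos := r0; pose rho := r / 2.
have rho0 : 0 < rho by rewrite /rho; lra.
have rr : rho < r by rewrite /rho; lra.
have tp : 0 < 2 * pi :> R by rewrite mulr_gt0// pi_gt0.
have tpc : (2 * pi)%:C != 0 :> R[i] by rewrite -nm_gt0 nm_real ger0_norm// ltW.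
have nzw w : nm w = rho -> w != 0 by move=> E; rewrite -nm_gt0 E.
have cfr w : nm w = rho -> cont_at id setT f w.
  by move=> E; apply: cf; [exact: nzw|rewrite E].
have cfn n w : nm w = rho -> cont_at id setT (fun w => f w * w^-1 ^+ n) w.
  move=> E; apply: contM; first exact: cfr.
  by apply: contX; apply: contV; [exact: nzw|exact: cont_id].
pose c n := circ (fun w => f w * w^-1 ^+ n) rho / (2 * pi)%:C.
have rhoV : rho^-1 = 2 / r by rewrite /rho invf_div.
exists c; split.
  move=> n; rewrite nmM nmV nm_real (ger0_norm (ltW tp)) ler_pdivrMr//.
  apply: circ_bound; [exact: ltW|exact: cfn|move=> w E].
  rewrite nmM nmX nmV E rhoV ler_piMl//.
    by rewrite exprn_ge0// divr_ge0// ltW.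
  by apply: fM; [exact: nzw|rewrite E].
move=> N w0 w00 w0r.
have n0 : 0 < nm w0 by rewrite nm_gt0.
have w0rho : nm w0 < rho by rewrite /rho; lra.
have ww w : nm w = rho -> w - w0 != 0.
  by move=> E; rewrite subr_eq0; apply/eqP => E'; move: E; rewrite E'; lra.
have cpole w : nm w = rho -> cont_at id setT (fun w => w / (w - w0)) w.
  move=> E; apply: contM; first exact: cont_id.
  by apply: contV => //; [exact: ww|apply: contB; [exact: cont_id|exact: cont_cst]].
(* What is left of [f] times the Cauchy kernel after [N] terms of the geometric series in
   [w0 / w]. *)
pose rem w := f w * ((w0 / w) ^+ N * (w / (w - w0))).
have crem w : nm w = rho -> cont_at id setT rem w.
  move=> E; apply: contM; first exact: cfr.
  apply: contM; last exact: cpole.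
  apply: contX; apply: contM; first exact: cont_cst.
  by apply: contV; [exact: nzw|exact: cont_id].
have brem : nm (circ rem rho) <= 2 * (2 / r * nm w0) ^+ N * (2 * pi).
  apply: circ_bound; [exact: ltW|exact: crem|move=> w E].
  rewrite !nmM nmX nmM !nmV E rhoV mulrA mulrC [nm w0 * _]mulrC ler_pM//.
  - by rewrite mulr_ge0 ?invr_ge0 ?nm_ge0// ltW.
  - by rewrite mulr_ge0 ?nm_ge0// exprn_ge0// mulr_ge0 ?nm_ge0// divr_ge0// ltW.
  - rewrite ler_pdivrMr ?nm_gt0 ?ww//.
    have := nmBB w w0; rewrite E /rho; lra.
  - rewrite ler_piMl//; first by rewrite exprn_ge0// mulr_ge0 ?nm_ge0// divr_ge0// ltW.
    by apply: fM; [exact: nzw|rewrite E].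
have := cauchy_formula w00 w0rho rr.
have -> : circ (fun w => f w * (w / (w - w0))) rho =
   (\sum_(n < N) c n * w0 ^+ n) * (2 * pi)%:C + circ rem rho.
  have csum n w : nm w = rho -> cont_at id setT (fun w => w0 ^+ n * (f w * w^-1 ^+ n)) w.
    by move=> E; apply: contM; [exact: cont_cst|exact: cfn].
  have -> : (\sum_(n < N) c n * w0 ^+ n) * (2 * pi)%:C =
     circ (fun w => \sum_(n < N) (w0 ^+ n * (f w * w^-1 ^+ n))) rho.
    rewrite /circ (@cint_sum _ (fun n t => w0 ^+ n * (f (rho%:C * cis t) *
       (rho%:C * cis t)^-1 ^+ n))).
    - rewrite mulr_suml; apply: eq_bigr => n _.
      rewrite cintZc ?twopi_ge0//; last exact: circle_cont (ltW rho0) (cfn n).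
      have -> : c n * w0 ^+ n * (2 * pi)%:C = w0 ^+ n * (c n * (2 * pi)%:C) by ring.
      by rewrite /c divfK.
    - exact: twopi_ge0.
    - by move=> k; apply: (circle_cont (ltW rho0) (csum k)).
  rewrite /circ -cintD; last 3 first.
  - exact: twopi_ge0.
  - move=> t tt.
    have H m : cont_at RC (seg 0 (2 * pi)) (fun x => \sum_(n < m) w0 ^+ n *
        (f (rho%:C * cis x) * (rho%:C * cis x)^-1 ^+ n)) t.
      elim: m => [|m IH].
        by under eq_fun do rewrite big_ord0; exact: cont_cst.
      under eq_fun do rewrite big_ord_recr /=.
      by apply: contD => //; exact: (circle_cont (ltW rho0) (csum m)).
    exact: H.
  - exact: circle_cont (ltW rho0) crem.
  apply: cint_ext; first exact: twopi_ge0.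
  move=> t _; set w := rho%:C * cis t.
  have E : nm w = rho by rewrite nm_circle// ltW.
  have wz := nzw w E; have wwz := ww w E.
  rewrite /rem; elim: N {w0r rem crem brem} => [|N IH].
    by rewrite big_ord0 add0r expr0 mul1r.
  rewrite big_ord_recr /= IH -addrA; congr (_ + _).
  by rewrite exprS exprMn; field; rewrite wz wwz.
move=> H.
have -> : f w0 - \sum_(n < N) c n * w0 ^+ n = circ rem rho / (2 * pi)%:C.
  by apply: (mulIf tpc); rewrite mulrBl -H divfK//; ring.
by rewrite nmM nmV nm_real (ger0_norm (ltW tp)) ler_pdivrMr.
Qed.

End Expansion.
End DiscExpansion.

(** * Absolute continuity on the half line *)

Section AbsolutelyContinuous.
Context {R : realType}.
Local Notation RC := (real_complex R).
Local Notation mu := (@lebesgue_measure R).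
Implicit Types (f g h F : R -> R[i]) (b : R) (s : seq (R * R)).

(** Sorted lists in place of the indexed families of [absolutely_continuous]: they allow induction,
    and families on adjacent segments are simply concatenated. *)
Definition ivs (a b : R) s : bool :=
  all (fun c => [&& a <= c.1, c.1 <= c.2 & c.2 <= b]) s &&
  pairwise (fun c d => c.2 <= d.1) s.

Definition abscont f b := forall e : R, 0 < e -> exists2 d : R, 0 < d &
  forall s, ivs 0 b s -> \sum_(c <- s) (c.2 - c.1) < d ->
    \sum_(c <- s) nm (f c.2 - f c.1) <= e.

Lemma AC_of_defs f b : absolutely_continuous (fun x => complex.Re (f x)) 0 b ->
  absolutely_continuous (fun x => complex.Im (f x)) 0 b -> abscont f b.
Proof.
move=> hR hI e e0; have e2 : 0 < e / 2 by rewrite divr_gt0.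
have [d d0 hd] := hR _ e2; have [d' d'0 hd'] := hI _ e2.
exists (Num.min d d'); first by rewrite lt_min d0.
move=> s /andP[/allP sb /(pairwiseP (0, 0)) sp]; rewrite lt_min => /andP[l1 l2].
pose l (i : 'I_(size s)) := (nth (0, 0) s i).1.
pose u (i : 'I_(size s)) := (nth (0, 0) s i).2.
have inb i : [/\ 0 <= l i, l i <= u i & u i <= b].
  by have /and3P[] := sb _ (mem_nth (0, 0) (ltn_ord i)).
have dis (i j : 'I_(size s)) : i != j -> u i <= l j \/ u j <= l i.
  move=> ij; have [lij|lji|E] := ltngtP i j.
  - by left; apply: sp => //; rewrite inE.
  - by right; apply: sp => //; rewrite inE.
  - by rewrite (ord_inj E) eqxx in ij.
have E (G : R * R -> R) : \sum_(c <- s) G c = \sum_(i < size s) G (nth (0, 0) s i).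
  by rewrite (big_nth (0, 0)) big_mkord.
have /ltW h1 := hd _ l u inb dis ltac:(by move: l1; rewrite E).
have /ltW h2 := hd' _ l u inb dis ltac:(by move: l2; rewrite E).
rewrite E [e]splitr (le_trans _ (lerD h1 h2))// -big_split /= ler_sum// => i _.
by rewrite (le_trans (nm_le_ReIm _))// ReB ImB.
Qed.

(** Sums, products, inverses, conjugates and exponentials are all handled through such a bound of
    increments by increments. *)
Lemma AC_lip2 f g h b C :
  (forall u l, seg 0 b u -> seg 0 b l ->
     nm (h u - h l) <= C * (nm (f u - f l) + nm (g u - g l))) ->
  abscont f b -> abscont g b -> abscont h b.
Proof.
move=> H cf cg e e0.
have C0 : 0 < `|C| + 1 by rewrite ltr_wpDl.
have e2 : 0 < e / (2 * (`|C| + 1)) by rewrite divr_gt0// mulr_gt0.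
have [d d0 hd] := cf _ e2; have [d' d'0 hd'] := cg _ e2.
exists (Num.min d d'); first by rewrite lt_min d0.
move=> s si; rewrite lt_min => /andP[/(hd s si) h1 /(hd' s si) h2].
apply: (@le_trans _ _ (\sum_(c <- s) (`|C| + 1) *
   (nm (f c.2 - f c.1) + nm (g c.2 - g c.1)))).
  rewrite big_seq [leRHS]big_seq ler_sum// => c cs.
  have /andP[/allP si1 _] := si; have /and3P[c1 c2 c3] := si1 _ cs.
  have u1 : seg 0 b c.1 by rewrite /seg /= c1 (le_trans c2).
  have u2 : seg 0 b c.2 by rewrite /seg /= c3 (le_trans c1).
  rewrite (le_trans (H _ _ u2 u1))// ler_wpM2r// ?addr_ge0 ?nm_ge0//.
  by rewrite (le_trans (ler_norm _))// lerDl.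
rewrite -mulr_sumr big_split /= (le_trans (ler_wpM2l (ltW C0) (lerD h1 h2)))//.
by rewrite le_eqVlt; apply/orP; left; apply/eqP; field; rewrite gt_eqF.
Qed.

Lemma AC_lip f h b C :
  (forall u l, seg 0 b u -> seg 0 b l -> nm (h u - h l) <= C * nm (f u - f l)) ->
  abscont f b -> abscont h b.
Proof.
move=> H cf; apply: (AC_lip2 (C := `|C|) _ cf cf) => u l hu hl.
rewrite (le_trans (H u l hu hl))//.
have h1 : C * nm (f u - f l) <= `|C| * nm (f u - f l).
  by rewrite ler_wpM2r ?nm_ge0// ler_norm.
have h2 : 0 <= `|C| * nm (f u - f l) by rewrite mulr_ge0// nm_ge0.
by rewrite mulrDr; lra.
Qed.

Lemma AC_id b : abscont RC b.
Proof.
move=> e e0; exists e => // s /andP[/allP si _] /ltW; apply: le_trans.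
rewrite big_seq [leRHS]big_seq ler_sum// => c /si /and3P[_ h _].
by rewrite nm_RCB ger0_norm// subr_ge0.
Qed.

Lemma AC_lipschitz h b C :
  (forall u l, seg 0 b u -> seg 0 b l -> nm (h u - h l) <= C * `|u - l|) -> abscont h b.
Proof.
by move=> H; apply: (AC_lip (C := C) _ (@AC_id b)) => u l hu hl; rewrite nm_RCB; exact: H.
Qed.

Lemma AC_cst (c : R[i]) b : abscont (fun=> c) b.
Proof. by apply: (@AC_lipschitz _ _ 0) => u l _ _; rewrite subrr nm0 mul0r. Qed.

Lemma AC_der f f' b M : (forall x, seg 0 b x -> der RC (seg 0 b) f x (f' x)) ->
  (forall x, seg 0 b x -> nm (f' x) <= M) -> abscont f b.
Proof.
move=> df fM; apply: (@AC_lipschitz _ _ M) => u l hu hl.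
by have := mvt_seg hl df fM hu; rewrite nm_RCB.
Qed.

Lemma AC_cont f b : abscont f b -> cont_on f 0 b.
Proof.
move=> cf x xb e e0; have [d d0 hd] := cf e e0; exists d => // y yb; rewrite nm_RCB => yx.
move: xb yb => /andP[x0 xb] /andP[y0 yb].
have [xy|yx'] := leP x y.
  have := hd [:: (x, y)]; rewrite /ivs !big_seq1 /= x0 xy yb /= => /(_ isT); apply.
  by rewrite (le_lt_trans (ler_norm _)).
have := hd [:: (y, x)]; rewrite /ivs !big_seq1 /= y0 (ltW yx') xb /= nmC => /(_ isT); apply.
by rewrite (le_lt_trans (ler_norm _))// distrC.
Qed.

Lemma bounded_on f a b : a <= b -> cont_on f a b ->
  exists2 M : R, 0 <= M & forall x, seg a b x -> nm (f x) <= M.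
Proof.
move=> ab cf.
apply: (segment_ind (P := fun p q => exists2 M : R, 0 <= M &
  forall x, seg p q x -> nm (f x) <= M) ab).
  move=> p m q _ _ _ _ [M M0 hM] [N N0 hN]; exists (M + N); first lra.
  move=> x /andP[px xq]; have [xm|/ltW mx] := leP x m.
    by have := hM x; rewrite /seg /= px xm => /(_ isT); lra.
  by have := hN x; rewrite /seg /= mx xq => /(_ isT); lra.
move=> x xab; have [d d0 hd] := cf x xab 1 ltr01.
exists d => // p q /andP[ap px] /andP[xq qb] pq.
exists (nm (f x) + 1); first by rewrite addr_ge0 ?nm_ge0.
move=> y /andP[py yq].
have yab : seg a b y by rewrite /seg /= (le_trans ap py) (le_trans yq qb).
have h : nm (f y - f x) <= 1 by apply: hd => //; rewrite nm_RCB ltr_norml; lra.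
have := nmBB (f y) (f x); lra.
Qed.

Lemma bounded_below f a b : a <= b -> cont_on f a b -> (forall x, seg a b x -> f x != 0) ->
  exists2 m : R, 0 < m & forall x, seg a b x -> m <= nm (f x).
Proof.
move=> ab cf f0.
have [x xab|M M0 hM] := @bounded_on (fun x => (f x)^-1) a b ab.
  by apply: contV; [exact: f0|exact: cf].
exists (M + 1)^-1; first by rewrite invr_gt0; lra.
move=> x xab; rewrite -[leRHS]invrK lef_pV2 ?posrE ?invr_gt0 ?nm_gt0 ?f0//; last lra.
by rewrite -nmV (le_trans (hM x xab))// lerDl.
Qed.

Section Closure.
Variables (b : R).
Hypothesis b0 : 0 <= b.

Lemma AC_bounded f : abscont f b -> exists2 M : R, 0 <= M & forall x, seg 0 b x -> nm (f x) <= M.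
Proof. by move=> /AC_cont; exact: bounded_on. Qed.

Lemma ACD f g : abscont f b -> abscont g b -> abscont (fun x => f x + g x) b.
Proof.
apply: (@AC_lip2 _ _ _ _ 1) => u l _ _.
have -> : f u + g u - (f l + g l) = (f u - f l) + (g u - g l) by ring.
by rewrite mul1r nmD.
Qed.

Lemma ACB f g : abscont f b -> abscont g b -> abscont (fun x => f x - g x) b.
Proof.
apply: (@AC_lip2 _ _ _ _ 1) => u l _ _.
have -> : f u - g u - (f l - g l) = (f u - f l) - (g u - g l) by ring.
by rewrite mul1r nmB.
Qed.

Lemma ACM f g : abscont f b -> abscont g b -> abscont (fun x => f x * g x) b.
Proof.
move=> cf cg; have [M M0 hM] := AC_bounded cf; have [N N0 hN] := AC_bounded cg.
apply: (AC_lip2 (C := M + N) _ cf cg) => u l hu hl.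
have -> : f u * g u - f l * g l = f u * (g u - g l) + (f u - f l) * g l by ring.
have h1 : nm (f u) * nm (g u - g l) <= M * nm (g u - g l) by rewrite ler_wpM2r ?nm_ge0 ?hM.
have h2 : nm (g l) * nm (f u - f l) <= N * nm (f u - f l) by rewrite ler_wpM2r ?nm_ge0 ?hN.
have h3 : 0 <= M * nm (f u - f l) by rewrite mulr_ge0 ?nm_ge0.
have h4 : 0 <= N * nm (g u - g l) by rewrite mulr_ge0 ?nm_ge0.
by rewrite (le_trans (nmD _ _))// !nmM [nm (f u - f l) * _]mulrC; lra.
Qed.

Lemma ACZ (c : R[i]) f : abscont f b -> abscont (fun x => c * f x) b.
Proof. by move=> cf; apply: ACM => //; exact: AC_cst. Qed.

Lemma AC_conj f : abscont f b -> abscont (fun x => conjc (f x)) b.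
Proof.
move=> cf; apply: (AC_lip (C := 1) _ cf) => u l _ _.
by rewrite mul1r -rmorphB nm_conj.
Qed.

Lemma ACV f : (forall x, seg 0 b x -> f x != 0) -> abscont f b -> abscont (fun x => (f x)^-1) b.
Proof.
move=> f0 cf; have [m m0 hm] := bounded_below b0 (AC_cont cf) f0.
apply: (AC_lip (C := m^-1 ^+ 2) _ cf) => u l hu hl.
have -> : (f u)^-1 - (f l)^-1 = (f u)^-1 * (f l)^-1 * - (f u - f l).
  by field; rewrite !f0.
rewrite !nmM nmN !nmV ler_wpM2r ?nm_ge0// expr2 ler_pM ?invr_ge0 ?nm_ge0//.
  by rewrite lef_pV2 ?posrE ?nm_gt0 ?f0 ?hm.
by rewrite lef_pV2 ?posrE ?nm_gt0 ?f0 ?hm.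
Qed.

Lemma AC_cexp f : abscont f b -> abscont (fun x => cexp (f x)) b.
Proof.
move=> cf; have [M M0 hM] := AC_bounded cf.
apply: (AC_lip (C := expR (M + 1)) _ cf) => u l hu hl.
apply: (@mvt_disc _ 0 (M + 1) _ _ cexp cexp).
- by rewrite /disc /= subr0 (le_lt_trans (hM l hl))// ltrDl.
- by move=> y _; exact: der_cexp.
- move=> y yd; have /ltW yM : nm y < M + 1 by move: yd; rewrite /disc /= subr0.
  rewrite nm_cexp ler_expR.
  by rewrite (le_trans (ler_norm _))// (le_trans (nm_Re _)).
- by rewrite /disc /= subr0 (le_lt_trans (hM u hu))// ltrDl.
Qed.

End Closure.

Lemma ivs_subset a b c d s : a <= c -> d <= b -> ivs c d s -> ivs a b s.
Proof.
move=> ac db /andP[/allP h1 h2]; rewrite /ivs h2 andbT; apply/allP => x /h1/and3P[k1 k2 k3].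
by rewrite k2 (le_trans ac) ?(le_trans _ db).
Qed.

Lemma ivs_cat a m b s s' : a <= m -> m <= b -> ivs a m s -> ivs m b s' -> ivs a b (s ++ s').
Proof.
move=> am mb h h'.
have /andP[h1 _] := ivs_subset (lexx a) mb h.
have /andP[h1' _] := ivs_subset am (lexx b) h'.
move: h h' => /andP[/allP k1 k2] /andP[/allP k1' k2'].
rewrite /ivs all_cat h1 h1' pairwise_cat k2 k2' !andbT /=.
apply/allrelP => x y /k1/and3P[_ _ xm] /k1'/and3P[my _ _].
exact: le_trans my.
Qed.

(* The bad points are covered by an open set of small measure, on which F
   varies little by absolute continuity; off it the derivative is used. *)
Lemma AC_monotone F b p q : 0 <= p -> p <= q -> q <= b -> abscont F b ->
  {ae mu, forall x, 0 <= x -> exists D, der RC setT F x D /\ 0 <= complex.Re D} ->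
  complex.Re (F p) <= complex.Re (F q).
Proof.
move=> p0 pq qb cF [N [mN N0 hN]].
apply/ler_addgt0Pr => e e0.
have L0 : 0 < q - p + 1 by lra.
have e1 : 0 < e / 2 by rewrite divr_gt0.
pose e' := e / 2 / (q - p + 1); have e'0 : 0 < e' by rewrite divr_gt0.
have [d d0 hd] := cF _ e1.
have [|U [oU NU muU]] := lebesgue_regularity_outer mN _ d0.
  by apply: le_lt_trans (ltry 0); exact: (eq_ind_r (fun t => (t <= 0)%E) (lexx _) N0).
have mU : measurable U by exact: open_measurable.
have {}muU : (mu U < d%:E)%E.
  rewrite (le_lt_trans _ muU)//.
  rewrite (@le_trans _ _ (mu (U `\` N) + mu N)%E)//; last first.
    by rewrite (_ : mu N = 0%E) ?adde0.
  rewrite (le_trans _ (measureU2 _ _ _))//; last exact: measurableD.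
  apply: le_measure; rewrite ?inE//; first by apply: measurableU => //; exact: measurableD.
  by move=> x Ux; have [|] := pselect (N x); [right|left].
(* This claim is suited to bisection. The list [s] collects segments around bad points, each
   contained in [U] up to its left end; half open intervals make the measure of the intersection
   with [U] additive under concatenation. *)
suff [s si [sl]] : exists2 s, ivs p q s &
   ((\sum_(c <- s) (c.2 - c.1))%:E <= mu (U `&` `]p, q]))%E /\
   complex.Re (F p) <= complex.Re (F q) + e' * (q - p) + \sum_(c <- s) nm (F c.2 - F c.1).
  move/le_trans; apply; rewrite [in leRHS](splitr e) [leRHS]addrA lerD//.
    by rewrite lerD2l /e' mulrAC ler_pdivrMr// ler_pM2l//; lra.
  apply: hd; first exact: ivs_subset si.
  rewrite -lte_fin (le_lt_trans sl)// (le_lt_trans _ muU)//.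
  by apply: le_measure; rewrite ?inE//; exact: measurableI.
apply: (segment_ind (P := fun p q => exists2 s, ivs p q s &
   ((\sum_(c <- s) (c.2 - c.1))%:E <= mu (U `&` `]p, q]))%E /\
   complex.Re (F p) <= complex.Re (F q) + e' * (q - p) +
     \sum_(c <- s) nm (F c.2 - F c.1)) pq).
  move=> a m c pa am mc cq [s si [sl sF]] [s' si' [sl' sF']].
  exists (s ++ s'); first exact: ivs_cat si si'.
  rewrite !big_cat /=; split; last lra.
  rewrite EFinD (le_trans (leeD sl sl'))// -measureU//; last 3 first.
  - exact: measurableI.
  - exact: measurableI.
  - rewrite -subset0 => x [[_ /=]]; rewrite !in_itv /= => /andP[_ h1] [_ /andP[h2 _]].
    by move: (le_lt_trans h1 h2); rewrite ltxx.
  apply: le_measure; rewrite ?inE.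
  - by apply: measurableU; exact: measurableI.
  - exact: measurableI.
  - move=> x [[Ux]|[Ux]] /=; rewrite !in_itv /= => /andP[h1 h2]; split => //.
      by rewrite h1 (le_trans h2).
    by rewrite h2 (le_lt_trans am).
move=> x /andP[px xq].
have x0 : 0 <= x by exact: le_trans px.
have [[D [dD D0]]|bad] := pselect (exists D, der RC setT F x D /\ 0 <= complex.Re D).
  have [d1 d10 hd1] := der_eps dD e'0.
  exists d1 => // a c /andP[pa ax] /andP[xc cq] ac.
  exists [::] => //; rewrite !big_nil addr0; split; first by rewrite measure_ge0.
  have hp : nm (F a - F x - D * (RC a - RC x)) <= e' * (x - a).
    rewrite (le_trans (hd1 a I _))// ?nm_RCB; first by rewrite distrC ger0_norm; lra.
    by rewrite distrC ger0_norm; lra.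
  have hq : nm (F c - F x - D * (RC c - RC x)) <= e' * (c - x).
    rewrite (le_trans (hd1 c I _))// ?nm_RCB; first by rewrite ger0_norm; lra.
    by rewrite ger0_norm; lra.
  have RM (u : R) : complex.Re (D * (RC u - RC x)) = complex.Re D * (u - x).
    by rewrite -rmorphB; exact: ReM_real.
  have := le_trans (nm_Re _) hp; have := le_trans (nm_Re _) hq.
  rewrite !ReB !RM !ler_norml => /andP[h1 _] /andP[_ h2].
  have h4 : 0 <= complex.Re D * (c - x) by rewrite mulr_ge0//; lra.
  have h5 : 0 <= complex.Re D * (x - a) by rewrite mulr_ge0//; lra.
  by have h6 : complex.Re D * (x - a) = - (complex.Re D * (a - x)); lra.
have Ux : U x by apply: NU; apply: hN => /= H; apply: bad; exact: H.
have /nbhs_ballP[d1 /= d10 hd1] := open_nbhs_nbhs (conj oU Ux).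
exists d1 => // a c /andP[pa ax] /andP[xc cq] ac.
exists [:: (a, c)]; first by rewrite /ivs /= !lexx (le_trans ax xc).
rewrite !big_seq1 /=; split.
  have -> : U `&` `]a, c] = `]a, c]%classic.
    apply/seteqP; split=> [y []//|y yac]; split => //.
    move: yac; rewrite /= in_itv /= => /andP[ay yc].
    by apply: hd1; rewrite /ball /= ltr_norml; lra.
  rewrite lebesgue_measure_itv /= lte_fin; case: ltP => //.
  by move=> ca; rewrite lee_fin; lra.
have := le_trans (ler_norm _) (nm_Re (F a - F c)); rewrite nmC ReB.
have : 0 <= e' * (c - a) by rewrite mulr_ge0 ?(ltW e'0)//; lra.
lra.
Qed.

End AbsolutelyContinuous.

(** * Locally integrable functions and their primitives *)

Section IntegralPrimitive.
Context {R : realType}.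
Local Notation RC := (real_complex R).
Local Notation mu := (@lebesgue_measure R).

Definition L1loc (g : R -> R) :=
  forall b : R, 0 <= b -> mu.-integrable `[0%R, b] (EFin \o g).

(** Half open intervals, so that adjacent members of a list are disjoint and their lengths add up to
    the measure of the union. *)
Let ivset (s : seq (R * R)) : set R := \big[setU/set0]_(c <- s) `]c.1, c.2]%classic.

Let ivset_measurable s : measurable (ivset s).
Proof.
elim: s => [|c s IH]; first by rewrite /ivset big_nil; exact: measurable0.
by rewrite /ivset big_cons; apply: measurableU.
Qed.

Let ivset_mem s x : ivset s x -> exists2 c, c \in s & c.1 < x.
Proof.
elim: s => [|c s IH]; first by rewrite /ivset big_nil.
rewrite /ivset big_cons => -[|/IH[d ds dx]].
  by rewrite /= in_itv /= => /andP[cx _]; exists c; rewrite ?mem_head.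
by exists d => //; rewrite in_cons ds orbT.
Qed.

Let ivset_disj (a b : R) c s : ivs a b (c :: s) -> [disjoint `]c.1, c.2]%classic & ivset s].
Proof.
move=> /andP[_ /= /andP[/allP h _]].
apply/disj_set2P; rewrite -subset0 => x [/=]; rewrite in_itv /= => /andP[_ xc].
by move=> /ivset_mem[d /h /= cd dx]; move: (le_lt_trans (le_trans xc cd) dx); rewrite ltxx.
Qed.

Let ivs_cons (a b : R) (c : R * R) (s : seq (R * R)) : ivs a b (c :: s) -> ivs a b s.
Proof. by rewrite /ivs /= => /andP[/andP[_ ->] /andP[_ ->]]. Qed.

Let ivset_mu a b s : ivs a b s -> mu (ivset s) = (\sum_(c <- s) (c.2 - c.1))%:E.
Proof.
elim: s => [|c s IH] h; first by rewrite /ivset !big_nil measure0.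
rewrite /ivset !big_cons EFinD -IH; last exact: ivs_cons h.
rewrite measureU//; last 2 first.
- exact: ivset_measurable.
- by apply/disj_set2P; exact: ivset_disj h.
congr (_ + _)%E; apply: etrans (lebesgue_measure_itv _) _.
rewrite /= lte_fin; case: ltP => h'; first by rewrite EFinB.
move: h => /andP[/= /andP[/and3P[_ h _] _] _].
by have -> : c.1 = c.2; [apply/eqP; rewrite eq_le h h'|rewrite subrr].
Qed.

Theorem L1_primitive (g : R -> R) : L1loc g -> exists G : R -> R,
  (forall b : R, 0 <= b -> abscont (fun x => (G x)%:C) b) /\
  {ae mu, forall x, 0 <= x -> der RC setT (fun x => (G x)%:C) x (g x)%:C}.
Proof.
move=> hg.
(* The extension by zero and the lower end [-1] make 0 an interior point of the domain of
   integration. *)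
pose g1 : R -> R := g \_ `[0%R, +oo[.
pose G (x : R) : R := (\int[mu]_(t in `[(-1)%R, x]) g1 t)%R.
(* The truncation at [b] is integrable on the whole line and agrees with [g1] up to [b]. *)
pose f b : R -> R := g \_ `[0%R, b].
have mI b : measurable (`[0%R, b]%classic : set R) by exact: measurable_itv.
have fint b : 0 <= b -> mu.-integrable setT (EFin \o f b).
  move=> b0; rewrite /f -restrict_EFin.
  by apply/integrable_restrict => //; rewrite setTI; exact: hg.
have fg b t : t <= b -> g1 t = f b t.
  move=> tb; rewrite /g1 /f !patchE; congr (if _ then _ else _).
  by rewrite !mem_setE !in_itv /= tb !andbT.
have g1i b : 0 <= b -> mu.-integrable `[(-1)%R, b] (EFin \o g1).
  move=> b0; have mb : measurable (`[(-1)%R, b]%classic : set R) by exact: measurable_itv.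
  apply: (@eq_integrable _ _ _ mu _ mb (EFin \o f b) (EFin \o g1)).
    by move=> t; rewrite inE /= in_itv /= => /andP[_ tb]; rewrite (fg b).
  by apply: (@integrableS _ _ _ _ setT) => //; exact: fint.
exists G; split.
  move=> b b0 e e0.
  have [d [d0 hd]] := integral_normr_continuous (fint b b0) e0.
  exists d => // s si sd.
  apply: le_trans (ltW (hd _ (ivset_measurable s) _)); last first.
    by move: sd; rewrite -lte_fin; apply: le_lt_trans; rewrite le_eqVlt; apply/orP; left;
      apply/eqP; exact: ivset_mu si.
  elim: s si {sd} => [|c s IH] si; first by rewrite /ivset !big_nil Rintegral_set0.
  have fn (D : set R) : measurable D -> mu.-integrable D (EFin \o (fun x => `|f b x|)).
    move=> mD; apply: (@integrableS _ _ _ _ setT) => //.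
    have -> : EFin \o (fun x => `|f b x|) = (abse \o (EFin \o f b)) by [].
    by apply: integrable_abse; exact: fint.
  rewrite /ivset !big_cons Rintegral_setU//; last 3 first.
  - exact: ivset_measurable.
  - apply: fn; apply: measurableU => //; exact: ivset_measurable.
  - exact: ivset_disj si.
  apply: lerD; last by apply: IH; exact: ivs_cons si.
  move: (si) => /andP[/= /andP[/and3P[c0 c12 cb] _] _].
  rewrite [X in X <= _](nm_RCB (G c.2) (G c.1)).
  have gi : mu.-integrable `[(-1)%R, c.2] (EFin \o g1) by apply: g1i; exact: le_trans c12.
  have c1' : -1 <= c.1 by lra.
  rewrite /G (@Rintegral_itvB _ g1 (BLeft (-1)) (BRight c.2) c.1)//.
  have sub : `]c.1, c.2]%classic `<=` (`[(-1)%R, c.2]%classic : set R).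
    by move=> x /=; rewrite !in_itv /= => /andP[h ->]; rewrite (le_trans c1')// ltW.
  rewrite (le_trans (le_normr_Rintegral _ _))//; first exact: integrableS gi.
  rewrite le_eqVlt; apply/orP; left; apply/eqP; apply: eq_Rintegral => x.
  by rewrite inE /= in_itv /= => /andP[_ h2]; rewrite (fg b)// (le_trans h2).
(* Each [x >= 0] lies below some integer [n], so countably many exceptional null sets suffice. *)
have ae1 : {ae mu, forall x, forall n : nat, lebesgue_pt (f n%:R) x}.
  apply: ae_foralln => n; apply: lebesgue_differentiation.
  exact: (integrable_locally (mI n%:R) (hg n%:R (ler0n _ _))).
apply: filterS ae1; first exact: (ae_filter_ringOfSetsType mu).
move=> x lx x0.
pose n := (Num.truncn x).+1.
have xn : x < n%:R by have /andP[] := truncn_itv x0.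
have fi : mu.-integrable `[(-1)%R, n%:R] (EFin \o f n%:R).
  by apply: (@integrableS _ _ _ _ setT) => //; exact: fint.
have [|dF F'] := @FTC1_lebesgue_pt _ (f n%:R) (BLeft (-1)) x n%:R xn fi _ (lx n).
  by rewrite /= lte_fin; lra.
have isd : is_derive x 1 (fun y => \int[mu]_(t in `[(-1)%R, y]) f n%:R t)%R (g x).
  apply: DeriveDef => //; rewrite -derive1E F' /f patchE ifT//.
  by rewrite inE /= in_itv /= x0 ltW.
have nx : 0 < n%:R - x by rewrite subr_gt0.
apply: (@der_local _ _ _ _ (fun y => (\int[mu]_(t in `[(-1)%R, y]) f n%:R t)%:C) _ _ _ _ nx) => //.
  move=> y _; rewrite nm_RCB => yx.
  have yn : y <= n%:R by move: yx; rewrite ltr_norml; lra.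
  congr (_%:C); apply: eq_Rintegral => t.
  by rewrite inE /= in_itv /= => /andP[_ ty]; rewrite (fg n%:R)// (le_trans ty).
exact: is_derive_der isd.
Qed.

End IntegralPrimitive.

Section LocallyIntegrable.
Context {R : realType}.
Local Notation RC := (real_complex R).
Local Notation mu := (@lebesgue_measure R).

Definition hcont (f : R -> R[i]) := forall x, halfline x -> cont_at RC halfline f x.

Lemma seg_halfline (a b : R) : 0 <= a -> seg a b `<=` halfline.
Proof. by move=> a0 x /andP[ax _]; exact: le_trans ax. Qed.

Lemma hcont_seg f (a b : R) : 0 <= a -> hcont f -> cont_on f a b.
Proof.
move=> a0 cf x xab; apply: cont_sub (cf x _); first exact: seg_halfline.
exact: seg_halfline xab.
Qed.

Lemma seg_hcont f : (forall b, 0 <= b -> cont_on f 0 b) -> hcont f.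
Proof.
move=> cf x x0 e e0.
have x10 : 0 <= x + 1 by rewrite addr_ge0.
have [d d0 hd] := cf (x + 1) x10 x ltac:(by rewrite /seg /= lerDl ler01 andbT) e e0.
exists (Num.min d 1); first by rewrite lt_min d0 ltr01.
move=> y y0; rewrite lt_min => /andP[yd y1]; apply: hd => //.
move: y1; rewrite nm_RCB ltr_norml => /andP[_ h].
by rewrite /seg /= y0 /=; lra.
Qed.

(** Continuation by a constant to the left of 0, which turns continuity on the half line into
    continuity on the line and so yields measurability. *)
Definition ext0 (f : R -> R[i]) : R -> R[i] := f \o Num.max 0.

Lemma ext0E f x : 0 <= x -> ext0 f x = f x.
Proof. by move=> x0; rewrite /ext0 /= max_r. Qed.

Lemma ext0_cont f : hcont f -> forall x, cont_at RC setT (ext0 f) x.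
Proof.
move=> cf x; apply: (@cont_comp _ _ _ RC RC setT halfline) => //.
- by move=> y _; rewrite /halfline /= le_max lexx.
- move=> e e0; exists e => // y _; rewrite nm_RCB => /ltW; apply: le_trans.
  by rewrite -[leLHS]/(nm (RC (Num.max 0 y) - RC (Num.max 0 x))) nm_RCB max_lip.
- by apply: cf; rewrite /halfline /= le_max lexx.
Qed.

Lemma ext0_Re f : hcont f -> continuous (fun x => complex.Re (ext0 f x) : R).
Proof. by move=> cf x; apply: cont_Re; exact: ext0_cont. Qed.
Lemma ext0_Im f : hcont f -> continuous (fun x => complex.Im (ext0 f x) : R).
Proof. by move=> cf x; apply: cont_Im; exact: ext0_cont. Qed.

Lemma L1loc_mul_cont (g h : R -> R) : L1loc g -> continuous h ->
  L1loc (fun x => g x * h x).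
Proof.
move=> hg ch b b0.
have mb : measurable (`[0%R, b]%classic : set R) by exact: measurable_itv.
have -> : EFin \o (fun x => g x * h x) = ((EFin \o g) \* (EFin \o h))%E.
  by apply/funext => x /=; rewrite EFinM.
apply: integrableMl => //; first exact: hg.
  by apply: measurable_funTS; exact: continuous_measurable_fun.
have cb : compact (h @` `[0%R, b]%classic).
  by apply: continuous_compact; [exact: continuous_subspaceT|exact: segment_compact].
have [M [Mr hM]] := compact_bounded cb.
by exists M; split => // N MN x xb; apply: (hM N MN); exists x.
Qed.

Lemma L1loc_add (g h : R -> R) : L1loc g -> L1loc h -> L1loc (fun x => g x + h x).
Proof.
move=> hg hh b b0.
have mb : measurable (`[0%R, b]%classic : set R) by exact: measurable_itv.
have -> : EFin \o (fun x => g x + h x) = ((EFin \o g) \+ (EFin \o h))%E.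
  by apply/funext => x /=; rewrite EFinD.
by apply: integrableD => //; [exact: hg|exact: hh].
Qed.

Lemma L1loc_norm (g : R -> R) : L1loc g -> L1loc (fun x => `|g x|).
Proof. by move=> hg b b0; apply: integrable_norm; exact: hg. Qed.

Lemma L1loc_cont (h : R -> R) : continuous h -> L1loc h.
Proof.
move=> ch b b0; apply: continuous_compact_integrable; first exact: segment_compact.
exact: continuous_subspaceT.
Qed.

Lemma L1loc_eq (g h : R -> R) : (forall x, 0 <= x -> g x = h x) -> L1loc g -> L1loc h.
Proof.
move=> gh hg b b0.
have mb : measurable (`[0%R, b]%classic : set R) by exact: measurable_itv.
apply: (@eq_integrable _ _ _ mu _ mb (EFin \o g) (EFin \o h)); last exact: hg.
by move=> t; rewrite inE /= in_itv /= => /andP[t0 _]; rewrite gh.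
Qed.

Definition L1c (q : R -> R[i]) :=
  L1loc (fun x => complex.Re (q x)) /\ L1loc (fun x => complex.Im (q x)).

Lemma L1c_mul_cont q f : L1c q -> hcont f -> L1c (fun x => q x * f x).
Proof.
move=> [qR qI] cf; split.
  apply: (L1loc_eq (g := fun x => complex.Re (q x) * complex.Re (ext0 f x) +
     (complex.Im (q x) * (- complex.Im (ext0 f x))))).
    by move=> x x0; rewrite ext0E//; case: (q x) (f x) => a b [c d] /=; ring.
  apply: L1loc_add; apply: L1loc_mul_cont => //; first exact: ext0_Re.
  by move=> x; apply: continuousN; exact: ext0_Im.
apply: (L1loc_eq (g := fun x => complex.Re (q x) * complex.Im (ext0 f x) +
     (complex.Im (q x) * complex.Re (ext0 f x)))).
  by move=> x x0; rewrite ext0E//; case: (q x) (f x) => a b [c d] /=; ring.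
by apply: L1loc_add; apply: L1loc_mul_cont => //; [exact: ext0_Im|exact: ext0_Re].
Qed.

Lemma L1c_conj q : L1c q -> L1c (fun x => conjc (q x)).
Proof.
move=> [qR qI]; split.
  by apply: L1loc_eq qR => x _; case: (q x).
apply: (L1loc_eq (g := fun x => complex.Im (q x) * (-1))).
  by move=> x x0; case: (q x) => a b /=; ring.
by apply: L1loc_mul_cont => //; exact: cst_continuous.
Qed.

Theorem L1c_primitive q : L1c q -> exists Q : R -> R[i],
  (forall b : R, 0 <= b -> abscont Q b) /\
  {ae mu, forall x, 0 <= x -> der RC setT Q x (q x)}.
Proof.
move=> [/L1_primitive[F [aF dF]] /L1_primitive[G [aG dG]]].
exists (fun x => (F x)%:C + 'i%C * (G x)%:C); split.
  by move=> b b0; apply: ACD => //; [exact: aF|apply: ACZ => //; exact: aG].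
apply: filterS2 dF dG; first exact: (ae_filter_ringOfSetsType mu).
move=> x /[swap] dG /[swap] x0 /(_ x0) dF; rewrite [q x]ReImE.
by apply: derD => //; apply: derZ; exact: dG.
Qed.

End LocallyIntegrable.

(** * The first order system and its Weyl solutions *)

Section System.
Context {R : realType}.
Local Notation RC := (real_complex R).
Local Notation mu := (@lebesgue_measure R).
Implicit Types (q u v : R -> R[i]) (z : R[i]).

Definition dsol q z u v :=
  (forall b : R, 0 <= b -> abscont u b /\ abscont v b) /\
  {ae mu, forall x, 0 <= x ->
    der RC setT u x ('i%C * z * u x + q x * v x) /\
    der RC setT v x (- ('i%C * z * v x) + conjc (q x) * u x)}.

Lemma conj_real (x : R) : conjc (RC x) = RC x.
Proof. exact: conjc_real. Qed.

(** A Hermitian form, complex-valued only to fit [der]. The case [s = 1] serves uniqueness; [s = -1]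
    is the gap between [nm u ^+ 2] and [nm v ^+ 2]. *)
Definition energy (s : R) u v (x : R) : R[i] :=
  u x * conjc (u x) + s%:C * (v x * conjc (v x)).

Lemma energy_AC s u v (b : R) : 0 <= b -> abscont u b -> abscont v b ->
  abscont (energy s u v) b.
Proof.
move=> b0 au av; apply: ACD => //; first by apply: ACM => //; exact: AC_conj.
by apply: ACZ => //; apply: ACM => //; exact: AC_conj.
Qed.

Lemma energy_der (A : set R) (s : R) u v x (u' v' : R[i]) : A x ->
  der RC A u x u' -> der RC A v x v' ->
  der RC A (energy s u v) x ((u' * conjc (u x) + u x * conjc u') +
     s%:C * (v' * conjc (v x) + v x * conjc v')).
Proof.
move=> Ax du dv; apply: derD.
  by apply: derM => //; apply: der_conj => //; exact: conj_real.
by apply: derZ; apply: derM => //; apply: der_conj => //; exact: conj_real.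
Qed.

Lemma Re_energy s u v x : complex.Re (energy s u v x) = nm (u x) ^+ 2 + s * nm (v x) ^+ 2.
Proof. by rewrite /energy !mulcJ /=; ring. Qed.

(** For [s = -1] the potential drops out, and the sign of [complex.Im z] alone decides the
    monotonicity of the gap. *)
Lemma energy_Re_der (s : R) (q' z a c : R[i]) :
  let a' := 'i%C * z * a + q' * c in let c' := - ('i%C * z * c) + conjc q' * a in
  complex.Re ((a' * conjc a + a * conjc a') + s%:C * (c' * conjc c + c * conjc c')) =
  - 2 * complex.Im z * (nm a ^+ 2 - s * nm c ^+ 2) +
    2 * (1 + s) * complex.Re (q' * c * conjc a).
Proof.
rewrite !nm_sqr; case: q' => q1 q2; case: z => z1 z2; case: a => a1 a2; case: c => c1 c2 /=.
ring.
Qed.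

Section Solution.
Variables (q : R -> R[i]) (z : R[i]) (u v : R -> R[i]).
Hypothesis sol : dsol q z u v.

Lemma sol_AC b : 0 <= b -> abscont u b /\ abscont v b. Proof. exact: sol.1. Qed.

Lemma sol_hcont : hcont u /\ hcont v.
Proof. by split; apply: seg_hcont => b b0; apply: AC_cont; case: (sol_AC b0). Qed.

(** Gronwall's argument with an integrable rate. If N is the squared norm of the solution and K a
    primitive of [k], then N exp(K) is nondecreasing and N exp(-K) nonincreasing, so a zero spreads
    in both directions; [sg] treats the two together. *)
Theorem sol_unique : L1c q -> forall x1, 0 <= x1 -> u x1 = 0 -> v x1 = 0 ->
  forall x, 0 <= x -> u x = 0 /\ v x = 0.
Proof.
move=> [qR qI] x1 x10 ux1 vx1 x x0.
(* An integrable bound for the logarithmic derivative of the squared norm, where 2 |u v| is at most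
   |u|^2 + |v|^2. *)
pose k (t : R) := 2 * (nm z + `|complex.Re (q t)| + `|complex.Im (q t)|).
have /L1_primitive[K [aK dK]] : L1loc k.
  apply: (L1loc_eq (g := fun t => (`|complex.Re (q t)| + `|complex.Im (q t)|) * 2 + 2 * nm z)).
    by move=> t _; rewrite /k; ring.
  apply: L1loc_add; last by apply: L1loc_cont; exact: cst_continuous.
  apply: L1loc_mul_cont; last exact: cst_continuous.
  by apply: L1loc_add; exact: L1loc_norm.
have H (sg : R) (p r : R) : `|sg| = 1 -> 0 <= p -> p <= r ->
    sg * ((nm (u p) ^+ 2 + nm (v p) ^+ 2) * expR (sg * K p)) <=
    sg * ((nm (u r) ^+ 2 + nm (v r) ^+ 2) * expR (sg * K r)).
  move=> sg1 p0 pr; have r0 := le_trans p0 pr.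
  pose F t := sg%:C * (energy 1 u v t * cexp (sg%:C * (K t)%:C)).
  have FE t : complex.Re (F t) = sg * ((nm (u t) ^+ 2 + nm (v t) ^+ 2) * expR (sg * K t)).
    rewrite /F -rmorphM cexp_real mulrA ReM_real [sg%:C * _]mulrC ReM_real Re_energy.
    by ring.
  rewrite -!FE; apply: (AC_monotone p0 pr (lexx r)).
    apply: ACZ => //; apply: ACM => //.
      by have [au av] := sol_AC r0; exact: energy_AC.
    by apply: AC_cexp => //; apply: ACZ => //; exact: aK.
  move: sol.2; apply: filterS2 dK; first exact: (ae_filter_ringOfSetsType mu).
  move=> t dKt dt t0; have [du dv] := dt t0; have {}dKt := dKt t0.
  have dE := energy_der 1 (I : setT t) du dv.
  have dX : der RC setT (fun t => cexp (sg%:C * (K t)%:C)) t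
      (cexp (sg%:C * (K t)%:C) * (sg%:C * (k t)%:C)).
    apply: (der_comp (k := id) (B := setT) (h := fun t => sg%:C * (K t)%:C)) => //.
      by apply: derZ; exact: dKt.
    exact: der_cexp.
  eexists; split; first by apply: derZ; apply: derM => //; [exact: dE|exact: dX].
  have cE : cexp (sg%:C * (K t)%:C) = (expR (sg * K t))%:C by rewrite -rmorphM cexp_real.
  rewrite cE; set E' := (X in complex.Re (_ * (X * _ + _))).
  have -> : sg%:C * (E' * (expR (sg * K t))%:C +
      energy 1 u v t * ((expR (sg * K t))%:C * (sg%:C * (k t)%:C))) =
      E' * (sg * expR (sg * K t))%:C + energy 1 u v t * ((sg ^+ 2 * k t) * expR (sg * K t))%:C.
    by rewrite !rmorphM; ring.
  rewrite ReD !ReM_real Re_energy -[sg ^+ 2]real_normK ?num_real// sg1 expr1n !mul1r !mulrA -mulrDl.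
  rewrite mulr_ge0 ?expR_ge0//.
  rewrite energy_Re_der mul1r.
  set a := u t; set c := v t; set n := nm a ^+ 2 + nm c ^+ 2.
  have n0 : 0 <= n by rewrite addr_ge0// sqr_ge0.
  have h1 : `|- 2 * complex.Im z * (nm a ^+ 2 - nm c ^+ 2) +
      2 * (1 + 1) * complex.Re (q t * c * conjc a)| <= n * k t.
    have b1 : `|- 2 * complex.Im z * (nm a ^+ 2 - nm c ^+ 2)| <= 2 * nm z * n.
      have -> : - 2 * complex.Im z * (nm a ^+ 2 - nm c ^+ 2) =
         - (2 * (complex.Im z * (nm a ^+ 2 - nm c ^+ 2))) by ring.
      rewrite normrN normrM (ger0_norm (ler0n _ 2)) -mulrA ler_wpM2l// normrM.
      apply: ler_pM => //; first exact: nm_Im.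
      have := sqr_ge0 (nm a); have := sqr_ge0 (nm c).
      by rewrite /n ler_norml; lra.
    have b2 : `|2 * (1 + 1) * complex.Re (q t * c * conjc a)| <= 2 * nm (q t) * n.
      rewrite normrM (ger0_norm (x := 2 * (1 + 1)))//.
      have : `|complex.Re (q t * c * conjc a)| <= nm (q t) * (nm c * nm a).
        by rewrite (le_trans (nm_Re _))// !nmM nm_conj mulrA.
      have h2 : nm c * nm a <= n / 2.
        by have := sqr_ge0 (nm c - nm a); rewrite /n !expr2; lra.
      have := ler_wpM2l (nm_ge0 (q t)) h2; lra.
    have b3 : nm (q t) * n <= (`|complex.Re (q t)| + `|complex.Im (q t)|) * n.
      by rewrite ler_wpM2r// nm_le_ReIm.
    rewrite (le_trans (ler_normD _ _))// /k; lra.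
  move: h1; rewrite /k ler_norml => /andP[h2 h3].
  have [->|->] : sg = 1 \/ sg = -1.
    by case: (ger0P sg) sg1 => _ <-; [left|right; rewrite opprK].
  - by rewrite mulr1; lra.
  - by rewrite mulrN1; lra.
have n0 (a c : R[i]) : nm a ^+ 2 + nm c ^+ 2 <= 0 -> a = 0 /\ c = 0.
  have := sqr_ge0 (nm a); have := sqr_ge0 (nm c) => h1 h2 h3.
  have e1 : nm a ^+ 2 = 0 by lra.
  have e2 : nm c ^+ 2 = 0 by lra.
  by split; apply/eqP; rewrite -nm_eq0 -sqrf_eq0 ?e1 ?e2.
apply: n0.
have [xx|/ltW xx] := leP x x1.
  have := H 1 x x1 (normr1 _) x0 xx.
  rewrite ux1 vx1 nm0 expr0n /= addr0 mul0r !mul1r pmulr_lle0 ?expR_gt0//.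
have := H (-1) x1 x ltac:(by rewrite normrN1) x10 xx.
by rewrite ux1 vx1 nm0 expr0n /= addr0 mul0r mulr0 mulN1r oppr_ge0 pmulr_lle0 ?expR_gt0.
Qed.

Lemma sol_gap_der : {ae mu, forall x, 0 <= x -> exists D, der RC setT (energy (-1) u v) x D /\
  complex.Re D = - 2 * complex.Im z * (nm (u x) ^+ 2 + nm (v x) ^+ 2)}.
Proof.
move: sol.2; apply: filterS; first exact: (ae_filter_ringOfSetsType mu).
move=> x dx x0; have [du dv] := dx x0.
eexists; split; first exact: energy_der (I : setT x) du dv.
by rewrite energy_Re_der; ring.
Qed.

Lemma gap_nondecreasing p r : complex.Im z <= 0 -> 0 <= p -> p <= r ->
  nm (u p) ^+ 2 - nm (v p) ^+ 2 <= nm (u r) ^+ 2 - nm (v r) ^+ 2.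
Proof.
move=> z0 p0 pr; have r0 := le_trans p0 pr.
have E t : nm (u t) ^+ 2 - nm (v t) ^+ 2 = complex.Re (energy (-1) u v t).
  by rewrite Re_energy mulN1r.
rewrite !E; apply: (AC_monotone p0 pr (lexx r)).
  by have [au av] := sol_AC r0; exact: energy_AC.
move: sol_gap_der; apply: filterS; first exact: (ae_filter_ringOfSetsType mu).
move=> x dx /dx[D [dD DE]]; exists D; split => //; rewrite DE.
by rewrite mulr_ge0 ?addr_ge0 ?sqr_ge0// mulNr -mulrN mulr_ge0// oppr_ge0.
Qed.

Lemma gap_nonincreasing p r : 0 <= complex.Im z -> 0 <= p -> p <= r ->
  nm (u r) ^+ 2 - nm (v r) ^+ 2 <= nm (u p) ^+ 2 - nm (v p) ^+ 2.
Proof.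
move=> z0 p0 pr; have r0 := le_trans p0 pr.
have E t : nm (u t) ^+ 2 - nm (v t) ^+ 2 = - complex.Re (- energy (-1) u v t).
  by rewrite -[- energy _ _ _ _]sub0r ReB Re_energy mulN1r /= sub0r opprK.
rewrite !E lerN2; apply: (AC_monotone (F := fun t => - energy (-1) u v t) p0 pr (lexx r)).
  have [au av] := sol_AC r0.
  have := ACZ r0 (-1) (energy_AC (-1) r0 au av).
  by congr abscont; apply/funext => t; rewrite mulN1r.
move: sol_gap_der; apply: filterS; first exact: (ae_filter_ringOfSetsType mu).
move=> x dx /dx[D [dD DE]]; exists (- D); split; first exact: derN.
rewrite -[- D]sub0r ReB DE /= sub0r !mulNr opprK.
by rewrite !mulr_ge0 ?addr_ge0 ?sqr_ge0.
Qed.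

(** If [nm (v x)] exceeded [nm (u x)] somewhere, then by monotonicity of the gap the integrand would
    stay above a positive constant from there on. *)
Theorem square_integrable_gap : 0 <= complex.Im z ->
  (\int[mu]_(x in `[0%R, +oo[) ((nm (u x) ^+ 2 + nm (v x) ^+ 2) / 2)%:E < +oo)%E ->
  forall x, 0 <= x -> nm (v x) <= nm (u x).
Proof.
move=> z0 fin x x0; rewrite leNgt; apply/negP => uv.
pose k := (nm (v x) ^+ 2 - nm (u x) ^+ 2) / 2.
have k0 : 0 < k by rewrite divr_gt0// subr_gt0 ltr_pXn2r// nnegrE nm_ge0.
have hk y : x <= y -> k <= (nm (u y) ^+ 2 + nm (v y) ^+ 2) / 2.
  move=> xy; have := gap_nonincreasing z0 x0 xy.
  by have := sqr_ge0 (nm (u y)); rewrite /k; lra.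
pose f (y : R) := (nm (u y) ^+ 2 + nm (v y) ^+ 2) / 2.
have [cu cv] := sol_hcont.
have mf : measurable_fun (`[0%R, +oo[%classic : set R) (EFin \o f).
  apply/measurable_EFinP.
  pose g (y : R) : R := ((complex.Re (ext0 u y) * complex.Re (ext0 u y) +
     complex.Im (ext0 u y) * complex.Im (ext0 u y)) +
     (complex.Re (ext0 v y) * complex.Re (ext0 v y) +
     complex.Im (ext0 v y) * complex.Im (ext0 v y))) / 2.
  apply: (@eq_measurable_fun _ _ _ _ _ g).
    by move=> y; rewrite inE /= in_itv /= andbT => y0; rewrite /g /f !ext0E// !nm_sqr !expr2.
  apply: measurable_funTS; apply: continuous_measurable_fun => y.
  apply: cvgM; last exact: cvg_cst.
  apply: cvgD; apply: cvgD; apply: cvgM;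
    by [apply: ext0_Re|apply: ext0_Im].
have f0 y : (0 <= (EFin \o f) y)%E by rewrite lee_fin divr_ge0// addr_ge0// sqr_ge0.
pose n := (Num.truncn (fine (\int[mu]_(x in `[0%R, +oo[) (f x)%:E) / k)).+1.
have I0 : (0 <= \int[mu]_(x in `[0%R, +oo[) (f x)%:E)%E.
  by apply: integral_ge0 => y _; exact: f0.
have big : ((k * n%:R)%:E <= \int[mu]_(x in `[0%R, +oo[) (f x)%:E)%E.
  have sub : `[x, x + n%:R]%classic `<=` (`[0%R, +oo[%classic : set R).
    by move=> y /=; rewrite !in_itv /= andbT => /andP[xy _]; exact: le_trans xy.
  have mI0 : measurable (`[0%R, +oo[%classic : set R) by exact: measurable_itv.
  apply: (@le_trans _ _ (\int[mu]_(y in `[x, (x + n%:R)%R]) (f y)%:E)%E); last first.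
    by apply: ge0_subset_integral => //; move=> y _; exact: f0.
  have mI : measurable (`[x, x + n%:R]%classic : set R) by exact: measurable_itv.
  apply: (@le_trans _ _ (\int[mu]_(y in `[x, (x + n%:R)%R]) (cst k%:E) y)%E).
    rewrite integral_cst// EFinM; apply: lee_wpmul2l; first by rewrite lee_fin ltW.
    rewrite le_eqVlt; apply/orP; left; apply/eqP; symmetry.
    apply: etrans (lebesgue_measure_itv _) _; rewrite /= lte_fin ltrDl ltr0n /=.
    by rewrite -EFinB addrAC subrr add0r.
  apply: ge0_le_integral => //.
  - by move=> y _; rewrite lee_fin ltW.
  - exact: measurable_funS mf.
  - by move=> y /=; rewrite in_itv /= => /andP[xy _]; rewrite lee_fin hk.
have finI : (\int[mu]_(x in `[0%R, +oo[) (f x)%:E)%E \is a fin_num.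
  by rewrite ge0_fin_numE.
move: big; rewrite -(fineK finI) lee_fin; apply/negP; rewrite -ltNge.
rewrite mulrC -ltr_pdivrMr//.
by have /andP[] := truncn_itv (divr_ge0 (fine_ge0 I0) (ltW k0)).
Qed.

End Solution.

End System.

(** * Holomorphic dependence on the spectral parameter *)

Section PowerSeries.
Context {R : realType}.
Local Notation RC := (real_complex R).
Implicit Types (a : nat -> R[i]) (z : R[i]).

Lemma nested_limit (s t : nat -> R) : (forall n, 0 <= t n) ->
  (forall n p, (n <= p)%N -> `|s p - s n| <= t n) ->
  exists L, forall n, `|L - s n| <= t n.
Proof.
move=> t0 H.
have le n p : s n - t n <= s p + t p.
  have := t0 n; have := t0 p; have [/H|/ltnW/H] := leqP n p; rewrite ler_norml; lra.
have hs : has_sup (range (fun n => s n - t n)).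
  split; first by exists (s 0%N - t 0%N), 0%N.
  by exists (s 0%N + t 0%N) => _ [n _ <-].
exists (sup (range (fun n => s n - t n))) => n; rewrite ler_norml; apply/andP; split.
  have : s n - t n <= sup (range (fun n => s n - t n)).
    by apply: ub_le_sup; [case: hs|exists n].
  lra.
have : sup (range (fun n => s n - t n)) <= s n + t n.
  by apply: ge_sup; [case: hs|move=> _ [m _ <-]].
lra.
Qed.

Lemma nested_limitC (s : nat -> R[i]) (t : nat -> R) : (forall n, 0 <= t n) ->
  (forall n p, (n <= p)%N -> nm (s p - s n) <= t n) ->
  exists L, forall n, nm (L - s n) <= 2 * t n.
Proof.
move=> t0 H.
have [|L hL] := @nested_limit (fun n => complex.Re (s n)) t t0.
  by move=> n p /H; apply: le_trans; rewrite -ReB nm_Re.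
have [|L' hL'] := @nested_limit (fun n => complex.Im (s n)) t t0.
  by move=> n p /H; apply: le_trans; rewrite -ImB nm_Im.
exists (L +i* L') => n; rewrite (le_trans (nm_le_ReIm _))// ReB ImB /=.
by have := hL n; have := hL' n; lra.
Qed.

Definition partial_sum a z n : R[i] := \sum_(k < n) a k * z ^+ k.

(** The sum of the power series, with default 0 where it diverges; [psumP] identifies it on half of
    the radius of a coefficient bound. *)
Definition psum a z : R[i] := xget 0 [set L | forall e : R, 0 < e ->
  exists N, forall n, (N <= n)%N -> nm (L - partial_sum a z n) <= e].

Definition coef_bound a (rho M : R) := forall k, nm (a k) * rho ^+ k <= M.

Lemma half_pow_le (C e : R) : 0 < e -> exists N, forall n, (N <= n)%N -> C / 2 ^+ n <= e.
Proof.
move=> e0; have [N hN] := half_powers_small `|C| e0; exists N => n Nn.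
rewrite (le_trans _ (ltW hN))//.
apply: (@le_trans _ _ (`|C| / 2 ^+ n)).
  by rewrite ler_wpM2r ?invr_ge0 ?exprn_ge0// ler_norm.
by rewrite ler_wpM2l// lef_pV2 ?posrE ?exprn_gt0// ler_eXn2l// ltr1n.
Qed.

(** On half the radius the k-th term is at most M / 2^k, so tails are at most 2 M / 2^n; taking
    limits of real and imaginary parts separately doubles this. *)
Lemma psumP a rho M z : coef_bound a rho M -> 0 < rho -> nm z <= rho / 2 ->
  forall n, nm (psum a z - partial_sum a z n) <= 4 * M / 2 ^+ n.
Proof.
move=> aM rho0 zr n.
have M0 : 0 <= M by apply: le_trans (aM 0%N); rewrite mulr_ge0 ?nm_ge0.
pose t n : R := 2 * M / 2 ^+ n.
have t0 k : 0 <= t k by rewrite divr_ge0 ?mulr_ge0// exprn_ge0.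
have term k : nm (a k * z ^+ k) <= M / 2 ^+ k.
  rewrite nmM nmX (le_trans (ler_wpM2l (nm_ge0 _) (_ : _ <= (rho / 2) ^+ k)))//.
    by rewrite lerXn2r// ?nnegrE ?nm_ge0// divr_ge0// ltW.
  rewrite exprMn exprVn mulrA ler_wpM2r// ?invr_ge0 ?exprn_ge0//; exact: aM.
have cau m p : (m <= p)%N -> nm (partial_sum a z p - partial_sum a z m) <= t m.
  move=> /subnK <-; set d := (p - m)%N.
  suff : nm (partial_sum a z (d + m) - partial_sum a z m) <= t m - 2 * M / 2 ^+ (d + m).
    move/le_trans; apply; rewrite lerBlDr lerDl divr_ge0 ?mulr_ge0// exprn_ge0//.
  elim: d => [|d IH]; first by rewrite add0n !subrr nm0.
  rewrite addSn /partial_sum big_ord_recr /= -/(partial_sum a z (d + m)).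
  rewrite addrAC (le_trans (nmD _ _))// (le_trans (lerD IH (term _)))//.
  rewrite le_eqVlt; apply/orP; left; apply/eqP; rewrite [X in _ = _ - _ / X]exprS.
  by field; rewrite expf_neq0.
have [L hL] := nested_limitC t0 cau.
have Lset : [set L | forall e : R, 0 < e ->
  exists N, forall n, (N <= n)%N -> nm (L - partial_sum a z n) <= e] L.
  move=> e e0; have [N hN] := half_pow_le (4 * M) e0.
  exists N => k /hN; apply: le_trans; rewrite (le_trans (hL k))// /t; lra.
have := xgetI 0 Lset; rewrite -/(psum a z) => hP.
suff -> : psum a z = L by rewrite (le_trans (hL n))// /t; lra.
apply/eqP; rewrite -subr_eq0 -nm_eq0 eq_le nm_ge0 andbT.
apply/ler_addgt0Pr => e e0; rewrite add0r.
have e2 : 0 < e / 2 by rewrite divr_gt0.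
have [N hN] := hP _ e2; have [N' hN'] := Lset _ e2.
have := hN _ (leq_maxl N N'); have := hN' _ (leq_maxr N N').
set w := partial_sum a z _ => h1 h2.
have -> : psum a z - L = (psum a z - w) - (L - w) by ring.
by rewrite (le_trans (nmB _ _))//; lra.
Qed.

Lemma psum0 a rho M : coef_bound a rho M -> 0 < rho -> psum a 0 = a 0%N.
Proof.
move=> aM rho0; apply/eqP; rewrite -subr_eq0 -nm_eq0 eq_le nm_ge0 andbT.
apply/ler_addgt0Pr => e e0; rewrite add0r.
have [N hN] := half_pow_le (4 * M) e0.
have h0 : nm (0 : R[i]) <= rho / 2 by rewrite nm0 divr_ge0// ltW.
have := psumP aM rho0 h0 N.+1.
rewrite /partial_sum big_ord_recl /= expr0 mulr1 big1 ?addr0 => [h|i _]; last first.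
  by rewrite expr0n /= mulr0.
by rewrite (le_trans h)// hN.
Qed.

Definition deriv_coef a k : R[i] := (k.+1)%:R * a k.+1.

(** Halving the radius absorbs the factor [k.+1], since [k.+1 <= 2 ^+ k.+1]. *)
Lemma deriv_coef_bound a rho M : 0 < rho -> coef_bound a rho M ->
  coef_bound (deriv_coef a) (rho / 2) (2 * M / rho).
Proof.
move=> rho0 aM k; rewrite /deriv_coef nmM nm_natr exprMn exprVn.
have M0 : 0 <= M by apply: le_trans (aM 0%N); rewrite mulr_ge0 ?nm_ge0.
have h1 : (k.+1)%:R / 2 ^+ k <= 2 :> R.
  rewrite ler_pdivrMr ?exprn_gt0// -exprS -natrX ler_nat ltnW// ltn_expl//.
have h2 := aM k.+1.
have -> : (k.+1)%:R * nm (a k.+1) * (rho ^+ k / 2 ^+ k) =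
  ((k.+1)%:R / 2 ^+ k) * (nm (a k.+1) * rho ^+ k.+1 / rho).
  by rewrite exprS; field; rewrite expf_neq0// gt_eqF.
have -> : 2 * M / rho = 2 * (M / rho) by ring.
have rk : 0 <= rho ^+ k.+1 by rewrite exprn_ge0// ltW.
have k0 : 0 <= (k.+1)%:R / 2 ^+ k :> R by rewrite divr_ge0// exprn_ge0.
have m0 := divr_ge0 (mulr_ge0 (nm_ge0 (a k.+1)) rk) (ltW rho0).
by rewrite (ler_pM k0 m0 h1)// ler_pM2r ?invr_gt0.
Qed.

(** The radius is halved twice: for the coefficients of the derived series, then for its uniform
    convergence. The latter allows [der_limit]. *)
Lemma psum_der a rho M z : 0 < rho -> coef_bound a rho M -> nm z < rho / 4 ->
  der id setT (psum a) z (psum (deriv_coef a) z).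
Proof.
move=> rho0 aM zr.
have M0 : 0 <= M by apply: le_trans (aM 0%N); rewrite mulr_ge0 ?nm_ge0.
have r4 : 0 < rho / 4 - nm z by rewrite subr_gt0.
have zd : disc 0 (rho / 4) z by rewrite /disc /= subr0.
suff : der id (disc 0 (rho / 4)) (psum a) z (psum (deriv_coef a) z).
  move=> dd; have H := der_eps dd; apply: derP => e /H[d d0 hd].
  exists (Num.min d (rho / 4 - nm z)); first by rewrite lt_min d0.
  move=> y _; rewrite lt_min => /andP[yd yr]; apply: hd => //.
  rewrite /disc /= subr0.
  have := nmD (y - z) z; rewrite subrK; move: yr => /=; lra.
have s0 : 0 < rho / 2 by rewrite divr_gt0.
have sM := deriv_coef_bound rho0 aM.
apply: (der_limit (F := fun n y => partial_sum a y n.+1)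
  (F' := fun n y => partial_sum (deriv_coef a) y n)) => //.
- exact: mvt_disc.
- move=> n y yb.
  have -> : (fun y => partial_sum a y n.+1) =
      (fun y => \sum_(k < n.+1) (fun k y => a k * y ^+ k) k y) by [].
  have -> : partial_sum (deriv_coef a) y n = \sum_(k < n.+1) a k * (k%:R * y ^+ k.-1 * 1).
    rewrite big_ord_recl /= !mul0r mulr0 add0r; apply: eq_bigr => k _.
    by rewrite /deriv_coef /bump /= add1n; ring.
  apply: der_sum => k; apply: derZ; apply: derX => //; exact: der_id.
- move=> y; rewrite /disc /= subr0 => yr e e0.
  have [N hN] := half_pow_le (4 * M) e0; exists N => n Nn.
  rewrite nmC (le_trans (psumP aM rho0 _ _))//; first lra.
  by apply: hN; rewrite (leq_trans Nn).
- move=> e e0; have [N hN] := half_pow_le (4 * (2 * M / rho)) e0; exists N => n Nn.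
  move=> y; rewrite /disc /= subr0 => yr.
  by rewrite nmC (le_trans (psumP sM s0 _ _)) ?hN//; lra.
Qed.

End PowerSeries.

(** * Linear systems proportional to a complex parameter *)

Section LinearODE.
Context {R : realType}.
Local Notation RC := (real_complex R).

(** The factor [c], of modulus at most 1, turns the increment of [f] to the positive real axis; then
    the real part of [G - c * f] is nondecreasing. *)
Lemma mean_value_cmp (f f' G G' : R -> R[i]) (a b : R) : a <= b ->
  (forall x, seg a b x -> der RC (seg a b) f x (f' x)) ->
  (forall x, seg a b x -> der RC (seg a b) G x (G' x)) ->
  (forall x, seg a b x -> nm (f' x) <= complex.Re (G' x)) ->
  nm (f b - f a) <= complex.Re (G b) - complex.Re (G a).
Proof.
move=> ab df dG fG.
pose w := f b - f a.
pose c : R[i] := if w == 0 then 0 else (nm w)^-1%:C * conjc w.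
have c1 : nm c <= 1.
  rewrite /c; case: ifPn => [_|w0]; first by rewrite nm0.
  by rewrite nmM nm_real nm_conj ger0_norm ?invr_ge0 ?nm_ge0// mulVf// nm_eq0.
have cw : complex.Re (c * w) = nm w.
  rewrite /c; case: eqP => [->|/eqP w0]; first by rewrite mul0r nm0.
  rewrite mulrAC -mulrA mulcJ -rmorphM /=.
  by rewrite expr2 mulKf// nm_eq0.
have := @der_monotone R (fun x => G x - c * f x) (fun x => G' x - c * f' x) a b ab.
have H1 x : seg a b x -> der RC (seg a b) (fun x => G x - c * f x) x (G' x - c * f' x).
  by move=> xab; apply: derB; [exact: dG|apply: derZ; exact: df].
have H2 x : seg a b x -> 0 <= complex.Re (G' x - c * f' x).
  move=> xab; rewrite ReB subr_ge0 (le_trans _ (fG x xab))//.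
  rewrite (le_trans (ler_norm _))// (le_trans (nm_Re _))// nmM.
  by rewrite ler_piMl// nm_ge0.
move=> /(_ H1 H2); rewrite !ReB -/w -cw /w mulrBr ReB; lra.
Qed.

Definition hder (f f' : R -> R[i]) := forall x, halfline x -> der RC halfline f x (f' x).

Lemma hder_cont f f' : hder f f' -> hcont f.
Proof. by move=> df x /df; exact: der_cont. Qed.

Lemma hder_seg f f' (a b : R) : 0 <= a -> hder f f' ->
  forall x, seg a b x -> der RC (seg a b) f x (f' x).
Proof.
move=> a0 df x xab; apply: der_sub (df x _); first exact: seg_halfline.
exact: seg_halfline xab.
Qed.

Lemma seg_hder f f' : (forall b, 0 <= b -> forall x, seg 0 b x ->
   der RC (seg 0 b) f x (f' x)) -> hder f f'.
Proof.
move=> H x x0.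
have b0 : 0 <= x + 1 by rewrite addr_ge0.
have xb : seg 0 (x + 1) x by rewrite /seg /= lerDl ler01 andbT.
have dF := der_eps (H _ b0 x xb).
apply: derP => e /dF[d d0 hd]; exists (Num.min d 1); first by rewrite lt_min d0 ltr01.
move=> y y0; rewrite lt_min => /andP[yd y1]; apply: hd => //.
by move: y1; rewrite nm_RCB ltr_norml /seg /= y0 => /andP[_ h] /=; lra.
Qed.

Definition hprim (f : R -> R[i]) : R -> R[i] :=
  xget (fun=> 0) [set F | hder F f /\ F 0 = 0].

Lemma hprimP f : hcont f -> hder (hprim f) f /\ hprim f 0 = 0.
Proof.
move=> cf; have [F hF] := primitive_half cf.
suff h : [set F | hder F f /\ F 0 = 0] (fun x => F x - F 0) by exact: xgetI h.
split; last by rewrite subrr.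
by move=> x x0; rewrite -[f x]subr0; apply: derB; [exact: hF|exact: der_cst].
Qed.

Lemma hder_AC f f' : hder f f' -> hcont f' -> forall b : R, 0 <= b -> abscont f b.
Proof.
move=> df cf b b0; have [M M0 hM] := bounded_on b0 (hcont_seg (lexx 0) cf).
exact: AC_der (hder_seg (lexx 0) df) hM.
Qed.

Variables (b11 b12 b21 b22 : R -> R[i]).
Hypothesis c11 : hcont b11.
Hypothesis c12 : hcont b12.
Hypothesis c21 : hcont b21.
Hypothesis c22 : hcont b22.

(* The coefficients of the power series in the spectral parameter. *)
Fixpoint picard (a1 a2 : R[i]) (k : nat) : (R -> R[i]) * (R -> R[i]) :=
  if k is k'.+1 then
    let p := picard a1 a2 k' in
    (hprim (fun x => b11 x * p.1 x + b12 x * p.2 x),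
     hprim (fun x => b21 x * p.1 x + b22 x * p.2 x))
  else (fun=> a1, fun=> a2).

Lemma picard_cont a1 a2 k : hcont (picard a1 a2 k).1 /\ hcont (picard a1 a2 k).2.
Proof.
elim: k => [|k [h1 h2]] /=; first by split=> x _; exact: cont_cst.
split; apply: hder_cont (hprimP _).1 => x x0; apply: contD; apply: contM;
  by [exact: c11|exact: c12|exact: c21|exact: c22|exact: h1|exact: h2].
Qed.

Lemma picard_der a1 a2 k :
  hder (picard a1 a2 k.+1).1
     (fun x => b11 x * (picard a1 a2 k).1 x + b12 x * (picard a1 a2 k).2 x) /\
  hder (picard a1 a2 k.+1).2
     (fun x => b21 x * (picard a1 a2 k).1 x + b22 x * (picard a1 a2 k).2 x).
Proof.
have [h1 h2] := picard_cont a1 a2 k.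
split; apply: (hprimP _).1 => x x0; apply: contD; apply: contM;
  by [exact: c11|exact: c12|exact: c21|exact: c22|exact: h1|exact: h2].
Qed.

Lemma picard0 a1 a2 k : (picard a1 a2 k.+1).1 0 = 0 /\ (picard a1 a2 k.+1).2 0 = 0.
Proof.
have [h1 h2] := picard_cont a1 a2 k.
split; apply: (hprimP _).2 => x x0; apply: contD; apply: contM;
  by [exact: c11|exact: c12|exact: c21|exact: c22|exact: h1|exact: h2].
Qed.

(** Iterated integration produces the factorial: each step is compared with the explicit monomial
    [G], and [c] bounds the sum of the four coefficients. *)
Lemma picard_bound a1 a2 (b : R) : 0 <= b -> exists2 c : R, 0 <= c & forall k x, seg 0 b x ->
  nm ((picard a1 a2 k).1 x) <= (nm a1 + nm a2) * ((c * x) ^+ k / k`!%:R) /\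
  nm ((picard a1 a2 k).2 x) <= (nm a1 + nm a2) * ((c * x) ^+ k / k`!%:R).
Proof.
move=> b0.
have [m1 m10 h1] := bounded_on b0 (hcont_seg (lexx 0) c11).
have [m2 m20 h2] := bounded_on b0 (hcont_seg (lexx 0) c12).
have [m3 m30 h3] := bounded_on b0 (hcont_seg (lexx 0) c21).
have [m4 m40 h4] := bounded_on b0 (hcont_seg (lexx 0) c22).
pose c := m1 + m2 + m3 + m4.
pose A := nm a1 + nm a2.
have A0 : 0 <= A by rewrite addr_ge0 ?nm_ge0.
have c0 : 0 <= c by rewrite /c; lra.
exists c => // k; rewrite -/A; elim: k => [|k IH] x xb.
  by rewrite expr0 fact0 divr1 mulr1 /= /A; have := nm_ge0 a1; have := nm_ge0 a2; lra.
have x0 : 0 <= x by case/andP: xb.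
have sub : seg 0 x `<=` seg 0 b by apply: seg_subset => //; case/andP: xb.
have [d1 d2] := picard_der a1 a2 k; have [z1 z2] := picard0 a1 a2 k.
pose G (t : R) : R[i] := (A * c ^+ k.+1 / (k.+1)`!%:R)%:C * RC t ^+ k.+1.
pose G' (t : R) : R[i] := (A * c ^+ k.+1 / (k.+1)`!%:R)%:C * ((k.+1)%:R * RC t ^+ k * 1).
have dG t : seg 0 x t -> der RC (seg 0 x) G t (G' t).
  by move=> tx; apply: derZ; apply: derX => //; exact: der_id.
have GR t : complex.Re (G t) = A * ((c * t) ^+ k.+1 / (k.+1)`!%:R).
  by rewrite /G -rmorphXn -rmorphM /= exprMn; ring.
have G'R t : complex.Re (G' t) = c * (A * ((c * t) ^+ k / k`!%:R)).
  rewrite /G' mulr1 -rmorphXn -(rmorph_nat (real_complex R)) -!rmorphM /= factS natrM exprMn exprS.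
  have nf : k`!%:R != 0 :> R by rewrite pnatr_eq0 -lt0n fact_gt0.
  have nk : (k.+1)%:R != 0 :> R by rewrite pnatr_eq0.
  move: nf nk; move: (k`!%:R : R) ((k.+1)%:R : R) => p m np nm'.
  by field; rewrite np nm'.
have key (be1 be2 : R -> R[i]) : (forall t, seg 0 b t -> nm (be1 t) + nm (be2 t) <= c) ->
  forall t, seg 0 x t -> nm (be1 t * (picard a1 a2 k).1 t + be2 t * (picard a1 a2 k).2 t)
     <= complex.Re (G' t).
  move=> be t tx; have tb := sub t tx; have [i1 i2] := IH t tb.
  rewrite G'R (le_trans (nmD _ _))// !nmM.
  have t0 : 0 <= t by case/andP: tx.
  have Q0 : 0 <= A * ((c * t) ^+ k / k`!%:R).
    by rewrite mulr_ge0// divr_ge0// exprn_ge0// mulr_ge0.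
  have j1 := ler_wpM2l (nm_ge0 (be1 t)) i1; have j2 := ler_wpM2l (nm_ge0 (be2 t)) i2.
  by have := ler_wpM2r Q0 (be t tb); rewrite mulrDl; lra.
have xx : complex.Re (G 0) = 0 by rewrite GR mulr0 expr0n /= mul0r mulr0.
split.
  have := mean_value_cmp x0 (hder_seg (lexx 0) d1) dG.
  rewrite z1 subr0 [X in _ <= _ - X]xx subr0 GR; apply; apply: (key b11 b12) => t tb.
  by have := h1 t tb; have := h2 t tb; rewrite /c; lra.
have := mean_value_cmp x0 (hder_seg (lexx 0) d2) dG.
rewrite z2 subr0 [X in _ <= _ - X]xx subr0 GR; apply; apply: (key b21 b22) => t tb.
by have := h3 t tb; have := h4 t tb; rewrite /c; lra.
Qed.

(** A single term of the exponential series is at most its sum. This works for every radius, so the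
    solutions are entire in the spectral parameter. *)
Lemma picard_coef a1 a2 (b rho : R) : 0 <= b -> 0 < rho ->
  exists M : R, forall x, seg 0 b x ->
    coef_bound (fun k => (picard a1 a2 k).1 x) rho M /\
    coef_bound (fun k => (picard a1 a2 k).2 x) rho M.
Proof.
move=> b0 rho0; have [c c0 hc] := picard_bound a1 a2 b0.
have A0 : 0 <= nm a1 + nm a2 by rewrite addr_ge0 ?nm_ge0.
exists ((nm a1 + nm a2) * expR (c * b * rho)) => x xb.
have /andP[x0 xb'] := xb.
have E k : (nm a1 + nm a2) * ((c * x) ^+ k / k`!%:R) * rho ^+ k <=
    (nm a1 + nm a2) * expR (c * b * rho).
  rewrite -mulrA ler_wpM2l// mulrAC -exprMn.
  have y0 : 0 <= c * x * rho by rewrite !mulr_ge0// ltW.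
  apply: (@le_trans _ _ (expR (c * x * rho))); last first.
    by rewrite ler_expR ler_wpM2r ?(ltW rho0)// ler_wpM2l.
  case: k => [|k]; first by rewrite expr0 fact0 divr1 -expR0 ler_expR.
  by have := expR_ge1Dxn k y0; lra.
split=> k; have [h1 h2] := hc k x xb.
  by rewrite (le_trans _ (E k))// ler_wpM2r// exprn_ge0// ltW.
by rewrite (le_trans _ (E k))// ler_wpM2r// exprn_ge0// ltW.
Qed.

(** With [flow2], the solution of Y' = z B Y with Y(0) = (a1, a2) for the matrix B of the [b11],
    ..., [b22]. *)
Definition flow1 a1 a2 (z : R[i]) x := psum (fun k => (picard a1 a2 k).1 x) z.
Definition flow2 a1 a2 (z : R[i]) x := psum (fun k => (picard a1 a2 k).2 x) z.

Lemma flow0 a1 a2 z : flow1 a1 a2 z 0 = a1 /\ flow2 a1 a2 z 0 = a2.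
Proof.
have [z1 z2] : (forall k, (picard a1 a2 k.+1).1 0 = 0) /\
   (forall k, (picard a1 a2 k.+1).2 0 = 0).
  by split=> k; case: (picard0 a1 a2 k).
have H (p : nat -> R[i]) : (forall k, p k.+1 = 0) -> psum p z = p 0%N.
  move=> p0; have rho0 : 0 < 2 * nm z + 1 by have := nm_ge0 z; lra.
  have pM : coef_bound p (2 * nm z + 1) (nm (p 0%N)).
    move=> [|k]; first by rewrite expr0 mulr1.
    by rewrite p0 nm0 mul0r nm_ge0.
  apply/eqP; rewrite -subr_eq0 -nm_eq0 eq_le nm_ge0 andbT.
  apply/ler_addgt0Pr => e e0; rewrite add0r.
  have [N hN] := half_pow_le (4 * nm (p 0%N)) e0.
  have := psumP pM rho0 ltac:(lra) N.+1.
  rewrite /partial_sum big_ord_recl /= expr0 mulr1 big1 ?addr0 => [h|i _].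
    by rewrite (le_trans h)// hN.
  by rewrite p0 mul0r.
by split; [rewrite /flow1 (H (fun k => (picard a1 a2 k).1 0))//|
           rewrite /flow2 (H (fun k => (picard a1 a2 k).2 0))//].
Qed.

Lemma flow_holo a1 a2 z x : halfline x ->
  (exists D, der id setT (fun z => flow1 a1 a2 z x) z D) /\
  (exists D, der id setT (fun z => flow2 a1 a2 z x) z D).
Proof.
(* [psum_der] differentiates inside a quarter of the radius of the coefficient bound. *)
move=> x0; pose rho := 4 * nm z + 1.
have n0 := nm_ge0 z.
have rho0 : 0 < rho by rewrite /rho; lra.
have [M hM] := picard_coef a1 a2 x0 rho0.
have [m1 m2] := hM x ltac:(by rewrite /seg /= lexx andbT).
have zr : nm z < rho / 4 by rewrite /rho; lra.
by split; eexists; [exact: psum_der rho0 m1 zr|exact: psum_der rho0 m2 zr].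
Qed.

Lemma flow_der a1 a2 z :
  hder (flow1 a1 a2 z) (fun x => z * (b11 x * flow1 a1 a2 z x + b12 x * flow2 a1 a2 z x)) /\
  hder (flow2 a1 a2 z) (fun x => z * (b21 x * flow1 a1 a2 z x + b22 x * flow2 a1 a2 z x)).
Proof.
pose rho := 2 * nm z + 1.
have n0 := nm_ge0 z.
have rho0 : 0 < rho by rewrite /rho; lra.
have zr : nm z <= rho / 2 by rewrite /rho; lra.
pose P1 n x := partial_sum (fun k => (picard a1 a2 k).1 x) z n.
pose P2 n x := partial_sum (fun k => (picard a1 a2 k).2 x) z n.
(* Both components at once: termwise differentiation in [x], uniform on segments. *)
have gen (b1 b2 f : R -> R[i]) (p : nat -> R -> R[i]) : hcont b1 -> hcont b2 ->
   (forall k, hder (p k.+1)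
      (fun x => b1 x * (picard a1 a2 k).1 x + b2 x * (picard a1 a2 k).2 x)) ->
   (exists c, p 0%N = fun=> c) -> f = (fun x => psum (p^~ x) z) ->
   (forall b : R, 0 <= b -> exists M : R, forall x, seg 0 b x -> coef_bound (p^~ x) rho M) ->
   hder f (fun x => z * (b1 x * flow1 a1 a2 z x + b2 x * flow2 a1 a2 z x)).
  move=> cb1 cb2 dp [c p0] -> pM; apply: seg_hder => b b0 x xb.
  have [M hM] := pM b b0; have [M' hM'] := picard_coef a1 a2 b0 rho0.
  have [N1 N10 hN1] := bounded_on b0 (hcont_seg (lexx 0) cb1).
  have [N2 N20 hN2] := bounded_on b0 (hcont_seg (lexx 0) cb2).
  apply: (der_limit (F := fun n x => partial_sum (p^~ x) z n.+1)
    (F' := fun n x => z * (b1 x * P1 n x + b2 x * P2 n x))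
    (f' := fun x => z * (b1 x * flow1 a1 a2 z x + b2 x * flow2 a1 a2 z x))) => //.
  - exact: mvt_seg.
  - move=> n y yb.
    have -> : (fun x => partial_sum (p^~ x) z n.+1) =
      (fun x => \sum_(k < n.+1) (fun k x => z ^+ k * p k x) k x).
      by apply/funext => t; apply: eq_bigr => k _; rewrite mulrC.
    have -> : z * (b1 y * P1 n y + b2 y * P2 n y) = \sum_(k < n.+1) z ^+ k *
       (if nat_of_ord k is k'.+1 then
         b1 y * (picard a1 a2 k').1 y + b2 y * (picard a1 a2 k').2 y else 0).
      rewrite big_ord_recl /= mulr0 add0r /P1 /P2 /partial_sum !mulr_sumr -big_split mulr_sumr.
      by apply: eq_bigr => k _; rewrite /bump /= add1n exprS; ring.
    apply: der_sum => k.
    apply: derZ; case: (nat_of_ord k) => [|k'].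
      by rewrite p0; exact: der_cst.
    exact: (hder_seg (lexx 0) (dp k')).
  - move=> y yb e e0; have [N hN] := half_pow_le (4 * M) e0; exists N => n Nn.
    by rewrite nmC (le_trans (psumP (hM y yb) rho0 zr _))// hN// (leq_trans Nn).
  - move=> e e0.
    have [N hN] := half_pow_le (nm z * (N1 + N2) * (4 * M')) e0; exists N => n Nn y yb.
    have [q1 q2] := hM' y yb.
    have -> : z * (b1 y * P1 n y + b2 y * P2 n y) -
       z * (b1 y * flow1 a1 a2 z y + b2 y * flow2 a1 a2 z y) =
       - (z * (b1 y * (flow1 a1 a2 z y - P1 n y) + b2 y * (flow2 a1 a2 z y - P2 n y))) by ring.
    have r1 := psumP q1 rho0 zr n; have r2 := psumP q2 rho0 zr n.
    apply: le_trans (hN n Nn); set T := 4 * M' / 2 ^+ n in r1 r2.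
    have -> : nm z * (N1 + N2) * (4 * M') / 2 ^+ n = nm z * (N1 * T + N2 * T).
      by rewrite /T; ring.
    rewrite nmN nmM ler_wpM2l ?nm_ge0// (le_trans (nmD _ _))// !nmM.
    by rewrite lerD// ler_pM ?nm_ge0 ?hN1 ?hN2.
split.
  apply: (gen b11 b12 _ (fun k => (picard a1 a2 k).1)) => //.
  - by move=> k; case: (picard_der a1 a2 k).
  - by exists a1.
  - by move=> b b0; have [M hM] := picard_coef a1 a2 b0 rho0; exists M => x /hM[].
apply: (gen b21 b22 _ (fun k => (picard a1 a2 k).2)) => //.
- by move=> k; case: (picard_der a1 a2 k).
- by exists a2.
- by move=> b b0; have [M hM] := picard_coef a1 a2 b0 rho0; exists M => x /hM[].
Qed.

End LinearODE.

Section HolomorphicSolutions.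
Context {R : realType}.
Local Notation RC := (real_complex R).
Local Notation mu := (@lebesgue_measure R).
Implicit Types (q u v : R -> R[i]) (z : R[i]).

(** Removes the end point 0, where a function on the half line has only a one-sided derivative. *)
Lemma ae_neq0 : {ae mu, forall x : R, x != 0}.
Proof.
exists [set 0]; split; first exact: measurable_set1.
  exact: lebesgue_measure_set1.
by move=> x /=; apply: contra_notP => /eqP.
Qed.

Lemma der_interior f x D : 0 < x -> der RC halfline f x D -> der RC setT f x D.
Proof.
move=> x0 df; have H := der_eps df; apply: derP => e /H[d d0 hd].
exists (Num.min d x); first by rewrite lt_min d0.
move=> y _; rewrite lt_min => /andP[yd yx]; apply: hd => //.
by move: yx; rewrite nm_RCB ltr_norml /halfline /=; lra.
Qed.

Lemma dsol_lin q z u1 v1 u2 v2 (a b : R[i]) : dsol q z u1 v1 -> dsol q z u2 v2 ->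
  dsol q z (fun x => a * u1 x + b * u2 x) (fun x => a * v1 x + b * v2 x).
Proof.
move=> [ac1 d1] [ac2 d2]; split.
  move=> c c0; have [? ?] := ac1 c c0; have [? ?] := ac2 c c0.
  by split; apply: ACD => //; apply: ACZ.
apply: filterS2 d1 d2; first exact: (ae_filter_ringOfSetsType mu).
move=> x h1 h2 x0; have [du1 dv1] := h1 x0; have [du2 dv2] := h2 x0; split.
  have := derD (derZ a du1) (derZ b du2); apply: derE; ring.
have := derD (derZ a dv1) (derZ b dv2); apply: derE; ring.
Qed.

(* Given a solution (u, v) at z0 with u without zeros, (c u, c v + 1 / u) with
   c' = q / u ^ 2 is a second one, and in the gauge they define the equation
   has continuous coefficients proportional to z - z0. *)
Theorem holo_solutions q z0 u v (A B : R[i]) : L1c q -> dsol q z0 u v ->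
  (forall x, 0 <= x -> u x != 0) ->
  exists U V : R[i] -> R -> R[i],
    [/\ forall z, dsol q z (U z) (V z),
        forall z, U z 0 = A /\ V z 0 = B &
        forall x, 0 <= x -> forall z,
          (exists D, der id setT (fun z => U z x) z D) /\
          (exists D, der id setT (fun z => V z x) z D)].
Proof.
move=> qL sol u0.
have [cu cv] := sol_hcont sol.
have cuV : hcont (fun x => (u x)^-1).
  by move=> x x0; apply: contV; [exact: u0|exact: cu].
have [c [ac dc]] : exists c : R -> R[i], (forall b : R, 0 <= b -> abscont c b) /\
    {ae mu, forall x, 0 <= x -> der RC setT c x (q x * (u x)^-1 ^+ 2)}.
  apply: L1c_primitive; apply: L1c_mul_cont => // x x0.
  by apply: contX; exact: cuV.
have cc : hcont c by apply: seg_hcont => b b0; apply: AC_cont; exact: ac.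
pose g x := c x * u x; pose h x := c x * v x + (u x)^-1.
have cg : hcont g by move=> x x0; apply: contM; [exact: cc|exact: cu].
have ch : hcont h.
  by move=> x x0; apply: contD; [apply: contM; [exact: cc|exact: cv]|exact: cuV].
(* Let Phi have the columns (u, v) and (g, h); its determinant is 1. The four functions are the
   entries of i Phi^-1 diag(1, -1) Phi. *)
pose b11 x := 'i%C * (u x * h x + g x * v x).
pose b12 x := 'i%C * (2 * (g x * h x)).
pose b21 x := 'i%C * (- 2 * (u x * v x)).
pose b22 x := - b11 x.
have c11 : hcont b11.
  move=> x x0; apply: contM; first exact: cont_cst.
  by apply: contD; apply: contM; by [exact: cu|exact: ch|exact: cg|exact: cv].
have c12 : hcont b12.
  move=> x x0; apply: contM; first exact: cont_cst.
  apply: contM; first exact: cont_cst.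
  by apply: contM; by [exact: ch|exact: cg].
have c21 : hcont b21.
  move=> x x0; apply: contM; first exact: cont_cst.
  apply: contM; first exact: cont_cst.
  by apply: contM; by [exact: cu|exact: cv].
have c22 : hcont b22 by move=> x x0; apply: contN; exact: c11.
(* (al, be) is Phi(0)^-1 applied to the prescribed initial values (A, B). *)
pose al := A * h 0 - B * g 0.
pose be := - v 0 * A + u 0 * B.
pose Z1 z x := flow1 b11 b12 b21 b22 al be (z - z0) x.
pose Z2 z x := flow2 b11 b12 b21 b22 al be (z - z0) x.
have dZ z : hder (Z1 z) (fun x => (z - z0) * (b11 x * Z1 z x + b12 x * Z2 z x)) /\
            hder (Z2 z) (fun x => (z - z0) * (b21 x * Z1 z x + b22 x * Z2 z x)).
  exact: flow_der.
have cZ z : hcont (Z1 z) /\ hcont (Z2 z).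
  by have [d1 d2] := dZ z; split; [exact: hder_cont d1|exact: hder_cont d2].
exists (fun z x => u x * Z1 z x + g x * Z2 z x), (fun z x => v x * Z1 z x + h x * Z2 z x).
split.
- move=> z; have [dZ1 dZ2] := dZ z; have [cZ1 cZ2] := cZ z; split.
    move=> b b0; have [au av] := sol_AC sol b0; have acb := ac b b0.
    have aZ1 : abscont (Z1 z) b.
      apply: (hder_AC dZ1) => // x x0; apply: contM; first exact: cont_cst.
      by apply: contD; apply: contM; by [exact: c11|exact: c12|exact: cZ1|exact: cZ2].
    have aZ2 : abscont (Z2 z) b.
      apply: (hder_AC dZ2) => // x x0; apply: contM; first exact: cont_cst.
      by apply: contD; apply: contM; by [exact: c21|exact: c22|exact: cZ1|exact: cZ2].
    have ag : abscont g b by exact: ACM.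
    have ah : abscont h b.
      apply: ACD; first exact: ACM.
      by apply: ACV => // x /andP[x0 _]; exact: u0.
    by split; apply: ACD; exact: ACM.
  move: sol.2; apply: filterS3 ae_neq0 dc; first exact: (ae_filter_ringOfSetsType mu).
  move=> x xn0 dcx solx x0; have {}dcx := dcx x0; have [du dv] := solx x0.
  have xp : 0 < x by rewrite lt_def xn0.
  have d1 := der_interior xp (dZ1 x x0); have d2 := der_interior xp (dZ2 x x0).
  have du1 := derV_at (I : setT x) (u0 x x0) du.
  have dg := derM (I : setT x) dcx du.
  have dh := derD (derM (I : setT x) dcx dv) du1.
  have un := u0 x x0; split.
    have := derD (derM (I : setT x) du d1) (derM (I : setT x) dg d2); apply: derE.
    by rewrite /b22 /b11 /b12 /b21 /g /h; field.
  have := derD (derM (I : setT x) dv d1) (derM (I : setT x) dh d2); apply: derE.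
  by rewrite /b22 /b11 /b12 /b21 /g /h; field.
- move=> z; have [e1 e2] := flow0 c11 c12 c21 c22 al be (z - z0).
  have un := u0 0 (lexx 0).
  by rewrite /Z1 /Z2 e1 e2 /al /be /g /h; split; field.
- move=> x x0 z.
  have [[D1 dz1] [D2 dz2]] := flow_holo c11 c12 c21 c22 al be (z - z0) x0.
  have sh : der id setT (fun z : R[i] => z - z0) z (1 - 0).
    by apply: derB; [exact: der_id|exact: der_cst].
  have e1 : der id setT (fun z => Z1 z x) z (D1 * (1 - 0)).
    exact: (der_comp (k := id) (B := setT) (h := fun z => z - z0) _ sh dz1).
  have e2 : der id setT (fun z => Z2 z x) z (D2 * (1 - 0)).
    exact: (der_comp (k := id) (B := setT) (h := fun z => z - z0) _ sh dz2).
  by split; eexists; apply: derD; apply: derZ; by [exact: e1|exact: e2].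
Qed.

End HolomorphicSolutions.

(** * The Schur function of the half line *)

Section Cayley.
Context {R : realType}.
Implicit Types (z w : R[i]) (p : sphere R).

Lemma holomorphic_der (f : R[i] -> R[i]) w : holomorphic_at f w ->
  exists D, der id setT f w D.
Proof.
move=> /cvg_ex[/= D cF]; exists D; apply: derP => e e0.
move/cvgrPdist_le : cF => /(_ e%:C); rewrite ltcR => /(_ e0).
rewrite near_withinE => /nbhs_ballP[d /= d0 hd].
(* Radii of balls in [R[i]] are complex numbers; being positive, they are real. *)
have dE : d = (complex.Re d)%:C.
  by apply/esym/RRe_real; rewrite realE ltW.
have d0' : 0 < complex.Re d by rewrite -ltcR -dE.
exists (complex.Re d) => // y _ yd.
have [->|yx] := eqVneq y w; first by rewrite !subrr mulr0 subr0 nm0 mulr0.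
have yx0 : y - w != 0 by rewrite subr_eq0.
have := hd (y - w); rewrite /ball /= sub0r normrN normrE_nm dE ltcR => /(_ yd yx0).
rewrite /GRing.scale /= mulr1 subrK normrE_nm lecR => h.
have -> : f y - f w - D * (y - w) = - ((y - w) * (D - (y - w)^-1 * (f y - f w))).
  by field.
by rewrite nmN nmM mulrC ler_wpM2r ?nm_ge0.
Qed.

Lemma der_holomorphic (f : R[i] -> R[i]) w D : der id setT f w D -> holomorphic_at f w.
Proof.
move=> df; apply/cvg_ex; exists D; apply/cvgrPdist_le => e e0.
have eE : e = (complex.Re e)%:C.
  by apply/esym/RRe_real; rewrite realE ltW.
have e0' : 0 < complex.Re e by rewrite -ltcR -eE.
have [d d0 hd] := der_eps df e0'.
rewrite near_withinE; apply/nbhs_ballP; exists d%:C => /=; first by rewrite ltcR.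
move=> h; rewrite /ball /= sub0r normrN normrE_nm ltcR => hd' h0.
have := hd (h *: 1 + w) I; rewrite /= addrK /GRing.scale /= mulr1 => /(_ hd') le.
have -> : D - h^-1 * (f (h + w) - f w) = - (h^-1 * (f (h + w) - f w - D * h)).
  by field.
rewrite normrE_nm eE lecR nmN nmM nmV mulrC ler_pdivrMr// nm_gt0//.
Qed.

(** With m = f1 / f2 this is (f1 - i f2) / (f1 + i f2), that is v / u; the point at infinity, where
    f2 = 0, goes to 1. *)
Definition cay p : R[i] := if p is Some m then (m - 'i%C) / (m + 'i%C) else 1.

Lemma cay_den z : 0 <= complex.Im z -> z + 'i%C != 0.
Proof.
move=> z0; apply/eqP => /(congr1 (@complex.Im R)); rewrite ImD /=.
by move=> h; have : 0 < complex.Im z + 1; [lra|rewrite h ltxx].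
Qed.

Lemma nm_cay p : closed_upper_half_plane R p -> nm (cay p) <= 1.
Proof.
case: p => [m|_]; last by rewrite [cay _](erefl : _ = 1) nm1.
rewrite /cay /closed_upper_half_plane /= => m0.
rewrite nmM nmV ler_pdivrMr ?nm_gt0 ?cay_den// mul1r.
rewrite -(@ler_pXn2r _ 2)// ?nnegrE ?nm_ge0// !nm_sqr.
by case: m m0 => a b /= b0; rewrite !expr2; lra.
Qed.

Lemma near_disc (P : R[i] -> Prop) w : (\forall y \near (w : R[i]^o), P y) ->
  exists2 d : R, 0 < d & forall y, nm (y - w) < d -> P y.
Proof.
move=> /nbhs_ballP[d /= d0 hd].
have dE : d = (complex.Re d)%:C.
  by apply/esym/RRe_real; rewrite realE ltW.
exists (complex.Re d); first by rewrite -ltcR -dE.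
by move=> y yd; apply: hd; rewrite /ball /= dE distrC normrE_nm ltcR.
Qed.

(** In the chart p = 1 / m the transform reads (1 - i p) / (1 + i p), which is regular at
    infinity. *)
Lemma cay_holo (M : R[i] -> sphere R) w : sphere_holomorphic_at M w ->
  closed_upper_half_plane R (M w) -> exists D, der id setT (cay \o M) w D.
Proof.
move=> [[/near_disc[d d0 hd] /holomorphic_der[D dD]]|
        [/near_disc[d d0 hd] /holomorphic_der[D dD]]] cl.
  have ME : M w = Some (chart (M w)).
    by case E : (M w) => [m|]//; case: (hd w); rewrite ?subrr ?nm0.
  have dn : (chart \o M) w + 'i%C != 0 by apply: cay_den; move: cl; rewrite ME.
  eexists; apply: (@der_local _ _ _ _ (fun y => ((chart \o M) y - 'i%C) *
     ((chart \o M) y + 'i%C)^-1) _ _ _ _ d0) => //.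
    move=> y _ /hd /=; rewrite /cay; case: (M y) => // h; by case: h.
  apply: derM => //; first by apply: derB; [exact: dD|exact: der_cst].
  by apply: derV_at => //; apply: derD; [exact: dD|exact: der_cst].
have dn : 1 + 'i%C * (chart_inv \o M) w != 0.
  move: cl; have := hd w; rewrite subrr nm0 => /(_ d0) /=.
  case: (M w) => [m m0|_ _] /=; last by rewrite mulr0 addr0 oner_neq0.
  rewrite /closed_upper_half_plane /= => mc.
  have mn : m != 0 by apply/eqP => E; rewrite E in m0.
  have -> : 1 + 'i%C * m^-1 = (m + 'i%C) / m by field.
  by rewrite mulf_neq0 ?invr_neq0// cay_den.
(* The half plane is assumed at [w] only; at nearby points the second alternative is available, by
   continuity of the denominator. *)
have cE p : p <> Some 0 -> closed_upper_half_plane R p \/ 1 + 'i%C * chart_inv p != 0 ->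
    cay p = (1 - 'i%C * chart_inv p) * (1 + 'i%C * chart_inv p)^-1.
  case: p => [m|_ _] /=; last by rewrite mulr0 subr0 addr0 divr1.
  move=> m0; have mn : m != 0 by apply/eqP => E; rewrite E in m0.
  have e : 1 + 'i%C * m^-1 = (m + 'i%C) / m by field.
  move=> H; have mi : m + 'i%C != 0.
    case: H => [|H]; first exact: cay_den.
    by move: H; rewrite e mulf_eq0 negb_or => /andP[].
  rewrite e; field; by rewrite mn mi.
have dI := derD (der_cst id setT w 1) (derZ 'i%C dD).
have n0 : 0 < nm (1 + 'i%C * (chart_inv \o M) w) by rewrite nm_gt0.
have [d' d'0 hd'] := der_cont dI (divr_gt0 n0 (ltr0n R 2)).
have dm : 0 < Num.min d d' by rewrite lt_min d0.
eexists; apply: (@der_local _ _ _ _ (fun y => (1 - 'i%C * (chart_inv \o M) y) *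
   (1 + 'i%C * (chart_inv \o M) y)^-1) _ _ _ _ dm) => //.
  move=> y _; rewrite lt_min => /andP[y1 y2] /=; rewrite cE//; first exact: hd.
  right; apply/eqP => E; have := hd' y I y2; rewrite /= E sub0r nmN.
  by move: n0 => /=; lra.
apply: derM => //; first by apply: derB; [exact: der_cst|apply: derZ; exact: dD].
by apply: derV_at => //; exact: dI.
Qed.

End Cayley.

(** * From the Dirac equation to the first order system *)

Section DiracToSystem.
Context {R : realType}.
Local Notation RC := (real_complex R).
Local Notation mu := (@lebesgue_measure R).
Variable W : R -> 'M[R]_2.

Definition potential (x : R) : R[i] := 'i%C * (W x 0 0 +i* W x 0 1).

Definition cplus (y : R -> 'cV[R[i]]_2) (x : R) : R[i] := y x 0 0 + 'i%C * y x 1 0.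
Definition cminus (y : R -> 'cV[R[i]]_2) (x : R) : R[i] := y x 0 0 - 'i%C * y x 1 0.

Lemma potential_L1 : dirac_potential W -> L1c potential.
Proof.
move=> [Wi _].
have h i j : L1loc (fun x => W x i j) by move=> b b0; exact: Wi.
split.
  apply: (L1loc_eq (g := fun x => W x 0 1 * -1)).
    by move=> x _; rewrite /potential /=; ring.
  by apply: L1loc_mul_cont => //; exact: cst_continuous.
by apply: L1loc_eq (h 0 0) => x _; rewrite /potential /=; ring.
Qed.

Lemma sum2 (V : nmodType) (F : 'I_2 -> V) : \sum_(i < 2) F i = F 0 + F 1.
Proof.
rewrite !big_ord_recl big_ord0 addr0.
by congr (F _ + F _); exact: val_inj.
Qed.

Lemma vec2_eq0 (y : 'cV[R[i]]_2) : y 0 0 = 0 -> y 1 0 = 0 -> y = 0.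
Proof.
move=> y0 y1; apply/matrixP => i j; rewrite !mxE (ord1 j).
by case: i => [[|[|//]]] Hi; [rewrite -[RHS]y0|rewrite -[RHS]y1];
  congr (y _ _); apply: val_inj.
Qed.

Lemma dirac_dsol z y : dirac_potential W ->
  {ae mu, forall x : R, 0 <= x -> \tr (W x) = 0} ->
  dirac_solution W z y -> dsol potential z (cplus y) (cminus y).
Proof.
move=> [_ Ws] Wt [ay dy]; split.
  move=> b b0.
  have a i : abscont (fun x => y x i 0) b by apply: AC_of_defs; case: (ay i b b0).
  by split; [apply: ACD|apply: ACB] => //; apply: ACZ.
apply: filterS3 dy Ws Wt; first exact: (ae_filter_ringOfSetsType mu).
move=> x dyx Wsx Wtx x0.
have [dd E] := dyx x0; have {}Wsx := Wsx x0; have {}Wtx := Wtx x0.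
pose d i := vec_derive y x i 0.
have dE i : der RC setT (fun t => y t i 0) x (d i).
  have [dr di] := dd i.
  have h1 : is_derive x 1 (Re_entry y i) (derive1 (Re_entry y i) x).
    exact (DeriveDef dr (esym (derive1E _ _))).
  have h2 : is_derive x 1 (Im_entry y i) (derive1 (Im_entry y i) x).
    exact (DeriveDef di (esym (derive1E _ _))).
  have := derD (is_derive_der setT h1) (derZ 'i%C (is_derive_der setT h2)).
  rewrite /d mxE [X in _ -> der _ _ _ _ X]ReImE /=.
  by apply: der_eq => // t _; rewrite [RHS]ReImE.
have E0 : - d 1 + ((W x 0 0)%:C * y x 0 0 + (W x 0 1)%:C * y x 1 0) = - z * y x 0 0.
  have := congr1 (fun A : 'cV[R[i]]_2 => A 0 0) E.
  by rewrite /d !mxE !sum2 !mxE /= modn_small// => <-; ring.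
have E1 : d 0 + ((W x 1 0)%:C * y x 0 0 + (W x 1 1)%:C * y x 1 0) = - z * y x 1 0.
  have := congr1 (fun A : 'cV[R[i]]_2 => A 1 0) E.
  by rewrite /d !mxE !sum2 !mxE /= modn_small// => <-; ring.
have W10 : W x 1 0 = W x 0 1 by rewrite -[in LHS]Wsx mxE.
have W11 : W x 1 1 = - W x 0 0.
  move: Wtx; rewrite /mxtrace sum2.
  by move=> h; apply/eqP; rewrite -addr_eq0 addrC; apply/eqP.
have d1E : d 1 = ((W x 0 0)%:C * y x 0 0 + (W x 0 1)%:C * y x 1 0) + z * y x 0 0.
  by move: E0; rewrite mulNr => h; rewrite -[z * _]opprK -h; ring.
have d0E : d 0 = - ((W x 0 1)%:C * y x 0 0 - (W x 0 0)%:C * y x 1 0) - z * y x 1 0.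
  by move: E1; rewrite mulNr W10 W11 rmorphN => <-; ring.
have ii : 'i%C * 'i%C = - 1 :> R[i] by rewrite -expr2 sqr_i.
have qE : potential x = 'i%C * ((W x 0 0)%:C + 'i%C * (W x 0 1)%:C).
  by congr (_ * _); exact: (ReImE (W x 0 0 +i* W x 0 1)).
have qJ : conjc (potential x) = - 'i%C * ((W x 0 0)%:C - 'i%C * (W x 0 1)%:C).
  by apply/eqP; rewrite /potential eq_complex /=; apply/andP; split; apply/eqP; ring.
split.
  have := derD (dE 0) (derZ 'i%C (dE 1)); apply: derE.
  rewrite d0E d1E qE /cplus /cminus.
  move: ((W x 0 0)%:C) ((W x 0 1)%:C) (y x 0 0) (y x 1 0) => w1 w2 f1 f2.
  (* For [ring] the imaginary unit is an atom, so its squares are isolated first and then replaced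
     by [ii]. *)
  have -> : 'i%C * z * (f1 + 'i%C * f2) + 'i%C * (w1 + 'i%C * w2) * (f1 - 'i%C * f2) =
    'i%C * z * f1 + ('i%C * 'i%C) * z * f2 + 'i%C * w1 * f1 + ('i%C * 'i%C) * w2 * f1
    - ('i%C * 'i%C) * w1 * f2 - ('i%C * 'i%C) * 'i%C * w2 * f2 by ring.
  by rewrite ii; ring.
have := derB (dE 0) (derZ 'i%C (dE 1)); apply: derE.
rewrite d0E d1E qJ /cplus /cminus.
move: ((W x 0 0)%:C) ((W x 0 1)%:C) (y x 0 0) (y x 1 0) => w1 w2 f1 f2.
have -> : - ('i%C * z * (f1 - 'i%C * f2)) + - 'i%C * (w1 - 'i%C * w2) * (f1 + 'i%C * f2) =
  - 'i%C * z * f1 + ('i%C * 'i%C) * z * f2 - 'i%C * w1 * f1 + ('i%C * 'i%C) * w2 * f1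
  - ('i%C * 'i%C) * w1 * f2 + ('i%C * 'i%C) * 'i%C * w2 * f2 by ring.
by rewrite ii; ring.
Qed.

Lemma nm_cplus_cminus y x : (nm (cplus y x) ^+ 2 + nm (cminus y x) ^+ 2) / 2 =
  \sum_(i < 2) (Re_entry y i x ^+ 2 + Im_entry y i x ^+ 2).
Proof.
rewrite sum2 !nm_sqr /cplus /cminus /Re_entry /Im_entry.
by case: (y x 0 0) (y x 1 0) => a b [c d] /=; field.
Qed.

Lemma cay_vec (f : 'cV[R[i]]_2) (p : sphere R) : sphere_of_vec f = p ->
  closed_upper_half_plane R p ->
  f 0 0 - 'i%C * f 1 0 = cay p * (f 0 0 + 'i%C * f 1 0).
Proof.
rewrite /sphere_of_vec; case: eqP => [-> <- _|/eqP f1 <-].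
  by rewrite /= !mulr0 subr0 addr0 mul1r.
move/cay_den => /= dn.
have e : f 0 0 / f 1 0 + 'i%C = (f 0 0 + 'i%C * f 1 0) / f 1 0 by field.
have dn' : f 0 0 + 'i%C * f 1 0 != 0.
  by move: dn; rewrite e mulf_eq0 negb_or => /andP[].
by rewrite e; field; rewrite f1.
Qed.

(* The default value of m_plus lies outside the closed upper half plane. *)
Lemma weyl_of_m_plus z (p : sphere R) : dirac_potential W ->
  {ae mu, forall x : R, 0 <= x -> \tr (W x) = 0} ->
  0 <= complex.Im z -> m_plus W z = p -> closed_upper_half_plane R p ->
  exists u v : R -> R[i], [/\ dsol potential z u v,
     (exists2 x, 0 <= x & ~ (u x = 0 /\ v x = 0)),
     forall x, 0 <= x -> nm (v x) <= nm (u x) & v 0 = cay p * u 0].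
Proof.
move=> Wp Wt z0; rewrite /m_plus; case: xgetP => [p' -> [f [sol sq [x x0 fx]] E]|_ <-]; last first.
  by rewrite /closed_upper_half_plane /= oppr_ge0 ler10.
move=> pp cp; have ds := dirac_dsol Wp Wt sol.
exists (cplus f), (cminus f); split => //.
- exists x => // -[h1 h2]; move/eqP: fx; apply.
  have e0 : f x 0 0 = 0.
    have -> : f x 0 0 = (cplus f x + cminus f x) / 2 by rewrite /cplus /cminus; field.
    by rewrite h1 h2 addr0 mul0r.
  apply: vec2_eq0 => //; move: h1; rewrite /cplus e0 add0r => /eqP.
  rewrite mulf_eq0 => /orP[/eqP i0|/eqP//].
  by have := @nm_i R; rewrite i0 nm0 => /esym/eqP; rewrite oner_eq0.
- apply: (square_integrable_gap ds) => //.
  move: sq; rewrite /square_integrable; congr (_ < _)%E.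
  by apply: eq_integral => t _; rewrite nm_cplus_cminus.
- by apply: cay_vec => //; rewrite -E.
Qed.

End DiracToSystem.

(** * Propagation of the Schur function along the half line *)

Section SchurFlow.
Context {R : realType}.
Local Notation RC := (real_complex R).
Local Notation mu := (@lebesgue_measure R).

Variables (q : R -> R[i]) (r : R) (s0 : R[i] -> R[i]).
Hypothesis qL : L1c q.
Hypothesis r0 : 0 < r.
Hypothesis s0_holo : forall w, w != 0 -> nm w < r -> exists D, der id setT s0 w D.
Hypothesis s0_le1 : forall w, nm w < r -> nm (s0 w) <= 1.
Hypothesis weyl : forall w, nm w < r -> 0 < complex.Im w ->
  exists u v : R -> R[i], [/\ dsol q (- w^-1) u v,
     (exists2 x, 0 <= x & ~ (u x = 0 /\ v x = 0)),
     forall x, 0 <= x -> nm (v x) <= nm (u x) & v 0 = s0 w * u 0].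

Lemma Im_Ninv (w : R[i]) : w != 0 -> complex.Im (- w^-1) = complex.Im w / nm w ^+ 2.
Proof. by rewrite nm_sqr; case: w => a b /= _; rewrite opprK. Qed.

(** A zero of [u] would also be one of [v], and uniqueness would make the solution trivial. *)
Lemma nontrivial_neq0 z u v : dsol q z u v ->
  (exists2 x, 0 <= x & ~ (u x = 0 /\ v x = 0)) ->
  (forall x, 0 <= x -> nm (v x) <= nm (u x)) -> forall x, 0 <= x -> u x != 0.
Proof.
move=> sol [x1 x10 nt] uv x x0; apply/eqP => ux; apply: nt.
apply: (sol_unique sol qL x0 ux) => //.
by apply: nm_eq0_le; rewrite -(nm0 (R := R)) -ux uv.
Qed.

(** The function is V / U for the solution with initial values (1, s0 w). Unlike a Weyl solution it
    is defined without regard to the sign of Im w, and it inherits holomorphy in w from [s0] and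
    from two solutions with constant initial values. *)
Theorem schur_flow : exists s : R -> R[i] -> R[i],
  (forall x, 0 <= x -> forall w, w != 0 -> nm w < r ->
     (exists D, der id setT (s x) w D) /\ nm (s x w) <= 1) /\
  (forall w, w != 0 -> nm w < r ->
     (forall b : R, 0 <= b -> abscont (fun x => s x w) b) /\
     {ae mu, forall x, 0 <= x -> der RC setT (fun x => s x w) x
        (2 * 'i%C * (s x w / w) + conjc (q x) - q x * s x w ^+ 2)}).
Proof.
have rpos := r0.
(* Some point of the upper half disc: its Weyl solution has no zeros and serves as the reference
   solution in [holo_solutions]. *)
pose w1 : R[i] := 'i%C * (r / 2)%:C.
have w1r : nm w1 < r by rewrite nmM nm_i mul1r nm_real ger0_norm; lra.
have w1I : 0 < complex.Im w1 by rewrite /w1 /= mul0r mul1r add0r divr_gt0.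
have [u [v [sol nt uv _]]] := weyl w1r w1I.
have un := nontrivial_neq0 sol nt uv.
have [U1 [V1 [sol1 i1 h1]]] := holo_solutions 1 0 qL sol un.
have [U2 [V2 [sol2 i2 h2]]] := holo_solutions 0 1 qL sol un.
pose U w x := 1 * U1 (- w^-1) x + s0 w * U2 (- w^-1) x.
pose V w x := 1 * V1 (- w^-1) x + s0 w * V2 (- w^-1) x.
have solw w : dsol q (- w^-1) (U w) (V w) by exact: dsol_lin.
have U0 w : U w 0 = 1 by rewrite /U (i1 _).1 (i2 _).1 mul1r mulr0 addr0.
have V0 w : V w 0 = s0 w by rewrite /V (i1 _).2 (i2 _).2 mul1r mulr1 add0r.
have VU w x : w != 0 -> nm w < r -> 0 <= x -> nm (V w x) <= nm (U w x).
  move=> wn wr x0; have wn0 : 0 < nm w ^+ 2 by rewrite exprn_gt0// nm_gt0.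
  have [wI|wI] := leP (complex.Im w) 0.
    have zI : complex.Im (- w^-1) <= 0 by rewrite Im_Ninv// pmulr_lle0// invr_gt0.
    have := gap_nondecreasing (solw w) zI (lexx 0) x0.
    rewrite U0 V0 nm1 expr1n => h.
    rewrite -(@ler_pXn2r _ 2)// ?nnegrE ?nm_ge0// -subr_ge0 (le_trans _ h)// subr_ge0.
    by rewrite expr_le1// ?nm_ge0// s0_le1.
  have [u' [v' [sol' nt' uv' ini]]] := weyl wr wI.
  have un' := nontrivial_neq0 sol' nt' uv'.
  (* The Weyl solution and [u' 0] times (U, V) agree at 0, hence everywhere; so the bound passes
     from the former to the latter. *)
  have dif := dsol_lin 1 (- u' 0) sol' (solw w).
  have [||hu hv] := sol_unique dif qL (lexx 0) _ _ x0.
  - by rewrite U0; ring.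
  - by rewrite V0 ini; ring.
  have eu : u' x = u' 0 * U w x.
    by apply/eqP; rewrite -subr_eq0 -hu; apply/eqP; ring.
  have ev : v' x = u' 0 * V w x.
    by apply/eqP; rewrite -subr_eq0 -hv; apply/eqP; ring.
  have := uv' x x0; rewrite eu ev !nmM ler_pM2l// nm_gt0.
  exact: un'.
have Un w x : w != 0 -> nm w < r -> 0 <= x -> U w x != 0.
  move=> wn wr x0; apply: (nontrivial_neq0 (solw w)) => //.
    by exists 0 => //; rewrite U0 => -[/eqP]; rewrite oner_eq0.
  by move=> y y0; exact: VU.
exists (fun x w => V w x / U w x); split.
  move=> x x0 w wn wr; split; last first.
    rewrite nmM nmV ler_pdivrMr ?nm_gt0 ?Un// mul1r; exact: VU.
  have [D0 ds] := s0_holo wn wr.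
  have dz : der id setT (fun w : R[i] => - w^-1) w (- (- 1 / w ^+ 2)).
    by apply: derN; apply: derV_at => //; exact: der_id.
  have [[a1 da1] [b1 db1]] := h1 x x0 (- w^-1).
  have [[a2 da2] [b2 db2]] := h2 x x0 (- w^-1).
  have cmp f a : der id setT f (- w^-1) a -> exists D, der id setT (fun w => f (- w^-1)) w D.
    by move=> df; eexists; exact: (der_comp (k := id) (B := setT) (h := fun w => - w^-1) _ dz df).
  have [A1 dA1] := cmp _ _ da1; have [A2 dA2] := cmp _ _ da2.
  have [B1 dB1] := cmp _ _ db1; have [B2 dB2] := cmp _ _ db2.
  have dU := derD (derZ 1 dA1) (derM (I : setT w) ds dA2).
  have dV := derD (derZ 1 dB1) (derM (I : setT w) ds dB2).
  by eexists; exact: (derM (I : setT w) dV (derV_at (I : setT w) (Un w x wn wr x0) dU)).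
move=> w wn wr; split.
  move=> b b0; have [aU aV] := sol_AC (solw w) b0.
  by apply: ACM => //; apply: ACV => // x /andP[x0 _]; exact: Un.
move: (solw w).2; apply: filterS; first exact: (ae_filter_ringOfSetsType mu).
move=> x dx x0; have [dU dV] := dx x0; have Ux := Un w x wn wr x0.
have := derM (I : setT x) dV (derV_at (I : setT x) Ux dU); apply: derE.
by field; rewrite wn Ux.
Qed.

End SchurFlow.

(** * The Taylor coefficients of the Schur function *)

Section HalflineCalculus.
Context {R : realType}.
Local Notation RC := (real_complex R).
Local Notation mu := (@lebesgue_measure R).
Implicit Types (f g F G : R -> R[i]).

(** The rotation argument of [mean_value_cmp] for derivatives that exist almost everywhere. *)
Lemma AC_cmp F G (b : R) : 0 <= b -> abscont F b -> abscont G b ->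
  {ae mu, forall x, 0 <= x -> exists D D', [/\ der RC setT F x D, der RC setT G x D' &
     nm D <= complex.Re D']} ->
  nm (F b - F 0) <= complex.Re (G b) - complex.Re (G 0).
Proof.
move=> b0 aF aG dFG.
pose w := F b - F 0.
pose c : R[i] := if w == 0 then 0 else (nm w)^-1%:C * conjc w.
have c1 : nm c <= 1.
  rewrite /c; case: ifPn => [_|w0]; first by rewrite nm0.
  by rewrite nmM nm_real nm_conj ger0_norm ?invr_ge0 ?nm_ge0// mulVf// nm_eq0.
have cw : complex.Re (c * w) = nm w.
  rewrite /c; case: eqP => [->|/eqP w0]; first by rewrite mul0r nm0.
  by rewrite mulrAC -mulrA mulcJ -rmorphM /= expr2 mulKf// nm_eq0.
have aH : abscont (fun x => G x - c * F x) b by apply: ACB => //; exact: ACZ.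
have := AC_monotone (lexx 0) b0 (lexx b) aH.
rewrite !ReB => H; rewrite -/w -cw /w mulrBr ReB.
suff : complex.Re (G 0) - complex.Re (c * F 0) <= complex.Re (G b) - complex.Re (c * F b) by lra.
apply: H; apply: filterS dFG; first exact: (ae_filter_ringOfSetsType mu).
move=> x dx /dx[D [D' [dF dG DD]]]; exists (D' - c * D); split.
  by apply: derB => //; exact: derZ.
rewrite ReB subr_ge0 (le_trans _ DD)// (le_trans (ler_norm _))// (le_trans (nm_Re _))//.
by rewrite nmM ler_piMl// nm_ge0.
Qed.

(** Subtracting a primitive of [f] leaves an absolutely continuous function with derivative 0 almost
    everywhere, hence a constant. *)
Lemma AC_C1 F f : (forall b, 0 <= b -> abscont F b) -> hcont f ->
  {ae mu, forall x, 0 <= x -> der RC setT F x (f x)} -> hder F f.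
Proof.
move=> aF cf dF; have [dG G0] := hprimP cf; set G := hprim f in dG G0.
have E x : 0 <= x -> F x = F 0 + G x.
  move=> x0; apply/eqP; rewrite -subr_eq0 -nm_eq0 eq_le nm_ge0 andbT.
  have aH : abscont (fun x => F x - G x) x.
    by apply: ACB => //; [exact: aF|exact: hder_AC dG cf _ x0].
  have := AC_cmp x0 aH (AC_cst 0 x); rewrite /= subrr G0 subr0.
  have -> : F x - (F 0 + G x) = F x - G x - F 0 by ring.
  apply; apply: filterS2 ae_neq0 dF; first exact: (ae_filter_ringOfSetsType mu).
  move=> t tn dt t0; exists (f t - f t), 0; split; last by rewrite subrr nm0.
    apply: derB; first exact: dt.
    by apply: der_interior (dG t t0); rewrite lt_def tn.
  exact: der_cst.
move=> x x0.
apply: (@der_eq _ _ _ _ (fun x => F 0 + G x)) => //.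
  by move=> y y0; rewrite -E.
by rewrite -[f x]add0r; apply: derD; [exact: der_cst|exact: dG].
Qed.

Lemma der_half_unique f x D D' : 0 <= x -> der RC halfline f x D ->
  der RC halfline f x D' -> D = D'.
Proof.
move=> x0 d1 d2; apply/eqP; rewrite -subr_eq0 -nm_eq0 eq_le nm_ge0 andbT.
apply/ler_addgt0Pr => e e0; rewrite add0r.
have e2 : 0 < e / 2 by rewrite divr_gt0.
have [a a0 ha] := der_eps d1 e2; have [b b0 hb] := der_eps d2 e2.
pose m := Num.min a b / 2.
have ab0 : 0 < Num.min a b by rewrite lt_min a0.
have m0 : 0 < m by rewrite divr_gt0.
have la : Num.min a b <= a by rewrite ge_min lexx.
have lb : Num.min a b <= b by rewrite ge_min lexx orbT.
have ma : m < a by rewrite /m; lra.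
have mb : m < b by rewrite /m; lra.
have xm : halfline (x + m) by rewrite /halfline /=; lra.
have E : nm (RC (x + m) - RC x) = m by rewrite nm_RCB addrAC subrr add0r ger0_norm// ltW.
have h1 := ha _ xm; have h2 := hb _ xm; rewrite !E in h1 h2.
have {}h1 := h1 ma; have {}h2 := h2 mb.
have : nm ((D - D') * (RC (x + m) - RC x)) <= e * m.
  have -> : (D - D') * (RC (x + m) - RC x) =
     (f (x + m) - f x - D' * (RC (x + m) - RC x)) -
     (f (x + m) - f x - D * (RC (x + m) - RC x)) by ring.
  by rewrite (le_trans (nmB _ _))//; lra.
by rewrite nmM E ler_pM2r.
Qed.

Lemma hcont_ulimit f : (forall e : R, 0 < e -> exists2 g, hcont g &
  forall x, 0 <= x -> nm (f x - g x) <= e) -> hcont f.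
Proof.
move=> H x x0; apply: (@cont_scaled _ _ _ _ _ _ 3) => e e0 _.
have [g cg hg] := H e e0; have [d d0 hd] := cg x x0 e e0; exists d => // y y0 yd.
have h1 := hd y y0 yd; have h2 := hg y y0; have h3 := hg x x0.
have -> : f y - f x = (f y - g y) + (g y - g x) - (f x - g x) by ring.
have := nmB (f y - g y + (g y - g x)) (f x - g x); have := nmD (f y - g y) (g y - g x).
lra.
Qed.

Lemma hprim_bound f (M x : R) : 0 <= x -> hcont f -> (forall t, 0 <= t -> nm (f t) <= M) ->
  nm (hprim f x) <= M * x.
Proof.
move=> x0 cf fM; have [dF F0] := hprimP cf.
rewrite -[x in leRHS]subr0 -[hprim f x]subr0 -F0.
apply: (mean_value x0 (hder_seg (lexx 0) dF)) => t /andP[t0 _]; exact: fM.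
Qed.

Lemma hprim_lin f g (c d : R[i]) x : 0 <= x -> hcont f -> hcont g ->
  hprim (fun t => c * f t + d * g t) x = c * hprim f x + d * hprim g x.
Proof.
move=> x0 cf cg.
have ch : hcont (fun t => c * f t + d * g t).
  by move=> t t0; apply: contD; apply: contM; by [exact: cont_cst|exact: cf|exact: cg].
have [dF F0] := hprimP cf; have [dG G0] := hprimP cg; have [dH H0] := hprimP ch.
have := @der0_const _ (fun t => hprim (fun t => c * f t + d * g t) t -
  (c * hprim f t + d * hprim g t)) 0 x x0.
rewrite H0 F0 G0 !mulr0 addr0 subrr => h; apply/eqP; rewrite -subr_eq0; apply/eqP; apply: h.
move=> t tx; have t0 : 0 <= t by case/andP: tx.
apply: (@derE _ _ _ _ _ _ (c * f t + d * g t - (c * f t + d * g t))); first by rewrite subrr.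
have sub : seg 0 x `<=` halfline := seg_halfline (lexx 0).
apply: derB; first exact: der_sub sub (dH t t0).
by apply: derD; apply: derZ; [exact: der_sub sub (dF t t0)|exact: der_sub sub (dG t t0)].
Qed.

End HalflineCalculus.

Section CauchyProduct.
Context {R : realType}.
Implicit Types (a : nat -> R[i]) (w s : R[i]).

Definition cauchy_square a n : R[i] := \sum_(i < n.+1) a i * a (n - i)%N.

(** Both sides sum over the triangle i + j < N. *)
Lemma cauchy_square_triangle a w N : \sum_(k < N) cauchy_square a k * w ^+ k =
  \sum_(i < N) a i * w ^+ i * \sum_(j < N - i) a j * w ^+ j.
Proof.
elim: N => [|N IH]; first by rewrite !big_ord0.
rewrite big_ord_recr /= IH [in RHS]big_ord_recr /=.
rewrite subSn// subnn big_ord_recr big_ord0 /= add0r expr0 mulr1.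
rewrite [in RHS](eq_bigr (fun i : 'I_N => a i * w ^+ i * (\sum_(j < N - i) a j * w ^+ j) +
   a i * a (N - i)%N * w ^+ N)); last first.
  move=> i _; have iN := ltnW (ltn_ord i).
  rewrite subSn// big_ord_recr /= mulrDr; congr (_ + _).
  have eN : w ^+ N = w ^+ i * w ^+ (N - i) by rewrite -exprD subnKC.
  by rewrite eN; ring.
rewrite big_split /= -addrA; congr (_ + _).
by rewrite /cauchy_square mulr_suml big_ord_recr /= subnn; congr (_ + _); ring.
Qed.

(** In the i-th term the factor of order i meets a remainder of order N - i, so [N] errors of order
    N arise, and one more from [s] times its own remainder. *)
Lemma cauchy_square_remainder a w s (k : R) N :
  (forall n, nm (a n) <= k ^+ n) -> nm s <= 1 -> 0 <= k ->
  (forall n, nm (s - \sum_(j < n) a j * w ^+ j) <= 2 * (k * nm w) ^+ n) ->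
  nm (s ^+ 2 - \sum_(j < N) cauchy_square a j * w ^+ j) <= (2 + 2 * N%:R) * (k * nm w) ^+ N.
Proof.
move=> ak s1 k0 H; set t := k * nm w in H *.
have t0 : 0 <= t by rewrite mulr_ge0 ?nm_ge0.
have -> : s ^+ 2 - \sum_(j < N) cauchy_square a j * w ^+ j =
   s * (s - \sum_(j < N) a j * w ^+ j) +
   \sum_(i < N) a i * w ^+ i * (s - \sum_(j < N - i) a j * w ^+ j).
  rewrite cauchy_square_triangle.
  rewrite [X in _ = _ + X](eq_bigr (fun i : 'I_N => s * (a i * w ^+ i) -
    a i * w ^+ i * \sum_(j < N - i) a j * w ^+ j)); last by move=> i _; ring.
  by rewrite sumrB -mulr_sumr; ring.
rewrite (le_trans (nmD _ _))// mulrDl lerD//.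
  rewrite nmM -[leRHS]mul1r ler_pM ?nm_ge0//.
rewrite (le_trans (nm_sum _ _ _))//.
apply: (@le_trans _ _ (\sum_(i < N) 2 * t ^+ N)).
  apply: ler_sum => i _; rewrite !nmM nmX.
  have iN := ltnW (ltn_ord i).
  have -> : 2 * t ^+ N = (k ^+ i * nm w ^+ i) * (2 * t ^+ (N - i)).
    have eN : t ^+ N = t ^+ i * t ^+ (N - i) by rewrite -exprD subnKC.
    by rewrite -exprMn -/t eN; ring.
  rewrite ler_pM ?mulr_ge0 ?nm_ge0 ?exprn_ge0 ?nm_ge0//.
  by rewrite ler_wpM2r ?exprn_ge0 ?nm_ge0.
by rewrite sumr_const card_ord -mulr_natr; lra.
Qed.

End CauchyProduct.

Section Coefficients.
Context {R : realType}.
Local Notation RC := (real_complex R).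
Local Notation mu := (@lebesgue_measure R).

Variables (q : R -> R[i]) (r : R) (s : R -> R[i] -> R[i]).
Hypothesis qL : L1c q.
Hypothesis r0 : 0 < r.
Hypothesis s_schur : forall x, 0 <= x -> forall w, w != 0 -> nm w < r ->
  (exists D, der id setT (s x) w D) /\ nm (s x w) <= 1.
Hypothesis s_riccati : forall w, w != 0 -> nm w < r ->
  (forall b : R, 0 <= b -> abscont (fun x => s x w) b) /\
  {ae mu, forall x, 0 <= x -> der RC setT (fun x => s x w) x
     (2 * 'i%C * (s x w / w) + conjc (q x) - q x * s x w ^+ 2)}.

Let k : R := 2 / r.

Let k0 : 0 < k. Proof. by rewrite divr_gt0. Qed.

Definition expands (a : nat -> R -> R[i]) :=
  (forall n x, 0 <= x -> nm (a n x) <= k ^+ n) /\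
  (forall N x w, 0 <= x -> w != 0 -> nm w <= r / 4 ->
     nm (s x w - \sum_(n < N) a n x * w ^+ n) <= 2 * (k * nm w) ^+ N).

Lemma expansion_exists : exists a, expands a.
Proof.
have /choice[c hc] : forall x : R, exists c : nat -> R[i], 0 <= x ->
    (forall n, nm (c n) <= k ^+ n) /\
    (forall N w, w != 0 -> nm w <= r / 4 ->
      nm (s x w - \sum_(n < N) c n * w ^+ n) <= 2 * (k * nm w) ^+ N).
  move=> x; have [x0|x0] := leP 0 x; last by exists (fun=> 0).
  have [||c hc] := @disc_expansion _ (s x) r r0.
  - by move=> w wn wr; case: (s_schur x0 wn wr).
  - by move=> w wn wr; case: (s_schur x0 wn wr).
  by exists c.
exists (fun n x => c x n); split; first by move=> n x /hc[].
by move=> N x w /hc[_]; apply.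
Qed.

Variable a : nat -> R -> R[i].
Hypothesis aE : expands a.

Let small (e C : R) : 0 < e -> exists2 w : R[i], (w != 0) && (nm w <= r / 4) & C * nm w <= e.
Proof.
move=> e0; have rpos := r0.
have C1 : 0 < `|C| + 1 by rewrite ltr_wpDl.
pose m := Num.min (r / 4) (e / (`|C| + 1)).
have m0 : 0 < m by rewrite lt_min divr_gt0//= divr_gt0.
have m1 : m <= r / 4 by rewrite ge_min lexx.
have m2 : m <= e / (`|C| + 1) by rewrite ge_min lexx orbT.
have nE : nm m%:C = m by rewrite nm_real ger0_norm// ltW.
exists m%:C; first by rewrite -nm_gt0 nE m0.
rewrite nE (@le_trans _ _ ((`|C| + 1) * m))//.
  by rewrite ler_wpM2r ?(ltW m0)// (le_trans (ler_norm _))// lerDl.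
by rewrite (le_trans (ler_wpM2l (ltW C1) m2))// mulrCA divff ?mulr1// gt_eqF.
Qed.

Let in_disc (w : R[i]) : nm w <= r / 4 -> nm w < r.
Proof. by have := r0; lra. Qed.

Let s_hcont w : w != 0 -> nm w <= r / 4 -> hcont (fun x => s x w).
Proof.
move=> wn wr; apply: seg_hcont => b b0; apply: AC_cont.
by have [h _] := s_riccati wn (in_disc wr); exact: h.
Qed.

(** By induction, [a n] is the uniform limit as w tends to 0 of divided differences of [s], which
    are continuous in [x]. *)
Lemma coef_hcont n : hcont (a n).
Proof.
have [an sE] := aE.
elim/ltn_ind: n => n IH; apply: hcont_ulimit => e e0.
have [w /andP[wn wr] hw] := small (2 * k ^+ n.+1) e0.
have wn0 : 0 < nm w ^+ n by rewrite exprn_gt0// nm_gt0.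
exists (fun x => (s x w - \sum_(j < n) a j x * w ^+ j) * (w ^+ n)^-1).
  move=> x x0; apply: contM; last exact: cont_cst.
  apply: contB; first exact: s_hcont.
  have H m : (m <= n)%N -> cont_at RC halfline (fun x => \sum_(j < m) a j x * w ^+ j) x.
    elim: m => [|m IHm] mn.
      by under eq_fun do rewrite big_ord0; exact: cont_cst.
    under eq_fun do rewrite big_ord_recr /=.
    apply: contD; first by apply: IHm; exact: ltnW.
    by apply: contM; [exact: IH|exact: cont_cst].
  exact: H.
move=> x x0.
have -> : a n x - (s x w - \sum_(j < n) a j x * w ^+ j) * (w ^+ n)^-1 =
    - ((s x w - \sum_(j < n.+1) a j x * w ^+ j) / w ^+ n).
  by rewrite big_ord_recr /=; field; rewrite expf_neq0.
rewrite nmN nmM nmV nmX ler_pdivrMr//.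
rewrite (le_trans (sE n.+1 x w x0 wn wr))//.
have -> : 2 * (k * nm w) ^+ n.+1 = (2 * k ^+ n.+1 * nm w) * nm w ^+ n.
  by rewrite exprMn [nm w ^+ n.+1]exprS; ring.
by rewrite ler_wpM2r// ltW.
Qed.

Let H n := hprim (a n).

(** The equation is integrated because [q] has no pointwise bound. [Q] is a primitive of the
    conjugate of [q], and [K] one of |Re q| + |Im q|; the latter bounds the contribution of the
    quadratic term. *)
Lemma riccati_integrated : exists2 Q : R -> R[i],
  {ae mu, forall x, 0 <= x -> der RC setT Q x (conjc (q x))} &
  exists2 K : R -> R, (forall x, 0 <= x -> 0 <= K x) &
  forall w (eta x : R), w != 0 -> nm w <= r / 4 -> 0 <= x -> 0 <= eta ->
    (forall y, 0 <= y -> nm (s y w) <= eta) ->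
    nm (s x w - s 0 w - 2 * 'i%C * hprim (fun y => s y w / w) x - (Q x - Q 0))
      <= eta ^+ 2 * K x.
Proof.
have [Q [aQ dQ]] := L1c_primitive (L1c_conj qL).
exists Q => //.
have [qR qI] := qL.
have [K [aK dK]] := L1_primitive (L1loc_add (L1loc_norm qR) (L1loc_norm qI)).
have Kmono x : 0 <= x -> 0 <= K x - K 0.
  move=> x0.
  have := AC_monotone (lexx 0) x0 (lexx x) (aK x x0); rewrite /= subr_ge0; apply.
  apply: filterS dK; first exact: (ae_filter_ringOfSetsType mu).
  by move=> t dt /dt d; eexists; split; [exact: d|rewrite /= addr_ge0].
exists (fun x => K x - K 0) => // w eta x wn wr x0 eta0 sb.
have [asw dsw] := s_riccati wn (in_disc wr).
have csw : hcont (fun y => s y w / w).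
  by move=> y y0; apply: contM; [exact: s_hcont|exact: cont_cst].
have [dG G0] := hprimP csw; set G := hprim _ in dG G0 *.
have aG : abscont G x by exact: (hder_AC dG csw).
have -> : s x w - s 0 w - 2 * 'i%C * G x - (Q x - Q 0) =
   (s x w - 2 * 'i%C * G x - Q x) - (s 0 w - 2 * 'i%C * G 0 - Q 0) by rewrite G0; ring.
have E y : eta ^+ 2 * (K y) = complex.Re ((eta ^+ 2)%:C * (K y)%:C).
  by rewrite -rmorphM.
rewrite mulrBr !E.
apply: (@AC_cmp _ (fun x => s x w - 2 * 'i%C * G x - Q x)
   (fun x => (eta ^+ 2)%:C * (K x)%:C)) => //.
- apply: ACB => //; last exact: aQ.
  by apply: ACB => //; [exact: asw|exact: ACZ].
- by apply: ACZ => //; exact: aK.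
have A1 : {ae mu, forall x, x != 0 /\ (0 <= x -> der RC setT (fun x => s x w) x
     (2 * 'i%C * (s x w / w) + conjc (q x) - q x * s x w ^+ 2))}.
  apply: filterS2 ae_neq0 dsw; first exact: (ae_filter_ringOfSetsType mu).
  by move=> y ? ?; split.
apply: filterS3 A1 dQ dK; first exact: (ae_filter_ringOfSetsType mu).
move=> t [tn ds] dq dk t0.
have tp : 0 < t by rewrite lt_def tn.
have d1 := derB (derB (ds t0) (derZ (2 * 'i%C) (der_interior tp (dG t t0)))) (dq t0).
do 2 eexists; split; [exact: d1|exact: derZ (dk t0)|].
have -> : 2 * 'i%C * (s t w / w) + (q t)^*%C - q t * s t w ^+ 2 -
   2 * 'i%C * (s t w / w) - (q t)^*%C = - (q t * s t w ^+ 2) by ring.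
rewrite -rmorphM nmN nmM nmX mulrC /=.
by apply: ler_pM; rewrite ?exprn_ge0 ?nm_ge0 ?nm_le_ReIm ?lerXn2r ?nnegrE ?nm_ge0 ?sb.
Qed.

(** The quotient [w ^+ n / w] stands for the power n - 1; it is applied with n = 0 and n = 1. *)
Lemma coef_int_gap n (w : R[i]) x : 0 <= x -> w != 0 -> nm w <= r / 4 ->
  (forall j y, (j < n)%N -> 0 <= y -> a j y = 0) ->
  nm (hprim (fun y => s y w / w) x - w ^+ n / w * H n x) <=
    2 * (k * nm w) ^+ n.+1 / nm w * x.
Proof.
move=> x0 wn wr a0; have [an sE] := aE.
have ch := @coef_hcont n; have cs := s_hcont wn wr.
have -> : hprim (fun y => s y w / w) x - w ^+ n / w * H n x =
   hprim (fun y => w^-1 * s y w + (- (w ^+ n / w)) * a n y) x.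
  rewrite hprim_lin//.
  have -> : hprim (fun y => s y w / w) x = w^-1 * hprim (fun y => s y w) x + 0 * H n x.
    rewrite -hprim_lin//; congr (hprim _ x).
    by apply/funext => y; rewrite mul0r addr0 mulrC.
  by rewrite /H; ring.
apply: hprim_bound => //.
  by move=> t t0; apply: contD; apply: contM; by [exact: cont_cst|exact: cs|exact: ch].
move=> t t0.
have := sE n.+1 t w t0 wn wr; rewrite big_ord_recr /= big1; last first.
  by move=> j _; rewrite a0// mul0r.
rewrite add0r => h.
have -> : w^-1 * s t w + - (w ^+ n / w) * a n t = (s t w - a n t * w ^+ n) / w by ring.
by rewrite nmM nmV ler_wpM2r// invr_ge0 nm_ge0.
Qed.

(** As w tends to 0, the integral of s / w grows like that of a_0 divided by w, while the other
    terms of the integrated equation stay bounded. So the integrals of a_0 vanish, and by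
    differentiation so does a_0. *)
Lemma expansion_coef0 x : 0 <= x -> a 0%N x = 0.
Proof.
have [an sE] := aE.
have [Q dQ [K K0 hK]] := riccati_integrated.
have H0 y : 0 <= y -> H 0%N y = 0.
  move=> y0; apply/eqP; rewrite -nm_eq0 eq_le nm_ge0 andbT.
  apply/ler_addgt0Pr => e e0; rewrite add0r.
  pose C := 2 + K y + nm (Q y - Q 0) + 2 * k * y.
  have [w /andP[wn wr] hw] := small C e0.
  apply: le_trans hw.
  have wp : 0 < nm w by rewrite nm_gt0.
  have s1 t : 0 <= t -> nm (s t w) <= 1 by move=> t0; case: (s_schur t0 wn (in_disc wr)).
  have h1 := hK w 1 y wn wr y0 ler01 s1.
  have h2 := coef_int_gap (n := 0) y0 wn wr ltac:(by []).
  rewrite expr1n mul1r in h1.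
  have e1 : 2 * (k * nm w) ^+ 1 / nm w * y = 2 * k * y.
    by rewrite expr1; field; rewrite gt_eqF.
  rewrite e1 in h2; set G := hprim _ _ in h1 h2.
  have e2 : w ^+ 0 / w * H 0%N y = G - (G - w ^+ 0 / w * H 0%N y) by ring.
  have h3 : nm G <= 2 + K y + nm (Q y - Q 0).
    have e3 : 2 * 'i%C * G = (s y w - s 0 w) - (Q y - Q 0) -
        (s y w - s 0 w - 2 * 'i%C * G - (Q y - Q 0)) by ring.
    have : nm (2 * 'i%C * G) = 2 * nm G by rewrite !nmM nm_i mulr1 nm_natr.
    have := nmB ((s y w - s 0 w) - (Q y - Q 0)) (s y w - s 0 w - 2 * 'i%C * G - (Q y - Q 0)).
    rewrite -e3; have := nmB (s y w - s 0 w) (Q y - Q 0).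
    have := nmB (s y w) (s 0 w); have := s1 y y0; have := s1 0 (lexx 0).
    have := nm_ge0 G; lra.
  have h4 : nm (w ^+ 0 / w * H 0%N y) <= C.
    by rewrite e2 (le_trans (nmB _ _))// /C; lra.
  move: h4; rewrite expr0 mul1r nmM nmV mulrC ler_pdivrMr//.
have [d0 _] := hprimP (@coef_hcont 0).
move=> x0; apply: (der_half_unique x0 (d0 x x0)).
apply: (@der_eq _ _ _ _ (fun=> 0)) => //; last exact: der_cst.
by move=> y y0; rewrite -/(H 0%N) H0.
Qed.

(** Now s = O(w), so the quadratic term is O(w^2) and the limit of the integrated equation expresses
    [Q] by the integral of a_1; differentiation gives the claim. *)
Lemma expansion_coef1 : {ae mu, forall x, 0 <= x -> conjc (q x) = - (2 * 'i%C * a 1%N x)}.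
Proof.
have [an sE] := aE.
have [Q dQ [K K0 hK]] := riccati_integrated.
have QE y : 0 <= y -> Q y = Q 0 - 2 * 'i%C * H 1%N y.
  move=> y0; apply/eqP; rewrite -subr_eq0 -nm_eq0 eq_le nm_ge0 andbT.
  apply/ler_addgt0Pr => e e0; rewrite add0r.
  (* The terms come from [s] at both ends, from the quadratic term, where one factor
     [2 * (k * nm w)] is bounded by 1, and from [coef_int_gap]. *)
  pose C := 4 * k + 2 * k * K y + 4 * k ^+ 2 * y.
  have [w /andP[wn wr] hw] := small C e0.
  apply: le_trans hw.
  have wp : 0 < nm w by rewrite nm_gt0.
  have kp := k0.
  have s1 t : 0 <= t -> nm (s t w) <= 2 * (k * nm w).
    move=> t0; have := sE 1%N t w t0 wn wr.
    by rewrite big_ord_recl big_ord0 /= expansion_coef0// mul0r addr0 subr0 expr1.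
  have kw : k * nm w <= 1 / 2.
    by rewrite (le_trans (ler_wpM2l (ltW kp) wr))// /k; rewrite le_eqVlt; apply/orP; left;
      apply/eqP; field; rewrite gt_eqF.
  have kw0 : 0 <= k * nm w by rewrite mulr_ge0 ?nm_ge0// ltW.
  have eta0 : 0 <= 2 * (k * nm w) by rewrite mulr_ge0.
  have h1 := hK w (2 * (k * nm w)) y wn wr y0 eta0 s1.
  have h2 := coef_int_gap (n := 1) y0 wn wr _.
  have {}h2 := h2 ltac:(by move=> [|j]//= t _ t0; exact: expansion_coef0).
  have e1 : 2 * (k * nm w) ^+ 2 / nm w * y = 2 * k ^+ 2 * y * nm w.
    by field; rewrite gt_eqF.
  rewrite e1 expr1 divff// mul1r in h2; set G := hprim _ _ in h1 h2.
  have e3 : Q y - (Q 0 - 2 * 'i%C * H 1%N y) = s y w - s 0 w - 2 * 'i%C * (G - H 1%N y) -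
     (s y w - s 0 w - 2 * 'i%C * G - (Q y - Q 0)) by ring.
  have n2 : nm (2 * 'i%C * (G - H 1%N y)) = 2 * nm (G - H 1%N y).
    by rewrite !nmM nm_i mulr1 nm_natr.
  have h3 : (2 * (k * nm w)) ^+ 2 * K y <= 2 * (k * nm w) * K y.
    rewrite ler_wpM2r ?K0// expr2 ler_piMl//; lra.
  rewrite e3 (le_trans (nmB _ _))//.
  have := nmB (s y w - s 0 w) (2 * 'i%C * (G - H 1%N y)).
  have := nmB (s y w) (s 0 w); have := s1 y y0; have := s1 0 (lexx 0).
  rewrite /C; set kk := k * nm w in h3 h1 s1 *.
  have -> : (4 * k + 2 * k * K y + 4 * k ^+ 2 * y) * nm w =
    4 * kk + 2 * kk * K y + 2 * (2 * k ^+ 2 * y * nm w) by rewrite /kk; ring.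
  lra.
have [d1 _] := hprimP (@coef_hcont 1).
apply: filterS2 ae_neq0 dQ; first exact: (ae_filter_ringOfSetsType mu).
move=> x xn dx x0.
apply: (der_half_unique x0 (f := Q)).
  by apply: der_sub (dx x0).
apply: (@der_eq _ _ _ _ (fun y => Q 0 - 2 * 'i%C * H 1%N y)) => //.
  by move=> y y0; rewrite -QE.
rewrite -[X in der _ _ _ _ X]add0r; apply: derD; first exact: der_cst.
by apply: derN; apply: derZ; exact: d1.
Qed.

(** The continuous representative of [q] provided by [expansion_coef1]. *)
Definition qcont (x : R) : R[i] := 2 * 'i%C * conjc (a 1%N x).

Lemma qcont_hcont : hcont qcont.
Proof.
by move=> x x0; apply: contM; [exact: cont_cst|apply: cont_conj; exact: coef_hcont].
Qed.

Lemma conj_qcont x : conjc (qcont x) = - (2 * 'i%C * a 1%N x).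
Proof. by rewrite /qcont; case: (a 1%N x) => b c; apply/eqP; rewrite eq_complex /=;
  apply/andP; split; apply/eqP; ring. Qed.

(** With [qcont] the right hand side is continuous, so [AC_C1] upgrades the equation from almost
    every to every point. *)
Lemma s_hder w : w != 0 -> nm w <= r / 4 ->
  hder (fun x => s x w) (fun x => 2 * 'i%C * (s x w / w) + conjc (qcont x) -
    qcont x * s x w ^+ 2).
Proof.
move=> wn wr; have [asw dsw] := s_riccati wn (in_disc wr).
have cs := s_hcont wn wr.
apply: AC_C1 => //.
  move=> x x0; apply: contB.
    apply: contD; last by apply: cont_conj; exact: qcont_hcont.
    apply: contM; first exact: cont_cst.
    by apply: contM; [exact: cs|exact: cont_cst].
  by apply: contM; [exact: qcont_hcont|apply: contX; exact: cs].
apply: filterS2 expansion_coef1 dsw; first exact: (ae_filter_ringOfSetsType mu).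
move=> x qx ds x0; have := ds x0; apply: derE.
have -> : q x = qcont x by rewrite -[LHS]conjcK qx// -conj_qcont conjcK.
by [].
Qed.

Definition coef_rhs n (x : R) : R[i] :=
  2 * 'i%C * a n.+1 x + (if n == 0%N then conjc (qcont x) else 0) -
  qcont x * cauchy_square (fun j => a j x) n.

(** [a n.+1] is the limit of the divided remainders [F m] along a sequence w -> 0. Their derivatives
    are known by induction and converge uniformly, so [der_limit] applies. *)
Theorem coef_hder n : hder (a n) (coef_rhs n).
Proof.
have [an sE] := aE; have kp := k0; have rpos := r0.
elim/ltn_ind: n => -[_|n IH].
  move=> x x0; apply: (@der_eq _ _ _ _ (fun=> 0)) => //.
    by move=> y y0; rewrite expansion_coef0.
  rewrite /coef_rhs /= conj_qcont /cauchy_square big_ord_recl big_ord0 /=.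
  rewrite expansion_coef0// mul0r addr0 mulr0.
  by rewrite subr0 addrN; exact: der_cst.
apply: seg_hder => b b0 x xb.
pose wk m : R[i] := (r / 4 / m.+1%:R)%:C.
have wkE m : nm (wk m) = r / 4 / m.+1%:R by rewrite nm_real ger0_norm// !divr_ge0// ltW.
have wkn m : wk m != 0 by rewrite -nm_gt0 wkE !divr_gt0.
have wkr m : nm (wk m) <= r / 4.
  by rewrite wkE ler_pdivrMr// ler_peMr ?divr_ge0 ?(ltW rpos)// ler1n.
have wk_small (C e : R) : 0 < e -> exists N, forall m, (N <= m)%N -> C * nm (wk m) <= e.
  move=> e0; exists (Num.truncn (`|C| * (r / 4) / e)) => m Nm; rewrite wkE.
  have h : `|C| * (r / 4) / e < m.+1%:R.
    have z0 : 0 <= `|C| * (r / 4) / e.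
      by rewrite divr_ge0 ?(ltW e0)// mulr_ge0// divr_ge0// ltW.
    have /andP[_ h] := truncn_itv z0.
    by rewrite (lt_le_trans h)// ler_nat ltnS.
  rewrite (@le_trans _ _ (`|C| * (r / 4 / m.+1%:R)))//.
    by rewrite ler_wpM2r ?ler_norm// !divr_ge0// ltW.
  by rewrite mulrA ler_pdivrMr//; move: h; rewrite ltr_pdivrMr// [_ * e]mulrC => /ltW.
pose F m (y : R) := (s y (wk m) - \sum_(j < n.+1) a j y * wk m ^+ j) / wk m ^+ n.+1.
pose F' m (y : R) := ((2 * 'i%C * (s y (wk m) / wk m) + conjc (qcont y) -
   qcont y * s y (wk m) ^+ 2) - \sum_(j < n.+1) coef_rhs j y * wk m ^+ j) / wk m ^+ n.+1.
apply: (@der_limit R R RC (seg 0 b) x F F' (a n.+1) (coef_rhs n.+1)) => //.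
- exact: mvt_seg.
- move=> m y yb.
  have y0 : halfline y by case/andP: yb.
  have sub : seg 0 b `<=` halfline := seg_halfline (lexx 0).
  have dS : der RC halfline (fun y => \sum_(j < n.+1) a j y * wk m ^+ j) y
      (\sum_(j < n.+1) coef_rhs j y * wk m ^+ j).
    have := @der_sum R R RC halfline 'I_n.+1 (index_enum _)
       (fun j y => wk m ^+ j * a j y) (fun j => wk m ^+ j * coef_rhs j y) y.
    under [in X in _ -> der _ _ X _ _]eq_fun do under eq_bigr do rewrite mulrC.
    under [in X in _ -> der _ _ _ _ X]eq_bigr do rewrite mulrC.
    by apply => j; apply: derZ; exact: IH.
  have := derZ (wk m ^+ n.+1)^-1 (derB (s_hder (wkn m) (wkr m) y0) dS).
  move=> /(der_sub sub); rewrite /F' mulrC.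
  by congr der; apply/funext => t; rewrite mulrC.
- move=> y yb e e0; have y0 : 0 <= y by case/andP: yb.
  have [N hN] := wk_small (2 * k ^+ n.+2) e e0; exists N => m Nm.
  have wn0 : 0 < nm (wk m) ^+ n.+1 by rewrite exprn_gt0// nm_gt0.
  apply: le_trans (hN m Nm).
  have -> : F m y - a n.+1 y = (s y (wk m) - \sum_(j < n.+2) a j y * wk m ^+ j) / wk m ^+ n.+1.
    by rewrite /F [in RHS]big_ord_recr /=; field; rewrite expf_neq0.
  rewrite nmM nmV nmX ler_pdivrMr// (le_trans (sE n.+2 y _ y0 (wkn m) (wkr m)))//.
  by rewrite le_eqVlt; apply/orP; left; apply/eqP; rewrite exprMn [nm _ ^+ n.+2]exprS; ring.
- move=> e e0.
  (* The first summand stems from the remainder of [s], the second from that of its square,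
     multiplied by the bound [2 * k] for [qcont]. *)
  pose C := 4 * k ^+ n.+3 + 2 * k * ((2 + 2 * n.+2%:R) * k ^+ n.+2).
  have [N hN] := wk_small C e e0; exists N => m Nm y yb.
  have y0 : 0 <= y by case/andP: yb.
  have wn := wkn m; have wr := wkr m.
  have wp : 0 < nm (wk m) by rewrite nm_gt0.
  apply: le_trans (hN m Nm); rewrite /F'; move: (wk m) wn wr wp => w wn wr wp.
  (* Division by [w] shifts the index in the linear term, so [s] is expanded one order further than
     its square. *)
  have -> : ((2 * 'i%C * (s y w / w) + conjc (qcont y) - qcont y * s y w ^+ 2) -
     \sum_(j < n.+1) coef_rhs j y * w ^+ j) / w ^+ n.+1 - coef_rhs n.+1 y =
     2 * 'i%C * ((s y w - \sum_(j < n.+3) a j y * w ^+ j) / w ^+ n.+2) -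
     qcont y * ((s y w ^+ 2 - \sum_(j < n.+2) cauchy_square (fun j => a j y) j * w ^+ j) / w ^+ n.+1).
    have eS : \sum_(j < n.+2) coef_rhs j y * w ^+ j =
       2 * 'i%C * (\sum_(j < n.+3) a j y * w ^+ j) / w + conjc (qcont y) -
       qcont y * \sum_(j < n.+2) cauchy_square (fun j => a j y) j * w ^+ j.
      rewrite [\sum_(j < n.+3) _]big_ord_recl /= expansion_coef0// mul0r add0r.
      rewrite mulr_sumr mulr_suml mulr_sumr [LHS]big_ord_recl [X in _ = X + _ - _]big_ord_recl
        [X in _ = _ - X]big_ord_recl.
      rewrite {1}/coef_rhs /= /bump /=.
      rewrite (eq_bigr (fun i : 'I_n.+1 => 2 * 'i%C * (a (1 + (1 + i))%N y * w ^+ (1 + (1 + i))) / w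
         - qcont y * (cauchy_square (fun j => a j y) (1 + i)%N * w ^+ (1 + i)))); last first.
        move=> i _; rewrite /coef_rhs /= !add1n /=.
        by rewrite [w ^+ i.+2]exprS; field.
      by rewrite sumrB addn0 expr0 expr1; field.
    have eD : coef_rhs n.+1 y = (\sum_(j < n.+2) coef_rhs j y * w ^+ j -
        \sum_(j < n.+1) coef_rhs j y * w ^+ j) / w ^+ n.+1.
      by rewrite [\sum_(j < n.+2) _]big_ord_recr /=; field; rewrite expf_neq0.
    rewrite eD eS [w ^+ n.+2]exprS.
    have wp0 : w ^+ n.+1 != 0 by rewrite expf_neq0.
    move: (w ^+ n.+1) wp0 (\sum_(j < n.+1) _) (\sum_(j < n.+3) _) (\sum_(j < n.+2) _).
    by move=> p pn S1 S2 S3; field; rewrite pn wn.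
  apply: (le_trans (nmB _ _)); rewrite /C [leRHS]mulrDl; apply: lerD.
    rewrite !nmM nm_i mulr1 nm_natr nmV nmX mulrA ler_pdivrMr ?exprn_gt0//.
    have := ler_wpM2l (ler0n R 2) (sE n.+3 y w y0 wn wr); move/le_trans; apply.
    by rewrite le_eqVlt; apply/orP; left; apply/eqP;
      rewrite exprMn [nm w ^+ n.+3]exprS; ring.
  rewrite nmM -[2 * k * _ * _]mulrA ler_pM ?nm_ge0//.
    rewrite /qcont !nmM nm_conj nm_i mulr1 nm_natr ler_wpM2l//.
    by have := an 1%N y y0; rewrite expr1.
  rewrite nmM nmV nmX ler_pdivrMr ?exprn_gt0//.
  have s1 : nm (s y w) <= 1 by case: (s_schur y0 wn (in_disc wr)).
  have := @cauchy_square_remainder R (fun j => a j y) w (s y w) k n.+2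
     (fun j => an j y y0) s1 (ltW kp) (fun N => sE N y w y0 wn wr).
  move/le_trans; apply.
  by rewrite le_eqVlt; apply/orP; left; apply/eqP;
    rewrite exprMn [nm w ^+ n.+2]exprS; ring.
Qed.

End Coefficients.

(** * Growth of the derivatives *)

Section DegreeClass.
Context {R : realType}.
Local Notation RC := (real_complex R).

Variables (k : R) (a : nat -> R -> R[i]).
Hypothesis a_bound : forall n x, 0 <= x -> nm (a n x) <= k ^+ n.
Hypothesis a_zero : forall x, 0 <= x -> a 0%N x = 0.
Hypothesis a_hder : forall n, hder (a n.+1) (fun x =>
  2 * 'i%C * a n.+2 x - 2 * 'i%C * conjc (a 1%N x) * cauchy_square (fun j => a j x) n.+1).

(* Combinations of monomials in the a_n and their conjugates, homogeneous of
   weight d when a_n has weight n, with coefficients of absolute sum C. *)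
Inductive weighted : nat -> R -> (R -> R[i]) -> Prop :=
| weighted_coef n : weighted n.+1 1 (a n.+1)
| weighted_conj n : weighted n.+1 1 (fun x => conjc (a n.+1 x))
| weighted_zero d : weighted d 0 (fun=> 0)
| weighted_add d C C' f g : weighted d C f -> weighted d C' g ->
    weighted d (C + C') (fun x => f x + g x)
| weighted_scale d C c f : weighted d C f -> weighted d (nm c * C) (fun x => c * f x)
| weighted_mul d d' C C' f g : weighted d C f -> weighted d' C' g ->
    weighted (d + d') (C * C') (fun x => f x * g x).

Lemma weighted_cast d d' C C' f : d = d' -> C = C' -> weighted d C f -> weighted d' C' f.
Proof. by move=> -> ->. Qed.

Lemma weighted_bound d C f : weighted d C f ->
  0 <= C /\ forall x, 0 <= x -> nm (f x) <= C * k ^+ d.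
Proof.
elim=> {d C f} [n|n|d|d C C' f g _ [C0 hf] _ [C'0 hg]|d C c f _ [C0 hf]|
    d d' C C' f g _ [C0 hf] _ [C'0 hg]].
- by split=> // x x0; rewrite mul1r a_bound.
- by split=> // x x0; rewrite mul1r nm_conj a_bound.
- by split=> // x _; rewrite nm0 mul0r.
- split; first exact: addr_ge0.
  by move=> x x0; rewrite mulrDl (le_trans (nmD _ _))// lerD ?hf ?hg.
- split; first by rewrite mulr_ge0 ?nm_ge0.
  by move=> x x0; rewrite nmM -mulrA ler_wpM2l ?nm_ge0 ?hf.
- split; first exact: mulr_ge0.
  move=> x x0; rewrite nmM exprD mulrACA.
  by rewrite ler_pM ?nm_ge0 ?hf ?hg.
Qed.

Lemma weighted_sum d m (f : nat -> R -> R[i]) : (forall i, (i < m)%N -> weighted d 1 (f i)) ->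
  weighted d m%:R (fun x => \sum_(i < m) f i x).
Proof.
elim: m => [|m IH] H.
  by under eq_fun do rewrite big_ord0; exact: weighted_zero.
under eq_fun do rewrite big_ord_recr /=.
rewrite -natr1; apply: weighted_add; last exact: H.
by apply: IH => i im; apply: H; rewrite ltnS ltnW.
Qed.

Lemma hder_eq (f g g' : R -> R[i]) : (forall x, 0 <= x -> g x = g' x) -> hder f g -> hder f g'.
Proof. by move=> gg df x x0; rewrite -gg//; exact: df. Qed.

(** The products with a factor [a 0] are gone, so that only generators of [weighted] occur and the
    sum has [n] terms. *)
Definition coef_rhs' n (x : R) : R[i] := 2 * 'i%C * a n.+2 x +
  - (2 * 'i%C) * (conjc (a 1%N x) * \sum_(i < n) a i.+1 x * a (n - i)%N x).

Lemma coef_hder' n : hder (a n.+1) (coef_rhs' n).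
Proof.
apply: hder_eq (@a_hder n) => x x0.
rewrite /coef_rhs' /cauchy_square big_ord_recl big_ord_recr /= subnn.
rewrite a_zero// mul0r mulr0 add0r addr0.
rewrite (eq_bigr (fun i : 'I_n => a i.+1 x * a (n - i)%N x)); first by ring.
by move=> i _; rewrite /bump /= add1n subSS.
Qed.

(** The coefficients add up to 2 + 2 n, twice the weight of [a n.+1]; this is where the factor in
    [weighted_der] comes from. *)
Lemma coef_rhs'_weighted n : weighted n.+2 (2 * n.+1%:R) (coef_rhs' n).
Proof.
apply: (@weighted_cast _ _ (nm (2 * 'i%C : R[i]) * 1 +
   nm (- (2 * 'i%C) : R[i]) * (1 * n%:R))) => //.
  by rewrite nmN nmM nm_i nm_natr -natr1; ring.
apply: weighted_add; apply: weighted_scale; first exact: weighted_coef.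
apply: (weighted_mul (d := 1) (d' := n.+1)); first exact: weighted_conj.
apply: (weighted_sum (f := fun i x => a i.+1 x * a (n - i)%N x)) => i im.
have := weighted_mul (weighted_coef i) (weighted_coef (n - i).-1).
rewrite prednK ?subn_gt0//; apply: weighted_cast; last by rewrite mulr1.
by rewrite addSn subnKC// ltnW.
Qed.

(** The factor 2 d holds for the generators and is additive in the weight, hence compatible with the
    Leibniz rule. *)
Lemma weighted_der d C f : weighted d C f ->
  exists2 g, weighted d.+1 (2 * d%:R * C) g & hder f g.
Proof.
elim=> {d C f} [n|n|d|d C C' f g _ [f' wf df] _ [g' wg dg]|d C c f _ [f' wf df]|
    d d' C C' f g wf [f' wf' df] wg [g' wg' dg]].
- exists (coef_rhs' n); last exact: coef_hder'.
  by rewrite mulr1; exact: coef_rhs'_weighted.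
- exists (fun x => 2 * 'i%C * (- conjc (a n.+2 x)) +
    2 * 'i%C * (a 1%N x * \sum_(i < n) conjc (a i.+1 x) * conjc (a (n - i)%N x))).
    apply: (@weighted_cast _ _ (nm (2 * 'i%C : R[i]) * (nm (-1 : R[i]) * 1) +
      nm (2 * 'i%C : R[i]) * (1 * n%:R))) => //.
      by rewrite nmN nmM nm_i nm_natr nm1 -natr1; ring.
    apply: weighted_add; apply: weighted_scale.
      under eq_fun do rewrite -mulN1r.
      by apply: weighted_scale; exact: weighted_conj.
    apply: (weighted_mul (d := 1) (d' := n.+1)); first exact: weighted_coef.
    apply: (weighted_sum (f := fun i x => conjc (a i.+1 x) * conjc (a (n - i)%N x))) => i im.
    have := weighted_mul (weighted_conj i) (weighted_conj (n - i).-1).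
    rewrite prednK ?subn_gt0//; apply: weighted_cast; last by rewrite mulr1.
    by rewrite addSn subnKC// ltnW.
  move=> x x0; have := der_conj (@conj_real R) (coef_hder' n x0); apply: derE.
  have -> : \sum_(i < n) conjc (a i.+1 x) * conjc (a (n - i)%N x) =
      conjc (\sum_(i < n) a i.+1 x * a (n - i)%N x).
    by rewrite rmorph_sum; apply: eq_bigr => i _; rewrite rmorphM.
  rewrite /coef_rhs'; set B := \sum_(i < n) _.
  have i2 : conjc (2 * 'i%C) = - (2 * 'i%C) :> R[i].
    by apply/eqP; rewrite eq_complex /=; apply/andP; split; apply/eqP; ring.
  have cM (u v : R[i]) : conjc (u * v) = conjc u * conjc v by exact: rmorphM.
  have cD (u v : R[i]) : conjc (u + v) = conjc u + conjc v by exact: rmorphD.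
  have cN (u : R[i]) : conjc (- u) = - conjc u by exact: rmorphN.
  rewrite cD cM i2 cM cN i2 cM conjcK; ring.
- exists (fun=> 0); first by rewrite mulr0; exact: weighted_zero.
  by move=> x x0; exact: der_cst.
- exists (fun x => f' x + g' x).
    by rewrite mulrDr; exact: weighted_add.
  by move=> x x0; apply: derD; [exact: df|exact: dg].
- exists (fun x => c * f' x).
    by rewrite mulrCA; exact: weighted_scale.
  by move=> x x0; apply: derZ; exact: df.
- exists (fun x => f' x * g x + f x * g' x).
    apply: (@weighted_cast _ _ ((2 * d%:R * C) * C' + C * (2 * d'%:R * C'))) => //.
      by rewrite natrD; ring.
    apply: weighted_add; first by have := weighted_mul wf' wg; rewrite addSn.
    by have := weighted_mul wf wg'; rewrite addnS.
  by move=> x x0; apply: derM => //; [exact: df|exact: dg].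
Qed.

Theorem derivative_sequence : exists g : nat -> R -> R[i],
  [/\ g 0%N = a 1%N, forall n, hder (g n) (g n.+1) &
    forall n x, 0 <= x -> nm (g n x) <= k * (n`!%:R * (2 * k) ^+ n)].
Proof.
have /choice[next hnext] : forall t : nat * R * (R -> R[i]), exists g,
    weighted t.1.1 t.1.2 t.2 -> weighted t.1.1.+1 (2 * t.1.1%:R * t.1.2) g /\ hder t.2 g.
  move=> [[d C] f] /=; have [/weighted_der[g h1 h2]|H] := pselect (weighted d C f).
    by exists g.
  by exists f.
(* The n-th derivative of [a 1] has weight n + 1, so the constants multiply to 2 * 1, 2 * 2, ..., 2
   * n. *)
pose g := fix g n : R -> R[i] :=
  if n is m.+1 then next (m.+1, 2 ^+ m * m`!%:R, g m) else a 1%N.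
have wg n : weighted n.+1 (2 ^+ n * n`!%:R) (g n).
  elim: n => [|n IH]; first by rewrite expr0 fact0 mulr1; exact: weighted_coef.
  have [h _] := hnext (n.+1, 2 ^+ n * n`!%:R, g n) IH.
  by apply: weighted_cast h => //=; rewrite exprS factS natrM; ring.
exists g; split => //.
  by move=> n; have [_] := hnext (n.+1, 2 ^+ n * n`!%:R, g n) (wg n).
move=> n x x0; have [_ h] := weighted_bound (wg n).
by rewrite (le_trans (h x x0))// le_eqVlt; apply/orP; left; apply/eqP;
  rewrite exprMn exprS; ring.
Qed.

End DegreeClass.

(** * Extension to a strip *)

Section Extension.
Context {R : realType}.
Local Notation RC := (real_complex R).

(** [A n] stands for the n-th derivative of [A 0]. A bound for every shift [k] lets the property
    pass to derivatives without loss of radius. *)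
Definition derivatives_bounded (h : R) (A : nat -> R -> R) :=
  (forall n, hder (fun x => (A n x)%:C) (fun x => (A n.+1 x)%:C)) /\
  (forall k, exists B, forall n x, 0 <= x -> `|A (k + n)%N x| * h ^+ n <= B * n`!%:R).

Lemma derivatives_boundedS h A : derivatives_bounded h A -> derivatives_bounded h (fun n => A n.+1).
Proof.
move=> [dA bA]; split=> [n|k]; first exact: dA.
by have [B hB] := bA k.+1; exists B => n x x0; rewrite -addSn hB.
Qed.

Definition taylor (A : nat -> R -> R) (x : R) (n : nat) : R[i] := (A n x / n`!%:R)%:C.

Lemma taylor_deriv A x : deriv_coef (taylor A x) = taylor (fun n => A n.+1) x.
Proof.
apply/funext => n; rewrite /deriv_coef /taylor -(rmorph_nat (RC)) -rmorphM.
congr (RC _); rewrite factS natrM; field.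
by rewrite pnatr_eq0 -lt0n fact_gt0 /= nat1r pnatr_eq0.
Qed.

Lemma taylor_bound h A : derivatives_bounded h A -> 0 < h ->
  exists B, forall x, 0 <= x -> coef_bound (taylor A x) h B.
Proof.
move=> [_ /(_ 0%N)[B hB]] h0; exists B => x x0 n.
rewrite nm_real normrM normfV [X in _ / X]ger0_norm// mulrAC ler_pdivrMr; last first.
  by rewrite ltr0n fact_gt0.
exact: hB.
Qed.

(* In the derivative of the Taylor polynomial with respect to its centre all
   terms but the last one cancel. *)
Lemma taylor_der_center h A z N x : derivatives_bounded h A -> 0 <= x ->
  der RC halfline (fun t => partial_sum (taylor A t) (z - RC t) N.+1) x
    ((A N.+1 x / N`!%:R)%:C * (z - RC x) ^+ N).
Proof.
move=> [dA _] x0.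
have dz : der RC halfline (fun t => z - RC t) x (0 - 1).
  by apply: derB; [exact: der_cst|exact: der_id].
elim: N => [|N IH].
  apply: (der_eq (f := fun t => RC (A 0%N t))) => //.
    by move=> t _; rewrite /partial_sum big_ord1 expr0 mulr1 /taylor fact0 divr1.
  by apply: derE (dA 0%N x x0); rewrite fact0 divr1 expr0 mulr1.
apply: (der_eq (f := fun t => partial_sum (taylor A t) (z - RC t) N.+1 +
   (N.+1`!%:R^-1)%:C * ((A N.+1 t)%:C * (z - RC t) ^+ N.+1))) => //.
  move=> t _; rewrite /partial_sum [RHS]big_ord_recr /=; congr (_ + _).
  by rewrite mulrA; congr (_ * _); rewrite -(rmorphM RC) mulrC.
have := derD IH (derZ (N.+1`!%:R^-1)%:C (derM (A := halfline) x0 (dA N.+1 x x0)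
  (derX N.+1 (A := halfline) x0 dz))).
apply: derE; rewrite !rmorphM /= factS natrM invfM !rmorphM /=.
have -> : (N.+1%:R^-1)%:C = (N.+1%:R)^-1 :> R[i] by rewrite fmorphV rmorph_nat.
rewrite exprS; set n := (N.+1)%:R : R[i]; have n0 : n != 0 by rewrite pnatr_eq0.
set p := _ ^+ N; move: (A N.+1 x)%:C (A N.+2 x)%:C (_^-1)%:C => u v c.
by clear -n0; field.
Qed.

Lemma nm_segment (z : R[i]) (x y t c : R) : x <= t <= y ->
  nm (z - RC x) <= c -> nm (z - RC y) <= c -> nm (z - RC t) <= c.
Proof.
move=> /andP[xt ty] hx hy.
have c0 : 0 <= c := le_trans (nm_ge0 _) hx.
have sq u : nm (z - RC u) ^+ 2 = (complex.Re z - u) ^+ 2 + complex.Im z ^+ 2.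
  by rewrite nm_sqr ReB ImB /= subr0.
have le2 u : nm (z - RC u) <= c -> (complex.Re z - u) ^+ 2 + complex.Im z ^+ 2 <= c ^+ 2.
  by rewrite -sq => h; rewrite ler_pXn2r ?nnegrE ?nm_ge0.
rewrite -(@ler_pXn2r _ 2%N) ?nnegrE ?nm_ge0// sq.
move/le2 : hx; move/le2 : hy; have [h|h] := leP t (complex.Re z).
  by move=> _; apply: le_trans; rewrite lerD2r ler_pXn2r// ?nnegrE; lra.
move=> + _; apply: le_trans; rewrite lerD2r -sqrrN -[leRHS]sqrrN.
by rewrite ler_pXn2r// ?nnegrE; lra.
Qed.

(** All centres between [x] and [y] are within [h / 4] of [z], so by [taylor_der_center] moving the
    centre changes the Taylor polynomial at [z] by a geometrically small amount. *)
Lemma psum_center h A z x y : derivatives_bounded h A -> 0 < h -> 0 <= x -> 0 <= y ->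
  nm (z - RC x) <= h / 4 -> nm (z - RC y) <= h / 4 ->
  psum (taylor A x) (z - RC x) = psum (taylor A y) (z - RC y).
Proof.
move=> gA h0; wlog xy : x y / x <= y => [H x0 y0 hx hy|x0 y0 hx hy].
  by have [|/ltW] := leP x y => xy; [apply: H|apply/esym/H].
have [B hB] := taylor_bound gA h0.
(* The shift by 1 is needed because the derivative of order N + 1 appears over the factorial of
   N. *)
have [B1 hB1] := gA.2 1%N.
have B10 : 0 <= B1.
  have := hB1 0%N 0 (lexx 0); rewrite fact0 !mulr1; exact: le_trans.
have key N : nm (partial_sum (taylor A y) (z - RC y) N.+1 -
    partial_sum (taylor A x) (z - RC x) N.+1) <= B1 / 2 ^+ N * (y - x).
  apply: (mean_value (f := fun t => partial_sum (taylor A t) (z - RC t) N.+1)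
    (f' := fun t => (A N.+1 t / N`!%:R)%:C * (z - RC t) ^+ N) xy).
    move=> t /andP[xt ty]; have t0 := le_trans x0 xt.
    apply: der_sub (taylor_der_center z N gA t0) => u /andP[xu _].
    exact: le_trans xu.
  move=> t txy; have t0 : 0 <= t by move/andP: txy => [xt _]; exact: le_trans xt.
  rewrite nmM nmX nm_real normrM normfV [X in _ / X * _]ger0_norm//.
  have ht := nm_segment txy hx hy.
  have h2 : nm (z - RC t) ^+ N <= (h / 2) ^+ N.
    by rewrite lerXn2r ?nnegrE ?nm_ge0//; lra.
  rewrite (le_trans (ler_wpM2l _ h2))// ?divr_ge0//.
  have := hB1 N t t0; rewrite add1n exprMn exprVn => hb.
  rewrite mulrA ler_wpM2r ?invr_ge0 ?exprn_ge0//.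
  by rewrite mulrAC ler_pdivrMr ?ltr0n ?fact_gt0.
apply/eqP; rewrite -subr_eq0 -nm_eq0 eq_le nm_ge0 andbT.
apply/ler_addgt0Pr => e e0; rewrite add0r.
have [N hN] := half_pow_le (4 * B + 4 * B + 2 * B1 * (y - x)) e0.
have P t : 0 <= t -> nm (z - RC t) <= h / 4 ->
    nm (psum (taylor A t) (z - RC t) - partial_sum (taylor A t) (z - RC t) N.+1) <=
    4 * B / 2 ^+ N.+1.
  by move=> t0 ht; apply: (psumP (hB t t0) h0); lra.
have := P x x0 hx; have := P y y0 hy; have := key N; have := hN _ (leqnSn N).
rewrite exprS invfM; set i2 := (2 ^+ N)^-1.
set px := psum (taylor A x) _; set py := psum (taylor A y) _.
set sx := partial_sum (taylor A x) _ _; set sy := partial_sum (taylor A y) _ _ => k0 k1 k2 k3.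
have -> : px - py = (px - sx) - (py - sy) - (sy - sx) by ring.
apply: le_trans (nmB _ _) _; have := nmB (px - sx) (py - sy); lra.
Qed.

(** The centre is the point of the half line nearest to [z]; by [psum_center] any other centre
    within [h / 4] gives the same value. *)
Definition extension A (z : R[i]) : R[i] :=
  psum (taylor A (Num.max 0 (complex.Re z))) (z - RC (Num.max 0 (complex.Re z))).

Lemma extensionE h A z x : derivatives_bounded h A -> 0 < h -> 0 <= x -> nm (z - RC x) <= h / 4 ->
  extension A z = psum (taylor A x) (z - RC x).
Proof.
move=> gA h0 x0 hx; apply: (psum_center gA) => //; first by rewrite le_max lexx.
apply: le_trans hx; rewrite -(@ler_pXn2r _ 2%N) ?nnegrE ?nm_ge0//.
rewrite !nm_sqr !ReB !ImB /= lerD2r; have [z0|z0] := leP 0 (complex.Re z).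
  by rewrite subrr expr0n sqr_ge0.
by rewrite subr0 -sqrrN -[leRHS]sqrrN ler_pXn2r// ?nnegrE; lra.
Qed.

Lemma extension_der h A z x : derivatives_bounded h A -> 0 < h -> 0 <= x -> nm (z - RC x) < h / 4 ->
  der id setT (extension A) z (extension (fun n => A n.+1) z).
Proof.
move=> gA h0 x0 hx; have [B hB] := taylor_bound gA h0.
have gap : 0 < h / 4 - nm (z - RC x) by rewrite subr_gt0.
rewrite (extensionE (derivatives_boundedS gA) h0 x0 (ltW hx)) -taylor_deriv.
apply: (@der_local _ _ _ _ (fun y => psum (taylor A x) (y - RC x)) _ _ _ _ gap I).
  move=> y _ yz; rewrite (extensionE gA h0 x0)// ltW//.
  have := nmD (y - z) (z - RC x); rewrite addrA subrK; lra.
have dz : der id setT (fun y : R[i] => y - RC x) z (1 - 0).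
  by apply: derB; [exact: der_id|exact: der_cst].
have := der_comp (h := fun y : R[i] => y - RC x) (B := setT) _ dz (psum_der h0 (hB x x0) hx).
by rewrite subr0 mulr1; apply.
Qed.

Lemma extension_real h A (t x : R) : derivatives_bounded h A -> 0 < h -> 0 <= x ->
  `|t - x| <= h / 4 ->
  forall n, `|complex.Re (extension A (RC t)) -
    \sum_(k < n) A k x / k`!%:R * (t - x) ^+ k| <= nm (extension A (RC t) -
      partial_sum (taylor A x) (RC t - RC x) n) /\
    `|complex.Im (extension A (RC t))| <= nm (extension A (RC t) -
      partial_sum (taylor A x) (RC t - RC x) n).
Proof.
move=> gA h0 x0 hx n.
have -> : partial_sum (taylor A x) (RC t - RC x) n =
    RC (\sum_(k < n) A k x / k`!%:R * (t - x) ^+ k).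
  rewrite rmorph_sum; apply: eq_bigr => k _.
  by rewrite -rmorphB -rmorphXn -rmorphM.
set E := extension _ _; set S := \sum_(_ < _) _; split.
  by apply: le_trans (nm_Re _); rewrite ReB.
by apply: le_trans (nm_Im _); rewrite ImB /= subr0.
Qed.

Lemma extension_limit h A (t x : R) : derivatives_bounded h A -> 0 < h -> 0 <= x ->
  `|t - x| <= h / 4 -> exists B, forall n,
   nm (extension A (RC t) - partial_sum (taylor A x) (RC t - RC x) n) <= B / 2 ^+ n.
Proof.
move=> gA h0 x0 hx; have [B hB] := taylor_bound gA h0; exists (4 * B) => n.
rewrite (extensionE gA h0 x0) ?nm_RCB//; apply: (psumP (hB x x0) h0).
by rewrite nm_RCB; lra.
Qed.

Definition real_extension A (t : R) : R := complex.Re (extension A (RC t)).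

Lemma real_extensionE h A (t x : R) : derivatives_bounded h A -> 0 < h -> 0 <= x ->
  `|t - x| <= h / 4 -> extension A (RC t) = RC (real_extension A t).
Proof.
move=> gA h0 x0 hx; apply/eqP; rewrite eq_complex eqxx /= -normr_eq0 eq_le normr_ge0 andbT.
apply/ler_addgt0Pr => e e0; rewrite add0r.
have [B hB] := extension_limit gA h0 x0 hx; have [N hN] := half_pow_le B e0.
have [_] := extension_real gA h0 x0 hx N.
by move/le_trans; apply; rewrite (le_trans (hB N))// hN.
Qed.

Lemma real_extension0 h A x : derivatives_bounded h A -> 0 < h -> 0 <= x ->
  real_extension A x = A 0%N x.
Proof.
move=> gA h0 x0; have [B hB] := taylor_bound gA h0; rewrite /real_extension.
rewrite (extensionE gA h0 x0) subrr ?nm0 ?divr_ge0 ?ltW//.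
by rewrite (psum0 (hB x x0) h0) /taylor fact0 divr1.
Qed.

(** Points slightly to the left of 0 are included, since [derive1n] at 0 refers to two-sided
    derivatives. *)
Lemma real_extension_derive h A (t : R) : derivatives_bounded h A -> 0 < h -> - (h / 4) < t ->
  is_derive t 1 (real_extension A) (real_extension (fun n => A n.+1) t).
Proof.
move=> gA h0 ht; set x := Num.max 0 t.
have x0 : 0 <= x by rewrite le_max lexx.
have hx : nm (RC t - RC x) < h / 4.
  rewrite nm_RCB /x; have [t0|t0] := leP 0 t; first by rewrite subrr normr0 divr_gt0.
  by rewrite subr0 ltr0_norm//; lra.
have dE := extension_der gA h0 x0 hx.
apply: (@der_is_derive _ _ _ _ setT 1) => //.
apply: der_Re.
have := der_comp (h := RC) (B := setT) _ (der_id RC setT t) dE.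
by rewrite mulr1; apply.
Qed.

Lemma real_extension_deriven h A n : 0 < h -> derivatives_bounded h A -> forall t, - (h / 4) < t ->
  derive1n n (real_extension A) t = real_extension (fun m => A (n + m)%N) t.
Proof.
move=> h0; elim: n A => [|n IH] A gA t ht; first by [].
rewrite derive1nS derive1E.
have gn : derivatives_bounded h (fun m => A (n + m)%N).
  elim: n {IH} => [|n IH] //; have := derivatives_boundedS IH.
  by under eq_fun do rewrite addnS.
have := real_extension_derive gn h0 ht => dn.
have -> : (fun m => A (n.+1 + m)%N) = (fun m => A (n + m.+1)%N).
  by apply/funext => m; rewrite addSnnS.
apply: (@derive_val _ _ _ _ _ _ _ _); apply: eps_is_derive => e e0.
have [d d0 hd] := is_derive_eps dn e0.
have t4 : 0 < h / 4 + t by lra.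
exists (Num.min d (h / 4 + t)); first by rewrite lt_min d0.
move=> y; rewrite lt_min => /andP[yd yt].
have hy : - (h / 4) < y by move: yt; rewrite ltr_norml; lra.
by rewrite !IH// hd.
Qed.

Lemma real_extension_analytic h A x : derivatives_bounded h A -> 0 < h -> 0 <= x ->
  real_analytic_at (real_extension A) x.
Proof.
move=> gA h0 x0; exists (fun n => A n x / n`!%:R), (h / 4); first by rewrite divr_gt0.
move=> t tx.
have hx : `|x + t - x| <= h / 4 by rewrite addrAC subrr add0r ltW.
have [B hB] := extension_limit gA h0 x0 hx.
apply/cvgrPdist_le => e e0; have [N hN] := half_pow_le B e0.
exists N => // n /= Nn; have [h1 _] := extension_real gA h0 x0 hx n.
rewrite /pseries /series /= big_mkord.
rewrite (_ : x + t - x = t) in h1; last by ring.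
by rewrite (le_trans h1)// (le_trans (hB n))// hN.
Qed.

End Extension.

(** Separates the shift from the order of the derivative in [derivatives_bounded]; the power of 2
    reduces the radius from 1/(2 k) to 1/(4 k). *)
Lemma fact_add_le m n : ((m + n)`! <= 2 ^ (m + n) * (m`! * n`!))%N.
Proof.
have bin_le k j : ('C(k, j) <= 2 ^ k)%N.
  elim: k j => [|k IH] [|j] //; rewrite ?bin0 ?expn_gt0//.
  by rewrite binS expnS mul2n -addnn leq_add.
have := bin_fact (leq_addr n m); rewrite addKn => <-.
by rewrite leq_mul2r bin_le orbT.
Qed.

(** * Bounds for the potential and conclusion *)

Section Conclusion.
Context {R : realType}.
Local Notation RC := (real_complex R).
Local Notation mu := (@lebesgue_measure R).

Lemma derivatives_bounded_Re (g : nat -> R -> R[i]) (k c : R) (d : R[i]) : 0 < k -> 0 < c ->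
  (forall n, hder (g n) (g n.+1)) ->
  (forall n x, 0 <= x -> nm (g n x) <= c * (n`!%:R * (2 * k) ^+ n)) ->
  derivatives_bounded (4 * k)^-1 (fun n x => complex.Re (d * g n x)).
Proof.
move=> k0 c0 dg bg; split=> [n x x0|m].
  by apply: der_Re; apply: derZ; exact: dg.
exists (nm d * c * m`!%:R * (4 * k) ^+ m) => n x x0.
have h0 : 0 <= (4 * k)^-1 ^+ n by rewrite exprn_ge0// invr_ge0 mulr_ge0// ltW.
apply: le_trans (ler_wpM2r h0 (nm_Re _)) _.
rewrite nmM -[leLHS]mulrA [leRHS](_ : _ = nm d * (c * ((4 * k) ^+ m * (m`! * n`!)%:R))); last first.
  by rewrite natrM; ring.
rewrite ler_wpM2l ?nm_ge0// (le_trans (ler_wpM2r h0 (bg _ _ x0)))// -[leLHS]mulrA.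
rewrite ler_wpM2l ?(ltW c0)//.
have fl : (m + n)`!%:R <= 2 ^+ (m + n) * (m`! * n`!)%:R :> R.
  by rewrite -natrX -natrM ler_nat fact_add_le.
have e0 : 0 <= (2 * k) ^+ (m + n) by rewrite exprn_ge0// mulr_ge0// ltW.
apply: le_trans (ler_wpM2r h0 (ler_wpM2r e0 fl)) _.
have -> : 4 * k = 2 * (2 * k) by ring.
have n0 : (2 * k) ^+ n != 0 by rewrite expf_neq0// gt_eqF// mulr_gt0.
have n1 : 2 ^+ n != 0 :> R by rewrite expf_neq0.
move: n0; move: (2 * k) => c' n0.
rewrite exprVn !(exprMn _ 2 c') !exprD le_eqVlt; apply/orP; left; apply/eqP.
by field; rewrite n0 n1.
Qed.

Lemma ord2 (i : 'I_2) : i = 0 \/ i = 1.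
Proof. by case: i => [[|[|]]// ?]; [left|right]; apply: val_inj. Qed.

Lemma operator_norm_le (A : 'M[R]_2) (b : R) : (forall i j, `|A i j| <= b) ->
  operator_norm A <= 4 * b.
Proof.
move=> Ab; have b0 : 0 <= b := le_trans (normr_ge0 _) (Ab 0 0).
apply: ge_sup.
  exists (euclidean_norm (A *m 0)), 0 => //=.
  by rewrite /euclidean_norm big1 ?sqrtr0// => i _; rewrite mxE expr0n.
move=> _ [v v1 <-].
have vj j : `|v j 0| <= 1.
  rewrite -(@ler_pXn2r _ 2%N) ?nnegrE// expr1n real_normK ?num_real//.
  have S1 : \sum_(i < 2) v i 0 ^+ 2 <= 1.
    move: v1; rewrite /= /euclidean_norm -{1}[1]sqrtr1 ler_sqrt//.
  apply: le_trans S1; rewrite sum2; case: (ord2 j) => ->.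
    by rewrite lerDl sqr_ge0.
  by rewrite lerDr sqr_ge0.
rewrite /euclidean_norm.
have ci i : (A *m v) i 0 ^+ 2 <= (2 * b) ^+ 2.
  rewrite -[leLHS]real_normK ?num_real// lerXn2r ?nnegrE ?mulr_ge0//.
  rewrite mxE sum2 (le_trans (ler_normD _ _))// !normrM mulr2n mulrDl !mul1r.
  by rewrite lerD// -[leRHS]mulr1 ler_pM.
have : \sum_(i < 2) (A *m v) i 0 ^+ 2 <= (4 * b) ^+ 2.
  rewrite sum2; have := ci 0; have := ci 1; have : 0 <= b ^+ 2 by exact: sqr_ge0.
  by rewrite !exprMn; lra.
rewrite -(@ler_sqrt _ _ ((4 * b) ^+ 2)) ?sqr_ge0// sqrtr_sqr ger0_norm//.
by rewrite mulr_ge0.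
Qed.

Variables (W : R -> 'M[R]_2) (r : R) (M : R[i] -> sphere R).
Hypothesis W_potential : dirac_potential W.
Hypothesis W_traceless : {ae mu, forall x : R, 0 <= x -> \tr (W x) = 0}.
Hypothesis r_gt0 : 0 < r.
Hypothesis M_range : forall w : R[i], `|w| < r%:C -> closed_upper_half_plane R (M w).
Hypothesis M_holomorphic : forall w : R[i], `|w| < r%:C -> sphere_holomorphic_at M w.
Hypothesis m_plusE : forall z : R[i], upper_half_plane R z -> (1 / r)%:C < `|z| ->
  m_plus W z = M (-1 / z).

Lemma weyl_at_infinity w : nm w < r -> 0 < complex.Im w ->
  exists u v : R -> R[i], [/\ dsol (potential W) (- w^-1) u v,
     (exists2 x, 0 <= x & ~ (u x = 0 /\ v x = 0)),
     forall x, 0 <= x -> nm (v x) <= nm (u x) & v 0 = cay (M w) * u 0].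
Proof.
move=> wr wI; have wn : w != 0 by apply/eqP => w0; move: wI; rewrite w0 /= ltxx.
have wn0 : 0 < nm w by rewrite nm_gt0.
have zI : 0 < complex.Im (- w^-1) by rewrite Im_Ninv// divr_gt0// exprn_gt0.
apply: weyl_of_m_plus => //; first exact: ltW.
  rewrite m_plusE//; first by congr M; field.
  by rewrite normrE_nm ltcR nmN nmV div1r ltf_pV2.
by apply: M_range; rewrite normrE_nm ltcR.
Qed.

(* [a 1] is the limit of [(s w - s 0) / w] at 0, and [2 i conj (a 1)] the potential. *)
Lemma potential_derivatives : exists (k : R) (g : nat -> R -> R[i]),
  [/\ 0 < k, {ae mu, forall x, 0 <= x -> conjc (potential W x) = - (2 * 'i%C * g 0%N x)},
    forall n, hder (g n) (g n.+1) &
    forall n x, 0 <= x -> nm (g n x) <= k * (n`!%:R * (2 * k) ^+ n)].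
Proof.
have qL := potential_L1 W_potential.
have Mr w : nm w < r -> closed_upper_half_plane R (M w).
  by move=> wr; apply: M_range; rewrite normrE_nm ltcR.
have [|||s [schur riccati]] := @schur_flow _ (potential W) r (cay \o M) qL r_gt0.
- move=> w _ wr; apply: cay_holo; last exact: Mr.
  by apply: M_holomorphic; rewrite normrE_nm ltcR.
- by move=> w /Mr; exact: nm_cay.
- exact: weyl_at_infinity.
have [a aE] := expansion_exists r_gt0 schur.
have k0 : 0 < 2 / r by rewrite divr_gt0.
have [||g [g0 dg bg]] := @derivative_sequence _ (2 / r) a aE.1.
- move=> x x0; exact (expansion_coef0 qL r_gt0 schur riccati aE x0).
- move=> n; apply: hder_eq (coef_hder qL r_gt0 schur riccati aE n.+1) => x x0.
  by rewrite /coef_rhs /qcont /= addr0.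
exists (2 / r), g; split => //; rewrite g0.
exact: (expansion_coef1 qL r_gt0 schur riccati aE).
Qed.

End Conclusion.

Theorem theorem5p1 (R : realType) (W : R -> 'M[R]_2) (r : R)
    (M : R[i] -> sphere R)
    (W_potential : dirac_potential W)
    (W_traceless : {ae @lebesgue_measure R, forall x : R, 0 <= x -> \tr (W x) = 0})
    (r_gt0 : 0 < r)
    (M_range : forall w : R[i], `|w| < r%:C -> closed_upper_half_plane R (M w))
    (M_holomorphic : forall w : R[i], `|w| < r%:C -> sphere_holomorphic_at M w)
    (m_plusE : forall z : R[i], upper_half_plane R z -> (1 / r)%:C < `|z| ->
       m_plus W z = M (-1 / z)) :
  exists V : R -> 'M[R]_2,
    [/\ {ae @lebesgue_measure R, forall x : R, 0 <= x -> V x = W x},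
        forall (i j : 'I_2) (x : R), 0 <= x ->
          real_analytic_at (fun t : R => V t i j) x,
        exists2 h : R, 0 < h &
          exists F : R[i] -> 'M[R[i]]_2,
            (forall (i j : 'I_2) (z : R[i]), rounded_strip h z ->
               holomorphic_at (fun u : R[i] => F u i j) z) /\
            (forall x : R, rounded_strip h x%:C ->
               F x%:C = map_mx (real_complex R) (V x)) &
        forall n : nat, exists B : R, forall x : R, 0 <= x ->
          operator_norm (mxderiven n V x) <= B].

Proof.
have [k [g [k0 qg dg bg]]] :=
  potential_derivatives W_potential W_traceless r_gt0 M_range M_holomorphic m_plusE.
(* [q = - W01 + i W00 = 2 i conj (g 0)] determines the entries of W. *)
pose d (i j : 'I_2) : R[i] := if i == j then (if i == 0 then 2 else - 2) else 2 * 'i%C.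
pose A i j n x := complex.Re (d i j * g n x).
have gA i j : derivatives_bounded (4 * k)^-1 (A i j) by exact: derivatives_bounded_Re dg bg.
have h0 : 0 < (4 * k)^-1 by rewrite invr_gt0 mulr_gt0.
pose V t := \matrix_(i, j) real_extension (A i j) t.
have VE i j : (fun t => V t i j) = real_extension (A i j).
  by apply/funext => t; rewrite mxE.
exists V; split.
- have [_ sym] := W_potential.
  apply: filterS3 qg sym W_traceless; first exact: (ae_filter_ringOfSetsType (@lebesgue_measure R)).
  move=> x qx symx trx x0; move: (qx x0) => {qx} /eqP; rewrite eq_complex /potential.
  have := congr1 (fun B : 'M[R]_2 => B 0 1) (symx x0); rewrite mxE => w10.
  have := trx x0; rewrite /mxtrace sum2 => w11 /andP[/eqP w01 /eqP w00].
  apply/matrixP => i j; rewrite mxE (real_extension0 (gA i j) h0 x0) /A /d.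
  move: w00 w01; case: (g 0%N x) => p q /= w00 w01.
  by case: (ord2 i) => ->; case: (ord2 j) => -> /=; lra.
- by move=> i j x x0; rewrite VE; exact: real_extension_analytic (gA i j) h0 x0.
(* [extension_der] works within a quarter of the radius of the derivative bounds. *)
- exists ((4 * k)^-1 / 4); first by rewrite divr_gt0.
  exists (fun z => \matrix_(i, j) extension (A i j) z); split.
    move=> i j z [x x0]; rewrite normrE_nm ltcR => zx.
    under eq_fun do rewrite mxE.
    exact: der_holomorphic (extension_der (gA i j) h0 (ltW x0) zx).
  move=> t [x x0]; rewrite normrE_nm ltcR nm_RCB => /ltW tx.
  apply/matrixP => i j; rewrite !mxE.
  exact: real_extensionE (gA i j) h0 (ltW x0) tx.
- move=> n; have /choice[b hb] : forall ij : 'I_2 * 'I_2, exists b, forall x, 0 <= x ->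
      `|A ij.1 ij.2 n x| <= b.
    move=> [i j] /=; have [B hB] := (gA i j).2 n; exists B => x x0.
    by have := hB 0%N x x0; rewrite addn0 fact0 !mulr1.
  (* The sum dominates the bounds of all four entries at once; 4 is the constant of
     [operator_norm_le]. *)
  exists (4 * \sum_ij `|b ij|) => x x0; apply: operator_norm_le => i j.
  rewrite mxE VE (real_extension_deriven n h0 (gA i j)); last first.
    by rewrite (lt_le_trans _ x0)// oppr_lt0 divr_gt0.
  have gn : derivatives_bounded (4 * k)^-1 (fun m => A i j (n + m)%N).
    elim: n {hb b} => [|n IH]; first exact: gA.
    have := derivatives_boundedS IH.
    by under eq_fun do rewrite addnS.
  rewrite (real_extension0 gn h0 x0) addn0 (le_trans (hb (i, j) x x0))//.
  rewrite (le_trans (ler_norm _))// (bigD1 (i, j))//= lerDl.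
  by apply: sumr_ge0 => *; exact: normr_ge0.
Qed.
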